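(* Let $\Omega\subset\mathbb{R}^n$ be open, $T>0$, and let $$H(t,x,p)=\tfrac12\langle A(t,x)p,p\rangle+V(t,x),\qquad (t,x)\in[0,T]\times\Omega,\ p\in\mathbb{R}^n,$$ where $V:[0,T]\times\Omega\to\mathbb{R}$ is of class $C^2$ and $A(t,x)$ is a family of symmetric positive definite matrices with $C^2$ coefficients such that, as quadratic forms, $c_1I<A(t,x)<c_2I$ for every $(t,x)\in[0,T]\times\Omega$, for suitable positive constants $c_1,c_2$. Let $u_0:\Omega\to\mathbb{R}$ be locally Lipschitz continuous, and let $u:[0,T[\times\Omega\to\mathbb{R}$ be a continuous viscosity solution of $$\partial_t u+H(t,x,D_xu)=0 \ \text{ in } ]0,T[\times\Omega,\qquad u(0,x)=u_0(x)\ \text{ in }\Omega.$$ Let $y_0\in\Omega$ be such that the proximal subdifferential $D^-_{pr}u_0(y_0)$ is empty. Then there exists a generalized characteristic $\gamma:[0,\sigma[\to\Omega$ associated with $u$ (for some $\sigma>0$) starting from $(0,y_0)$, i.e. $\gamma(0)=y_0$, such that $u$ is not differentiable at $(t,\gamma(t))$ for all $t\in\,]0,\sigma[$.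
   Context: Notation: $]a,b[$ and $[a,b[$ denote open and right-open intervals. Proximal subdifferential: given $K>0$, a vector $p_0\in\mathbb{R}^n$ is a proximal $K$-subgradient of $v:\Omega\to\mathbb{R}$ at $x_0\in\Omega$ if $v(x)\ge v(x_0)+\langle p_0,x-x_0\rangle-\frac K2|x-x_0|^2$ for all $x$ in a neighbourhood of $x_0$. $D^-_{pr}v(x_0)$ is the set of all $p_0$ that are proximal $K$-subgradients of $v$ at $x_0$ for some $K>0$. The (Fréchet) superdifferential in space is $D^+_xu(t,x)=\{p\in\mathbb{R}^n:\ \limsup_{y\to x}\frac{u(t,y)-u(t,x)-\langle p,y-x\rangle}{|y-x|}\le 0\}$. A generalized characteristic associated with $u$ is a Lipschitz curve $\gamma:[t_0,t_1]\to\Omega$, with $(t,\gamma(t))\in[0,T[\times\Omega$, such that $\dot\gamma(t)\in \mathrm{co}\, D_pH(t,\gamma(t),D^+_xu(t,\gamma(t)))$ for a.e. $t\in[t_0,t_1]$ (co = convex hull); for the present $H$ this reads $\dot\gamma(t)\in A(t,\gamma(t))D^+_xu(t,\gamma(t))$. A curve on $[0,\sigma[$ is a generalized characteristic if its restriction to every compact subinterval is one. *)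

(* Defs.v *)
From HB Require Import structures.
From mathcomp Require Import all_boot all_order all_algebra.
From mathcomp Require Import all_classical all_reals all_analysis.

Set Implicit Arguments.
Unset Strict Implicit.
Unset Printing Implicit Defensive.

Import Order.TTheory GRing.Theory Num.Theory.
Import numFieldNormedType.Exports.

Local Open Scope classical_set_scope.
Local Open Scope ring_scope.

(* Vectors of R^n are row vectors.  The library norm `|x| on 'rV[R]_n is the sup
   norm; it is only used for notions invariant under equivalence of norms
   (topology, differentiability, Lipschitz continuity).  The Euclidean structure
   is given by dotv and enorm.  Functions on a subset of R x R^n are represented
   by total functions; only their values on that subset matter. *)

Section Euclidean.
Context {R : realType} {n : nat}.
Implicit Types (p q x : 'rV[R]_n) (M N : 'M[R]_n).

Definition dotv p q : R := \sum_(i < n) p ord0 i * q ord0 i.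

Definition enorm p : R := Num.sqrt (dotv p p).

(* The matrix-vector product M p, with p and M p written as rows. *)
Definition mxact M p : 'rV[R]_n := p *m M^T.

Definition form_lt M N : Prop :=
  forall p, p != 0 -> dotv (mxact M p) p < dotv (mxact N p) p.

Definition sym_posdef M : Prop := M^T = M /\ form_lt 0 M.

Definition grad (f : 'rV[R]_n -> R) x : 'rV[R]_n :=
  \row_(i < n) 'D_(delta_mx ord0 i) (f : 'rV[R]_n -> R^o) x.

Definition co (S : set 'rV[R]_n) : set 'rV[R]_n :=
  [set q | forall C : set 'rV[R]_n, convex_set C -> S `<=` C -> C q].

End Euclidean.

(* Class C^k on an open subset U of a finite-dimensional space V: in finite
   dimension, continuity of x |-> 'd f x amounts to continuity of
   x |-> 'D_v f x for every direction v. *)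
Fixpoint Ck {R : realType} {V : normedModType R} (k : nat) (U : set V)
    (f : V -> R^o) : Prop :=
  match k with
  | 0 => {in U, continuous f}
  | k'.+1 => {in U, forall x, differentiable f x} /\
             forall v : V, Ck k' U ('D_v f)
  end.

(* Class C^k on a set D that need not be open, such as [0,T] x Omega:
   restriction to D of a C^k function on an open set containing D. *)
Definition Ck_on {R : realType} {V : normedModType R} (k : nat) (D : set V)
    (f : V -> R) : Prop :=
  exists (U : set V) (g : V -> R^o),
    [/\ open U, D `<=` U, Ck k U g & {in D, forall x, g x = f x}].

Section HamiltonJacobi.
Context {R : realType} {n : nat}.
Implicit Types (T : R) (Om : set 'rV[R]_n) (z : R * 'rV[R]_n)
  (x p : 'rV[R]_n) (u : R * 'rV[R]_n -> R) (H : R * 'rV[R]_n -> 'rV[R]_n -> R).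

Definition hamiltonian (A : R * 'rV[R]_n -> 'M[R]_n) (V : R * 'rV[R]_n -> R)
    z p : R :=
  2^-1 * dotv (mxact (A z) p) p + V z.

Definition locally_lipschitz Om (v : 'rV[R]_n -> R) : Prop :=
  forall x, Om x -> exists2 W : set 'rV[R]_n,
    nbhs x W & [lipschitz (v y : R^o) | y in W].

Definition proximal_subgradient (K : R) (v : 'rV[R]_n -> R) x0 p0 : Prop :=
  \forall x \near x0,
    v x0 + dotv p0 (x - x0) - K / 2 * enorm (x - x0) ^+ 2 <= v x.

Definition proximal_subdiff (v : 'rV[R]_n -> R) x0 : set 'rV[R]_n :=
  [set p0 | exists2 K : R, 0 < K & proximal_subgradient K v x0 p0].

Definition superdiff_x u z : set 'rV[R]_n :=
  [set p | (limf_esup (fun y => ((u (z.1, y) - u z - dotv p (y - z.2))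
                                  / enorm (y - z.2))%:E) (z.2)^' <= 0)%E].

Definition dt (phi : R * 'rV[R]_n -> R) z : R :=
  'D_(1, 0) (phi : R * 'rV[R]_n -> R^o) z.

Definition grad_x (phi : R * 'rV[R]_n -> R) z : 'rV[R]_n :=
  grad (fun x => phi (z.1, x)) z.2.

(* Viscosity sub- and supersolutions of dt u + H(t,x,D_x u) = 0 in the open set
   Q, in the sense of Crandall and Lions: C^1 test functions touching u at a
   local maximum, resp. minimum, of u - phi. *)
Definition visc_subsol (Q : set (R * 'rV[R]_n)) H u : Prop :=
  forall phi : R * 'rV[R]_n -> R, Ck 1 Q phi ->
  forall z, Q z -> (\forall z' \near z, u z' - phi z' <= u z - phi z) ->
  dt phi z + H z (grad_x phi z) <= 0.

Definition visc_supersol (Q : set (R * 'rV[R]_n)) H u : Prop :=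
  forall phi : R * 'rV[R]_n -> R, Ck 1 Q phi ->
  forall z, Q z -> (\forall z' \near z, u z - phi z <= u z' - phi z') ->
  0 <= dt phi z + H z (grad_x phi z).

Definition cont_visc_sol T Om H (u0 : 'rV[R]_n -> R) u : Prop :=
  [/\ {within `[0, T[ `*` Om, continuous u},
      visc_subsol (`]0, T[ `*` Om) H u,
      visc_supersol (`]0, T[ `*` Om) H u
    & forall x, Om x -> u (0, x) = u0 x].

Definition gen_char T Om H u (gamma : R -> 'rV[R]_n) (t0 t1 : R) : Prop :=
  [/\ [lipschitz gamma t | t in `[t0, t1]],
      forall t, t \in `[t0, t1] -> (`[0, T[ `*` Om) (t, gamma t)
    & {ae @lebesgue_measure R, forall t, t \in `[t0, t1] ->
        derivable gamma t 1 /\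
        co (grad (H (t, gamma t)) @` superdiff_x u (t, gamma t))
           (derive1 gamma t)}].

Definition gen_char_ico T Om H u (gamma : R -> 'rV[R]_n) (sigma : R) : Prop :=
  forall t0 t1, 0 <= t0 -> t0 <= t1 -> t1 < sigma ->
  gen_char T Om H u gamma t0 t1.

End HamiltonJacobi.

(* Main.v *)
(* Comparison along short segments shows that, near y0 and for small positive
   times, u is Lipschitz in space and semiconcave in space-time; no minimizing
   curve is needed. An Euler scheme that follows a momentum p in D^+_x u with
   velocity A p then converges to a generalized characteristic gamma starting
   from (0, y0). If u is differentiable at (t, gamma(t)), the supergradient
   there is unique, so the approximate momenta of the scheme are close to it
   near that point. Take the bound
     u(s, gamma(s) + w) >= u(s, gamma(s)) - a + <p, w>
                           - (1 / (2 (t - s)) + K0) <A(t, gamma(t))^-1 w, w>,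
   void in the limit s -> t since the paraboloid becomes infinitely sharp. The
   equation propagates it backwards in time, with p transported along gamma and
   a controlled by a Gronwall argument; the differentiability at the final time
   makes a vanish. At s = 0 it says that p is a proximal subgradient of u0 at
   y0, so none of the points (t, gamma(t)) can be a differentiability point. *)
Require Import Defs.
From HB Require Import structures.
From mathcomp Require Import all_boot all_order all_algebra.
From mathcomp Require Import all_classical all_reals all_analysis.
From mathcomp Require Import ring lra.

Set Implicit Arguments.
Unset Strict Implicit.
Unset Printing Implicit Defensive.

Import Order.TTheory GRing.Theory Num.Theory.
Import numFieldNormedType.Exports.

Local Open Scope classical_set_scope.
Local Open Scope ring_scope.

(** The Gronwall argument is borderline. With [r = t - s], a paraboloid below [u] and one above it
    limit the growth of the vertex depth to [a' <= a / r + E a], and [a = e r exp(E r)] solves the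
    equality with [a(0) = 0] for every [e]. Zero initial depth is thus not enough: [a] must be
    [o(r)], and uniqueness of the supergradient at time [t] provides this. The coefficient of
    [a / r] has to be exactly 1, so the opening of the paraboloid must be the sharp [1 / (2 r)] in
    the metric frozen at the final point, up to a bounded constant. There is no lateral boundary
    condition and no a priori bound on momenta. Chains of almost optimal steps are therefore
    controlled by their kinetic energy, which telescopes against [u], and not by their speed.
    Semiconcavity degenerates like [C / t^2] at time 0. The propagation first runs down to a
    positive time [de], with [E] depending on [de]; only when the depth has been sent to 0 there
    does [de] tend to 0. *)

Section Vectors.
Context {R : realType} {n : nat}.
Implicit Types (p q x y : 'rV[R]_n) (M : 'M[R]_n).

Lemma dotvC p q : dotv p q = dotv q p.
Proof. by apply: eq_bigr => i _; rewrite mulrC. Qed.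

Lemma dotvDl p q x : dotv (p + q) x = dotv p x + dotv q x.
Proof. by rewrite -big_split; apply: eq_bigr => i _; rewrite mxE mulrDl. Qed.

Lemma dotvDr p q x : dotv x (p + q) = dotv x p + dotv x q.
Proof. by rewrite dotvC dotvDl !(dotvC x). Qed.

Lemma dotvZl a p x : dotv (a *: p) x = a * dotv p x.
Proof. by rewrite mulr_sumr; apply: eq_bigr => i _; rewrite mxE mulrA. Qed.

Lemma dotvZr a p x : dotv x (a *: p) = a * dotv x p.
Proof. by rewrite dotvC dotvZl dotvC. Qed.

Lemma dotvNl p x : dotv (- p) x = - dotv p x.
Proof. by rewrite -scaleN1r dotvZl mulN1r. Qed.

Lemma dotvNr p x : dotv x (- p) = - dotv x p.
Proof. by rewrite dotvC dotvNl dotvC. Qed.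

Lemma dotv0l x : dotv 0 x = 0.
Proof. by rewrite -(scale0r 0) dotvZl mul0r. Qed.

Lemma dotv0r x : dotv x 0 = 0.
Proof. by rewrite dotvC dotv0l. Qed.

Lemma norm_coord x (i : 'I_n) : `|x ord0 i| <= `|x|.
Proof.
rewrite [leRHS]/Num.Def.normr /= mx_normrE.
by apply: (@le_bigmax _ _ _ 0 (fun ij => `|x ij.1 ij.2|) (ord0, i)).
Qed.

Lemma norm_row_le x (c : R) : 0 <= c -> (forall i, `|x ord0 i| <= c) -> `|x| <= c.
Proof.
move=> c0 xc; rewrite [leLHS]/Num.Def.normr /= mx_normrE.
by apply/bigmax_leP; split=> // -[i j] _; rewrite ord1; exact: xc.
Qed.

Lemma ler_dotv p q : `|dotv p q| <= n%:R * `|p| * `|q|.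
Proof.
apply: le_trans (ler_norm_sum _ _ _) _.
apply: le_trans (_ : \sum_(i < n) (`|p| * `|q|) <= _); last first.
  by rewrite sumr_const card_ord -[leLHS]mulr_natl mulrA.
by apply: ler_sum => i _; rewrite normrM ler_pM ?norm_coord.
Qed.

Lemma dotvv_ge0 p : 0 <= dotv p p.
Proof. by apply: sumr_ge0 => i _; rewrite -expr2 sqr_ge0. Qed.

Lemma sqr_norm_le_dotv p : `|p| ^+ 2 <= dotv p p.
Proof.
suff pq : `|p| <= Num.sqrt (dotv p p).
  by rewrite -(sqr_sqrtr (dotvv_ge0 p)) lerXn2r ?nnegrE ?sqrtr_ge0.
apply: norm_row_le => [|i]; first exact: sqrtr_ge0.
rewrite -sqrtr_sqr ler_wsqrtr// /dotv (bigD1 i)//= -expr2 lerDl.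
by apply: sumr_ge0 => j _; rewrite -expr2 sqr_ge0.
Qed.

Lemma enorm_sqr p : enorm p ^+ 2 = dotv p p.
Proof. by rewrite sqr_sqrtr// dotvv_ge0. Qed.

Lemma mxactD M p q : mxact M (p + q) = mxact M p + mxact M q.
Proof. exact: mulmxDl. Qed.

Lemma mxactZ M a p : mxact M (a *: p) = a *: mxact M p.
Proof. by rewrite /mxact scalemxAl. Qed.

Lemma mxactN M p : mxact M (- p) = - mxact M p.
Proof. exact: mulNmx. Qed.

Lemma mxactB M p q : mxact M (p - q) = mxact M p - mxact M q.
Proof. exact: mulmxBl. Qed.

Lemma mxact0 M : mxact M 0 = 0.
Proof. exact: mul0mx. Qed.

Lemma mxactE M p i : mxact M p ord0 i = \sum_j M i j * p ord0 j.
Proof. by rewrite mxE; apply: eq_bigr => j _; rewrite mxE mulrC. Qed.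

Lemma dotv_mxact M p q : dotv (mxact M p) q = \sum_i \sum_j M i j * p ord0 j * q ord0 i.
Proof. by apply: eq_bigr => i _; rewrite mxactE mulr_suml. Qed.

Lemma dotv_mxactC M p q : M^T = M -> dotv (mxact M p) q = dotv p (mxact M q).
Proof.
move=> Msym; rewrite dotv_mxact [RHS]dotvC dotv_mxact exchange_big /=.
apply: eq_bigr => i _; apply: eq_bigr => j _.
by rewrite -[in RHS]Msym mxE mulrAC.
Qed.

End Vectors.

Lemma sqrD_le {R : realType} (x y : R) : (x + y) ^+ 2 <= 2 * (x ^+ 2 + y ^+ 2).
Proof. by have := sqr_ge0 (x - y); nra. Qed.

Lemma sqr_le_mono {R : realType} (x y : R) : 0 <= x -> x <= y -> x ^+ 2 <= y ^+ 2.
Proof. by move=> x0 xy; nra. Qed.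

Lemma norm_scale_ge0 {R : realType} {n : nat} (k : R) (p : 'rV[R]_n) :
  0 <= k -> `|k *: p| = k * `|p|.
Proof. by move=> k0; rewrite normrZ ger0_norm. Qed.

(** * Compactness and limits of bilinear pairings *)

Section Compactness.
Context {R : realType} {n : nat}.

Lemma compact_norm_ball (x : 'rV[R]_n) (r : R) : compact [set y | `|y - x| <= r].
Proof.
apply: bounded_closed_compact.
  exists (`|x| + r); split; first exact: num_real.
  move=> M xM y /= yxr; rewrite -(subrK x y).
  by rewrite (le_trans (ler_normD _ _))// (le_trans _ (ltW xM))// addrC lerD2l.
have cf : continuous (fun y : 'rV[R]_n => `|y - x| : R).
  move=> y; apply: (@cvg_norm _ _ _ (nbhs y) _ (fun z => z - x)).
  by apply: cvgB; [exact: cvg_id|exact: cvg_cst].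
exact: (@preimage_closed _ _ (fun y : 'rV[R]_n => `|y - x| : R) [set s | s <= r]
  (fun y _ => cf y) (@closed_le _ r)).
Qed.

(** Recurrence near [l] replaces the extraction of a subsequence: the limit arguments only ever need
    one index that is late enough and close enough. *)
Lemma bounded_cluster_point (f : nat -> 'rV[R]_n) (M : R) : (forall i, `|f i| <= M) ->
  exists l, `|l| <= M /\
    forall e k, 0 < e -> exists2 i, (k <= i)%N & `|f i - l| < e.
Proof.
move=> fM; have := @compact_norm_ball 0 M.
move=> /(_ (f @ \oo) _)[|l [/= lM fl]].
  by exists 0%N => // i _; rewrite /= subr0 fM.
exists l; split; first by rewrite subr0 in lM.
move=> e k e0.
have [_ [[i ki <-]]] := fl (f @` [set i | (k <= i)%N]) (ball l e)
  (filterS (fun i ki => imageP f ki) (nbhs_infty_ge k)) (nbhsx_ballx _ _ e0).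
by rewrite -ball_normE /= distrC => ?; exists i.
Qed.

End Compactness.

Lemma cvg_dotv {R : realType} {n : nat} {T : Type} (F : set_system T) {FF : Filter F}
    (f g : T -> 'rV[R]_n) (p q : 'rV[R]_n) :
  f @ F --> p -> g @ F --> q -> dotv (f x) (g x) @[x --> F] --> dotv p q.
Proof.
move=> fp gq; apply: cvg_big => [|i _]; first exact: add_continuous.
have coord (h : T -> 'rV[R]_n) (r : 'rV[R]_n) : h @ F --> r -> h x ord0 i @[x --> F] --> r ord0 i.
  by move=> hr; apply: (cvg_comp h (fun v : 'rV[R]_n => v ord0 i) hr); exact: coord_continuous.
by apply: cvgM; exact: coord.
Qed.

Lemma cvg_form {R : realType} {n : nat} {T : Type} (F : set_system T) {FF : Filter F}
    (f g : T -> 'rV[R]_n) (M : 'M[R]_n) (p q : 'rV[R]_n) :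
  f @ F --> p -> g @ F --> q ->
  dotv (mxact M (f x)) (g x) @[x --> F] --> dotv (mxact M p) q.
Proof.
move=> fp gq; rewrite dotv_mxact; under eq_fun do rewrite dotv_mxact.
have coord (h : T -> 'rV[R]_n) (r : 'rV[R]_n) (i : 'I_n) :
    h @ F --> r -> h x ord0 i @[x --> F] --> r ord0 i.
  by move=> hr; apply: (cvg_comp h (fun v : 'rV[R]_n => v ord0 i) hr); exact: coord_continuous.
apply: cvg_big => [|i _]; first exact: add_continuous.
apply: cvg_big => [|j _]; first exact: add_continuous.
by apply: cvgM; [apply: cvgM; [exact: cvg_cst|exact: coord]|exact: coord].
Qed.

(** * A parabolic maximum principle *)

Section MaximumPrinciple.
Context {R : realType} {n : nat}.
Implicit Types (w : R * 'rV[R]_n -> R) (K : set (R * 'rV[R]_n)) (z : R * 'rV[R]_n).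

Lemma within_continuous_dist w K z (e : R) : {within K, continuous w} -> K z -> 0 < e ->
  exists2 d : R, 0 < d & forall z', K z' -> `|z'.1 - z.1| < d -> `|z'.2 - z.2| < d ->
    `|w z' - w z| < e.
Proof.
move=> cw Kz e0.
have /subspace_continuousP/(_ _ Kz)/cvgrPdist_lt/(_ _ e0) := cw.
move=> /nbhs_ballP[d /= d0 dw].
exists d => // z' Kz' z1 z2; rewrite distrC.
by apply: dw => //; split; rewrite -ball_normE /= distrC.
Qed.

Definition pos_part (x : R) : R := (x + `|x|) / 2.

Lemma pos_part_ge0 x : 0 <= pos_part x.
Proof. by rewrite divr_ge0// -lerBlDl add0r -normrN ler_norm. Qed.

Lemma pos_part_id x : 0 <= x -> pos_part x = x.
Proof. by move=> x0; rewrite /pos_part ger0_norm//; field. Qed.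

(** The squared positive part is C^1 with derivative [2 x^+]. This one-sided expansion lets the time
    penalty enter a quadratic test function although it is not twice differentiable. *)
Lemma sqr_pos_part_smooth (x d : R) :
  pos_part (x + d) ^+ 2 <= pos_part x ^+ 2 + 2 * pos_part x * d + d ^+ 2.
Proof.
by rewrite /pos_part; case: (ler0P (x + d)) => ?; case: (ler0P x) => ?; nra.
Qed.

(* The maximum of [w - beta (t - a) - N ((t - b1)^+)^2] is attained at an
   interior time: [beta > 0] makes the final slope positive, and the quadratic
   term, active only close to [b], keeps the maximum away from [b]. *)
Lemma parabolic_max w (a b m : R) (B : set 'rV[R]_n) (xb : 'rV[R]_n) :
  a < b -> compact B -> {within `[a, b] `*` B, continuous w} ->
  (forall x, B x -> w (a, x) <= m) -> B xb -> m < w (b, xb) ->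
  exists t x tau C, [/\ a < t < b, B x, m < w (t, x), 0 < tau &
    forall t' x', a <= t' <= b -> B x' ->
      w (t', x') <= w (t, x) + tau * (t' - t) + C * (t' - t) ^+ 2].
Proof.
move=> ab cB cw wa Bxb mw.
set K := `[a, b] `*` B in cw *.
have Kb : K (b, xb) by split => //=; rewrite in_itv /= lexx ltW.
have cK : compact K by apply: compact_setX => //; exact: segment_compact.
pose g := (w (b, xb) - m) / 4.
have g0 : 0 < g by rewrite divr_gt0// subr_gt0.
have [d d0 wd] := within_continuous_dist cw Kb g0.
(* Between [b1] and [b] the value at [xb] loses less than [g] of the margin [4 g]; the slope [beta]
   will cost at most another [g]. *)
pose b1 := Num.max (b - d / 2) ((a + b) / 2).
have b1b : b1 < b by rewrite gt_max; apply/andP; split; lra.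
have ab1 : a < b1 by rewrite lt_max; apply/orP; right; lra.
have db1 : b - d / 2 <= b1 by rewrite le_max lexx.
have Kb1 : K (b1, xb) by split => //=; rewrite in_itv /=; apply/andP; split; lra.
have wb1 : m + 3 * g < w (b1, xb).
  have /= := wd _ Kb1; rewrite subrr normr0 distrC gtr0_norm ?subr_gt0//.
  have bb : b - b1 < d by lra.
  by move=> /(_ bb d0); rewrite ltr_norml /g => /andP[]; lra.
have [c cK' wc] := compact_EVT_max (ex_intro _ _ Kb) cK cw.
pose beta := g / (b - a).
have beta0 : 0 < beta by rewrite divr_gt0// subr_gt0.
have betag : beta * (b - a) = g by rewrite /beta divfK// subr_eq0 gt_eqF.
(* At time [b] the penalty equals the whole excess of the maximum of [w] over [m], so no maximum
   point of [f] can lie there. *)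
pose N := (w c - m) / (b - b1) ^+ 2.
have wcm : m < w c by apply: lt_le_trans mw (wc _ _); rewrite inE.
have N0 : 0 < N by rewrite divr_gt0 ?subr_gt0// exprn_gt0// subr_gt0.
pose f (z : R * 'rV[R]_n) := w z - beta * (z.1 - a) - N * pos_part (z.1 - b1) ^+ 2.
have cf : {within K, continuous f}.
  have ch : continuous (fun z : R * 'rV[R]_n => - (beta * (z.1 - a)) - N * pos_part (z.1 - b1) ^+ 2 : R).
    have cb (u : R) : continuous (fun z : R * 'rV[R]_n => z.1 - u : R).
      by move=> y; apply: cvgB; [exact: cvg_fst|exact: cvg_cst].
    have cp : continuous (fun z : R * 'rV[R]_n => pos_part (z.1 - b1) : R).
      move=> y; apply: cvgM; last exact: cvg_cst.
      by apply: cvgD; [exact: cb|apply: cvg_norm; exact: cb].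
    move=> y; apply: cvgB.
      by apply: cvgN; apply: cvgM; [exact: cvg_cst|exact: cb].
    apply: cvgM; first exact: cvg_cst.
    by rewrite expr2; apply: cvgM; exact: cp.
  rewrite (_ : f = fun z => w z + (- (beta * (z.1 - a)) - N * pos_part (z.1 - b1) ^+ 2)).
    exact: (within_continuousD cw (continuous_subspaceT ch)).
  by apply/funext => z; rewrite /f addrA.
have [[t x] Ktx ftx] := compact_EVT_max (ex_intro _ _ Kb) cK cf.
rewrite inE in Ktx; case: (Ktx) => /= tab Bx.
rewrite in_itv /= in tab; case/andP: tab => at_ tb.
have f1 : f (b1, xb) <= f (t, x) by apply: ftx; rewrite inE.
have fb1 : m < f (b1, xb).
  rewrite /f /= subrr pos_part_id// expr0n mulr0 subr0.
  have : beta * (b1 - a) <= beta * (b - a) by apply: ler_wpM2l; lra.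
  lra.
have fw : f (t, x) <= w (t, x) - beta * (t - a).
  by rewrite /f /= gerBl mulr_ge0 ?sqr_ge0// ltW.
have tbeta : 0 <= beta * (t - a) by apply: mulr_ge0; lra.
exists t, x, (beta + N * (2 * pos_part (t - b1))), N; split=> //.
- rewrite !lt_neqAle at_ tb !andbT; apply/andP; split; apply/negP => /eqP tE.
    by have := wa _ Bx; subst t; lra.
  have := wc (t, x); rewrite inE => /(_ Ktx) wcx.
  have : N * pos_part (t - b1) ^+ 2 = w c - m.
    rewrite tE pos_part_id ?subr_ge0 ?ltW//.
    by rewrite /N divfK// expf_eq0 /= subr_eq0 gt_eqF.
  move=> NE; have : f (t, x) = w (t, x) - beta * (t - a) - (w c - m) by rewrite /f /= NE.
  lra.
- lra.
- have := pos_part_ge0 (t - b1); nra.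
- move=> t' x' t'ab Bx'.
  have : f (t', x') <= f (t, x) by apply: ftx; rewrite inE; split => //=; rewrite in_itv.
  rewrite /f /= => ff.
  have := sqr_pos_part_smooth (t - b1) (t' - t).
  rewrite (_ : t - b1 + (t' - t) = t' - b1); last by ring.
  move=> /(ler_wpM2l (ltW N0)); rewrite !mulrDr; lra.
Qed.
End MaximumPrinciple.

(** * The equation on a box around the initial point; comparison along segments *)

Section LocalProblem.
Context {R : realType} {n : nat}.
Variables (A : R * 'rV[R]_n -> 'M[R]_n) (V u : R * 'rV[R]_n -> R).
Variables (y0 : 'rV[R]_n) (s0 rho c : R).
Implicit Types (z : R * 'rV[R]_n) (p q x : 'rV[R]_n) (t : R).

Local Notation H := (hamiltonian A V).
Local Notation a z := (fun p q => dotv (mxact (A z) p) q).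

Definition box : set (R * 'rV[R]_n) :=
  [set z | 0 <= z.1 <= s0 /\ `|z.2 - y0| <= rho].

Definition dist1 z z' : R := `|z'.1 - z.1| + `|z'.2 - z.2|.

(* The viscosity inequalities enter only through quadratic test functions. *)
Record local_solution : Prop := LocalSolution {
  ls_c : 1 <= c;
  ls_s0 : 0 < s0 <= 1;
  ls_rho : 0 < rho <= 1;
  ls_dot : forall p q : 'rV[R]_n, `|dotv p q| <= c * `|p| * `|q|;
  ls_sym : forall z, box z -> (A z)^T = A z;
  ls_ell : forall z p, box z -> `|p| ^+ 2 <= c * a z p p;
  ls_bnd : forall z p, box z -> `|mxact (A z) p| <= c * `|p|;
  ls_lip : forall z z' p, box z -> box z' ->
    `|mxact (A z') p - mxact (A z) p| <= c * dist1 z z' * `|p|;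
  ls_V : forall z, box z -> `|V z| <= c;
  ls_Vlip : forall z z', box z -> box z' -> `|V z' - V z| <= c * dist1 z z';
  ls_C11 : forall z p, box z -> exists h0 h1,
    [/\ `|h0| <= c * (1 + `|p| ^+ 2), `|h1| <= c * (1 + `|p| ^+ 2) &
      forall z', box z' ->
        `|H z' p - H z p - h0 * (z'.1 - z.1) - dotv h1 (z'.2 - z.2)|
        <= c * (1 + `|p| ^+ 2) * dist1 z z' ^+ 2];
  ls_u : forall z, box z -> `|u z| <= c;
  ls_cont : {within box, continuous u};
  ls_u0 : forall x x', `|x - y0| <= rho -> `|x' - y0| <= rho ->
    `|u (0, x') - u (0, x)| <= c * `|x' - x|;
  ls_sub : forall t x tau p C r, 0 < t < s0 -> `|x - y0| < rho -> 0 < r ->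
    (forall t' x', `|t' - t| < r -> `|x' - x| < r ->
      u (t', x') <= u (t, x) + tau * (t' - t) + dotv p (x' - x)
                    + C * ((t' - t) ^+ 2 + `|x' - x| ^+ 2)) ->
    tau + H (t, x) p <= 0;
  ls_super : forall t x tau p C r, 0 < t < s0 -> `|x - y0| < rho -> 0 < r ->
    (forall t' x', `|t' - t| < r -> `|x' - x| < r ->
      u (t, x) + tau * (t' - t) + dotv p (x' - x)
      - C * ((t' - t) ^+ 2 + `|x' - x| ^+ 2) <= u (t', x')) ->
    0 <= tau + H (t, x) p }.

Hypothesis LS : local_solution.

Lemma ls_c0 : 0 < c.
Proof. exact: lt_le_trans ltr01 (ls_c LS). Qed.

Lemma ls_dotvv p : dotv p p <= c * `|p| ^+ 2.
Proof. by apply: le_trans (ler_norm _) (le_trans (ls_dot LS p p) _); rewrite expr2 mulrA. Qed.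

Lemma ls_dot_le p q : dotv p q <= c * `|p| * `|q|.
Proof. exact: le_trans (ler_norm _) (ls_dot LS p q). Qed.

Lemma norm_segment_le (t1 t2 t : R) (x1 x2 v : 'rV[R]_n) : t1 < t2 ->
  x2 - x1 = (t2 - t1) *: v -> t1 <= t <= t2 ->
  `|x1 + (t - t1) *: v - y0| <= Num.max `|x1 - y0| `|x2 - y0|.
Proof.
move=> t12 x12 /andP[t1t tt2]; pose th := (t - t1) / (t2 - t1).
have th0 : 0 <= th by apply: divr_ge0; lra.
have th1 : th <= 1 by rewrite ler_pdivrMr; lra.
have thE : t - t1 = th * (t2 - t1) by rewrite divfK// subr_eq0 gt_eqF.
have -> : x1 + (t - t1) *: v - y0 = (1 - th) *: (x1 - y0) + th *: (x2 - y0).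
  have -> : x2 - y0 = (t2 - t1) *: v + (x1 - y0) by rewrite -x12 addrA subrK.
  by apply/rowP => i; rewrite thE !mxE; ring.
rewrite (le_trans (ler_normD _ _))// !norm_scale_ge0 ?subr_ge0//.
set m := Num.max _ _.
have : `|x1 - y0| <= m by rewrite le_max lexx.
have : `|x2 - y0| <= m by rewrite le_max lexx orbT.
by nra.
Qed.

Lemma continuous_line_sqr (t1 k : R) (x1 v : 'rV[R]_n) :
  continuous (fun z : R * 'rV[R]_n =>
    - (k * dotv (z.2 - (x1 + (z.1 - t1) *: v)) (z.2 - (x1 + (z.1 - t1) *: v))) : R).
Proof.
move=> z; apply: cvgN; apply: cvgM; first exact: cvg_cst.
have cl : continuous (fun z : R * 'rV[R]_n => z.2 - (x1 + (z.1 - t1) *: v)).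
  move=> y; apply: cvgB; first exact: cvg_snd.
  apply: cvgD; first exact: cvg_cst.
  apply: cvgZ; last exact: cvg_cst.
  by apply: cvgB; [exact: cvg_fst|exact: cvg_cst].
by apply: cvg_dotv; exact: cl.
Qed.

Lemma box_compact_slice (t1 t2 : R) : 0 <= t1 -> t2 <= s0 ->
  {within `[t1, t2] `*` [set x | `|x - y0| <= rho], continuous u}.
Proof.
move=> t10 t2s; apply: continuous_subspaceW (ls_cont LS) => -[t x] [/= + xr].
by rewrite in_itv /= => /andP[t1t tt2]; split => //=; apply/andP; split; lra.
Qed.

Lemma dotvv_line_le (d : R) (x v : 'rV[R]_n) :
  dotv (x - d *: v) (x - d *: v) <= 2 * c * (1 + `|v| ^+ 2) * (d ^+ 2 + `|x| ^+ 2).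
Proof.
have c0 := ls_c0; apply: le_trans (ls_dotvv _) _.
have xv : `|x - d *: v| <= `|x| + `|d| * `|v|.
  by rewrite (le_trans (ler_normB _ _))// normrZ.
have : `|x - d *: v| ^+ 2 <= (`|x| + `|d| * `|v|) ^+ 2.
  exact: sqr_le_mono.
have := sqrD_le `|x| (`|d| * `|v|); rewrite exprMn real_normK ?num_real//.
have : 0 <= `|x| ^+ 2 * `|v| ^+ 2 by rewrite mulr_ge0 ?sqr_ge0.
have := sqr_ge0 d.
set X := `|x - _| ^+ 2; set Y := (_ + _) ^+ 2; nra.
Qed.

(* Penalizing the squared distance to the segment localizes the maximum point
   of [u] near it, where [Lam] bounds the Lagrangian. *)
Lemma segment_bound (t1 t2 Lam r0 : R) (x1 x2 v : 'rV[R]_n) :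
  0 <= t1 -> t1 < t2 -> t2 <= s0 -> `|x1 - y0| < rho -> `|x2 - y0| < rho -> 0 < r0 ->
  x2 - x1 = (t2 - t1) *: v ->
  (forall t x q, t1 <= t <= t2 -> `|x - y0| <= rho ->
    `|x - (x1 + (t - t1) *: v)| <= r0 -> dotv q v - H (t, x) q <= Lam) ->
  u (t2, x2) <= u (t1, x1) + (t2 - t1) * Lam.
Proof.
move=> t10 t12 t2s x1r x2r r00 x12 lagr; rewrite leNgt; apply/negP => gap.
have c1 := ls_c LS; have c0 := ls_c0.
pose G := u (t2, x2) - (u (t1, x1) + (t2 - t1) * Lam).
have G0 : 0 < G by rewrite subr_gt0.
have B1 : box (t1, x1) by split=> /=; [apply/andP; split; lra|exact: ltW].
have B2 : box (t2, x2) by split=> /=; [apply/andP; split; lra|exact: ltW].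
have G2 : 0 < G / 2 by rewrite divr_gt0.
have [d d0 ud] := within_continuous_dist (ls_cont LS) B1 G2.
have /andP[s00 s01] := ls_s0 LS.
pose rm := Num.max `|x1 - y0| `|x2 - y0|.
have rmr : rm < rho by rewrite gt_max x1r.
pose r1 := Num.min r0 ((rho - rm) / 2).
have r10 : 0 < r1 by rewrite lt_min r00 /=; lra.
have r1r0 : r1 <= r0 by rewrite ge_min lexx.
have r1r : r1 <= (rho - rm) / 2 by rewrite ge_min lexx orbT.
(* [kX] lets the penalty at distance [d] outweigh the oscillation [2 c] of [u] at time [t1]. [kY]
   does so at distance [r1] from the segment, where the term [Lam (t - t1)] has to be beaten as
   well. *)
pose kX := 2 * c / d ^+ 2; pose kY := (2 * c + `|Lam| + 1) / r1 ^+ 2.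
have kXd : kX * d ^+ 2 = 2 * c by rewrite divfK// expf_eq0 /= gt_eqF.
have kYr : kY * r1 ^+ 2 = 2 * c + `|Lam| + 1 by rewrite divfK// expf_eq0 /= gt_eqF.
have L0 := normr_ge0 Lam.
have d20 : 0 < d ^+ 2 by rewrite exprn_gt0.
have r20 : 0 < r1 ^+ 2 by rewrite exprn_gt0.
clearbody kX kY.
have kX0 : 0 < kX by rewrite -(pmulr_lgt0 _ d20) kXd mulr_gt0// (lt_le_trans ltr01).
have kY0 : 0 < kY by rewrite -(pmulr_lgt0 _ r20) kYr; clear -LS c0 L0; lra.
pose k := kX + kY.
have kd : 2 * c <= k * d ^+ 2 by rewrite /k; nra.
have kr : 2 * c + `|Lam| < k * r1 ^+ 2 by rewrite /k; nra.
have k0 : 0 < k by rewrite addr_gt0.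
clearbody k; clear kXd kYr kX0 kY0 kX kY.
pose eta t : 'rV[R]_n := x1 + (t - t1) *: v.
have etar t : t1 <= t <= t2 -> `|eta t - y0| <= rm by exact: norm_segment_le.
pose w (z : R * 'rV[R]_n) := u z + (- (k * dotv (z.2 - eta z.1) (z.2 - eta z.1)) + - (Lam * (z.1 - t1))).
have cw : {within `[t1, t2] `*` [set x | `|x - y0| <= rho], continuous w}.
  have ch : continuous (fun z : R * 'rV[R]_n =>
      - (k * dotv (z.2 - eta z.1) (z.2 - eta z.1)) + - (Lam * (z.1 - t1)) : R).
    move=> z; apply: cvgD; first exact: continuous_line_sqr.
    apply: cvgN; apply: cvgM; first exact: cvg_cst.
    by apply: cvgB; [exact: cvg_fst|exact: cvg_cst].
  exact: (within_continuousD (box_compact_slice t10 t2s) (continuous_subspaceT ch)).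
have eta1 : eta t1 = x1 by rewrite /eta subrr scale0r addr0.
have eta2 : eta t2 = x2 by rewrite /eta -x12 addrC subrK.
have := @parabolic_max _ _ w t1 t2 (u (t1, x1) + G / 2) [set x | `|x - y0| <= rho] x2 t12
  (@compact_norm_ball _ _ y0 rho) cw.
case.
- move=> x /= xr; rewrite /w /= eta1 subrr mulr0 subr0.
  have Bx : box (t1, x) by split => //=; rewrite t10 ltW// (lt_le_trans t12).
  have [xd|dx] := ltP `|x - x1| d.
    have /= := ud _ Bx; rewrite subrr normr0 => /(_ d0 xd).
    rewrite ltr_norml => /andP[_ h1].
    by have := dotvv_ge0 (x - x1); clear -LS k0 G0 h1; nra.
  have := sqr_norm_le_dotv (x - x1).
  have := sqr_le_mono (ltW d0) dx.
  have := ls_u LS Bx; have := ls_u LS B1; rewrite !ler_norml => /andP[h1 _] /andP[_ h2].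
  by clear -LS kd k0 G0 h1 h2; nra.
- exact: ltW.
- by rewrite /w /= eta2 subrr dotv0l /G; clear -LS gap; lra.
move=> t [x [tau [C [/andP[t1t tt2] /= xr mw tau0 wmax]]]].
have tt0 : 0 < t by exact: le_lt_trans t1t.
have tts0 : t < s0 by exact: lt_le_trans t2s.
have Bt : box (t, x) by split => //=; rewrite !ltW.
have xeta : `|x - eta t| <= r1.
  rewrite leNgt; apply/negP => r1x.
  have := sqr_norm_le_dotv (x - eta t).
  have := sqr_le_mono (ltW r10) (ltW r1x).
  move: mw; rewrite /w /=.
  have := ls_u LS Bt; have := ls_u LS B1; rewrite !ler_norml => /andP[h1 _] /andP[_ h2].
  have := ler_norm (- Lam); rewrite normrN; have := normr_ge0 Lam.
  set X := dotv _ _; clear -LS kr k0 t1t tt0 tts0 t10 G0 s01 h1 h2; nra.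
have xin : `|x - y0| < rho.
  rewrite -(subrK (eta t) x) -addrA (le_lt_trans (ler_normD _ _))//.
  have : `|eta t - y0| <= rm by apply: etar; rewrite !ltW.
  by clear -LS xeta r1r rmr => ?; lra.
pose r := Num.min (Num.min (t - t1) (t2 - t)) (rho - `|x - y0|).
have r_gt0 : 0 < r by rewrite !lt_min !subr_gt0 t1t tt2.
have rt1 : r <= t - t1 by rewrite !ge_min lexx.
have rt2 : r <= t2 - t by rewrite !ge_min lexx orbT.
have rr : r <= rho - `|x - y0| by rewrite ge_min lexx orbT.
pose ze := x - eta t.
have tts : 0 < t < s0 by rewrite tt0.
(* The gradient of the penalty is the momentum [q = 2 k ze], and the motion of its centre adds
   [- <q, v>] to the time slope. Since [<q, v> - H <= Lam], the subsolution inequality contradicts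
   [tau > 0]. *)
suff : tau + Lam - 2 * k * dotv ze v + H (t, x) ((2 * k) *: ze) <= 0.
  have := @lagr t x ((2 * k) *: ze); rewrite ltW ?t1t// ltW ?tt2//.
  rewrite dotvZl => /(_ isT (ltW xin) (le_trans xeta r1r0)); set X := dotv ze v; set Y := H _ _.
  by clear -LS tau0 => ?; lra.
apply: (@ls_sub LS t x _ _ (`|C| + 2 * k * c * (1 + `|v| ^+ 2)) r tts xin r_gt0) => t' x' t'r x'r.
have x'in : `|x' - y0| <= rho.
  by rewrite -(subrK x x') -addrA (le_trans (ler_normD _ _))// -lerBrDr ltW// (lt_le_trans x'r).
have t'in : t1 <= t' <= t2.
  by clear -LS t'r rt1 rt2; move: t'r; rewrite ltr_norml => /andP[? ?]; apply/andP; split; lra.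
have := wmax t' x' t'in x'in; rewrite /w /=.
have -> : x' - eta t' = ze + ((x' - x) - (t' - t) *: v).
  by rewrite /ze /eta; apply/rowP => i; rewrite !mxE; ring.
have := dotvv_line_le (t' - t) (x' - x) v.
set dx := x' - x; set dt := t' - t; set D := dx - dt *: v.
rewrite dotvDl 2!dotvDr (dotvC D ze) -/ze => Dle.
have -> : dotv ze D = dotv ze dx - dt * dotv ze v by rewrite dotvDr dotvNr dotvZr.
have Ct : C * dt ^+ 2 <= `|C| * dt ^+ 2 by rewrite ler_wpM2r ?sqr_ge0// ler_norm.
have Cx : 0 <= `|C| * `|dx| ^+ 2 by rewrite mulr_ge0 ?sqr_ge0.
have kD := ler_wpM2l (ltW k0) Dle.
have -> : t' - t1 = (t - t1) + dt by rewrite /dt; ring.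
rewrite dotvZl.
set X := dotv D D in kD *; set Y := dotv ze dx; set Z := dotv ze v; set W := dotv ze ze.
by clear -LS Ct Cx kD => wle; lra.
Qed.

End LocalProblem.

(** * Lagrangian and Fenchel inequalities with frozen coefficients *)

Lemma linearization_error_le {R : realType} (c P D a b al X l0 l1 K : R) :
  1 <= c -> 1 <= P -> 0 <= a -> 0 <= b -> D = a + b -> - 2^-1 <= al -> al <= 2^-1 ->
  `|l0| <= c * P * a -> `|l1| <= c * (c * P) * b -> `|X - l0 - l1| <= c * P * D ^+ 2 ->
  - ((1 + al) * X) <= - l0 - l1 + 3 * c ^+ 5 * P * (K ^+ 2 + al ^+ 2 + D ^+ 2).
Proof.
move=> c1 P1 a0 b0 Dab alm alp l0P l1P XP.
have c21 : c <= c ^+ 2 by nra.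
have c25 : c ^+ 2 <= c ^+ 5 by rewrite ler_weXn2l.
have D0 : 0 <= D by rewrite Dab addr_ge0.
have cP0 : 0 <= c * P by nra.
have c2P0 : 0 <= c ^+ 2 * P by rewrite mulr_ge0 ?sqr_ge0//; lra.
have c5P0 : 0 <= c ^+ 5 * P by rewrite mulr_ge0 ?exprn_ge0//; lra.
have XD : `|X| <= c ^+ 2 * P * D + c * P * D ^+ 2.
  have -> : X = l0 + l1 + (X - l0 - l1) by ring.
  apply: le_trans (ler_normD _ _) (lerD _ XP).
  apply: le_trans (ler_normD _ _) _; apply: le_trans (lerD l0P l1P) _.
  rewrite Dab; have : c * P * a <= c ^+ 2 * P * a.
    by rewrite ler_wpM2r// ler_wpM2r//; lra.
  by rewrite mulrDr; nra.
have aX : - (al * X) <= `|al| * (c ^+ 2 * P * D + c * P * D ^+ 2).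
  by apply: le_trans (ler_norm _) _; rewrite normrN normrM ler_wpM2l.
have al2 : `|al| <= 2^-1 by rewrite ler_norml alm.
(* In [(1 + al) X] the product [al X] has two small factors, [X] being of order [D]; this inequality
   makes it part of the quadratic error. *)
have aD : 2 * (`|al| * D) <= al ^+ 2 + D ^+ 2.
  by rewrite -(real_normK (num_real al)); have := sqr_ge0 (`|al| - D); nra.
have aX2 : - (al * X) <= c ^+ 2 * P * (al ^+ 2 + D ^+ 2).
  apply: le_trans aX _.
  have e1 : `|al| * (c ^+ 2 * P * D) <= 2^-1 * (c ^+ 2 * P) * (al ^+ 2 + D ^+ 2).
    rewrite (_ : `|al| * _ = 2^-1 * (c ^+ 2 * P) * (2 * (`|al| * D))); last by field.
    by rewrite ler_wpM2l// mulr_ge0// mulr_ge0 ?sqr_ge0//; lra.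
  have e2 : `|al| * (c * P * D ^+ 2) <= 2^-1 * (c ^+ 2 * P * D ^+ 2).
    apply: ler_pM => //; first by rewrite mulr_ge0 ?sqr_ge0.
    by rewrite ler_wpM2r ?sqr_ge0// ler_wpM2r//; lra.
  have e3 : 0 <= c ^+ 2 * P * al ^+ 2 by rewrite mulr_ge0 ?sqr_ge0.
  by clear -e1 e2 e3; lra.
have XP2 : - (X - l0 - l1) <= c * P * D ^+ 2 by rewrite (le_trans _ XP)// -normrN ler_norm.
have e4 : c * P * D ^+ 2 <= c ^+ 2 * P * (al ^+ 2 + D ^+ 2).
  apply: (@le_trans _ _ (c ^+ 2 * P * D ^+ 2)).
    by rewrite ler_wpM2r ?sqr_ge0// ler_wpM2r//; lra.
  by rewrite ler_wpM2l ?lerDr ?sqr_ge0.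
have e5 : c ^+ 2 * P * (al ^+ 2 + D ^+ 2) <= c ^+ 5 * P * (K ^+ 2 + al ^+ 2 + D ^+ 2).
  apply: ler_pM; rewrite ?addr_ge0 ?sqr_ge0//.
    by rewrite ler_wpM2r//; lra.
  by rewrite -addrA lerDr sqr_ge0.
have e6 : 0 <= c ^+ 5 * P * (K ^+ 2 + al ^+ 2 + D ^+ 2).
  by rewrite mulr_ge0 ?addr_ge0 ?sqr_ge0.
by clear -aX2 XP2 e4 e5 e6; lra.
Qed.

Section Lagrangian.
Context {R : realType} {n : nat}.
Variables (A : R * 'rV[R]_n -> 'M[R]_n) (V u : R * 'rV[R]_n -> R).
Variables (y0 : 'rV[R]_n) (s0 rho c : R).
Implicit Types (z : R * 'rV[R]_n) (p q x e k : 'rV[R]_n) (t : R).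

Local Notation H := (hamiltonian A V).
Local Notation box := (box y0 s0 rho).

Definition aform z p q := dotv (mxact (A z) p) q.

Definition ainv z p : 'rV[R]_n := mxact (invmx (A z)) p.

Definition bform z p q := dotv (ainv z p) q.

(** The Lagrangian [<A^-1 v, v> / 2 - V] at the velocity [v = A p], as a function of the
    momentum. *)
Definition lagr z p := 2^-1 * aform z p p - V z.

Lemma hamiltonianE z p : H z p = 2^-1 * aform z p p + V z.
Proof. by []. Qed.

Hypothesis LS : local_solution A V u y0 s0 rho c.

Lemma aformDl z p p' q : aform z (p + p') q = aform z p q + aform z p' q.
Proof. by rewrite /aform mxactD dotvDl. Qed.

Lemma aformDr z p p' q : aform z q (p + p') = aform z q p + aform z q p'.
Proof. by rewrite /aform dotvDr. Qed.

Lemma aformNl z p q : aform z (- p) q = - aform z p q.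
Proof. by rewrite /aform mxactN dotvNl. Qed.

Lemma aformNr z p q : aform z p (- q) = - aform z p q.
Proof. by rewrite /aform dotvNr. Qed.

Lemma aformZl z s p q : aform z (s *: p) q = s * aform z p q.
Proof. by rewrite /aform mxactZ dotvZl. Qed.

Lemma aformZr z s p q : aform z p (s *: q) = s * aform z p q.
Proof. by rewrite /aform dotvZr. Qed.

Definition aformE := (aformDl, aformDr, aformNl, aformNr, aformZl, aformZr).

Lemma aformC z p q : box z -> aform z p q = aform z q p.
Proof. by move=> zB; rewrite /aform dotv_mxactC ?(ls_sym LS)// dotvC. Qed.

Lemma aform_ell z p : box z -> `|p| ^+ 2 <= c * aform z p p.
Proof. exact: ls_ell LS z p. Qed.

Lemma aform_ge0 z p : box z -> 0 <= aform z p p.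
Proof.
by move=> zB; have ap := aform_ell p zB; rewrite -(pmulr_rge0 _ (ls_c0 LS)) (le_trans (sqr_ge0 _) ap).
Qed.

Lemma aform_le z p q : box z -> aform z p q <= c ^+ 2 * `|p| * `|q|.
Proof.
move=> zB; apply: le_trans (ls_dot_le LS _ _) _.
rewrite ler_wpM2r// expr2 -mulrA ler_wpM2l ?(ltW (ls_c0 LS))//.
exact: ls_bnd LS _ _ zB.
Qed.

Lemma aform_lip z z' p q : box z -> box z' ->
  `|aform z' p q - aform z p q| <= c ^+ 2 * dist1 z z' * `|p| * `|q|.
Proof.
move=> zB zB'; rewrite /aform -dotvNl -dotvDl.
apply: le_trans (ls_dot LS _ _) _.
rewrite ler_wpM2r// expr2 -!mulrA ler_wpM2l ?(ltW (ls_c0 LS))// !mulrA.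
exact: ls_lip LS _ _ _ zB zB'.
Qed.

(** By ellipticity a row in the kernel of [A z] has norm zero. *)
Lemma A_unit z : box z -> A z \in unitmx.
Proof.
move=> zB; rewrite -row_free_unit -kermx_eq0; apply/eqP/row_matrixP => i.
rewrite row0; apply/eqP; rewrite -normr_eq0 -sqrf_eq0; apply/eqP/le_anti.
rewrite sqr_ge0 andbT; apply: le_trans (aform_ell _ zB) _.
rewrite /aform /mxact (ls_sym LS zB) -row_mul mulmx_ker row0 dotv0l mulr0.
exact: lexx.
Qed.

Lemma ainvK z q : box z -> mxact (A z) (ainv z q) = q.
Proof.
move=> zB; rewrite /ainv /mxact -mulmxA trmx_inv (ls_sym LS zB).
by rewrite mulVmx ?mulmx1// A_unit.
Qed.

Lemma ainv_bnd z q : box z -> `|ainv z q| <= c ^+ 2 * `|q|.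
Proof.
move=> zB; have := aform_ell (ainv z q) zB; rewrite /aform ainvK//.
have := ls_dot_le LS q (ainv z q); have := ls_c0 LS.
have := normr_ge0 (ainv z q); have := normr_ge0 q.
set d := dotv _ _; move: `|ainv z q| `|q| => X Y Y0 X0 c0 dle Xle.
have : X ^+ 2 <= (c ^+ 2 * Y) * X by nra.
have [->|Xn0] := eqVneq X 0; first by rewrite mulr_ge0 ?sqr_ge0.
by rewrite expr2 ler_pM2r// lt_neqAle eq_sym Xn0.
Qed.

Lemma bformC z p q : box z -> bform z p q = bform z q p.
Proof.
move=> zB; rewrite /bform -[in LHS](ainvK q zB) dotvC -/(aform _ _ _) aformC//.
by rewrite /aform ainvK// dotvC.
Qed.

Lemma bformDl z p p' q : bform z (p + p') q = bform z p q + bform z p' q.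
Proof. by rewrite /bform /ainv mxactD dotvDl. Qed.

Lemma bformDr z p p' q : bform z q (p + p') = bform z q p + bform z q p'.
Proof. by rewrite /bform dotvDr. Qed.

Lemma bformZl z s p q : bform z (s *: p) q = s * bform z p q.
Proof. by rewrite /bform /ainv mxactZ dotvZl. Qed.

Lemma bformZr z s p q : bform z p (s *: q) = s * bform z p q.
Proof. by rewrite /bform dotvZr. Qed.

Lemma bformNl z p q : bform z (- p) q = - bform z p q.
Proof. by rewrite /bform /ainv mxactN dotvNl. Qed.

Lemma bformNr z p q : bform z p (- q) = - bform z p q.
Proof. by rewrite /bform dotvNr. Qed.

Definition bformE := (bformDl, bformDr, bformNl, bformNr, bformZl, bformZr).

Lemma bform_le z p q : box z -> bform z p q <= c ^+ 3 * `|p| * `|q|.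
Proof.
move=> zB; apply: le_trans (ls_dot_le LS _ _) _.
rewrite ler_wpM2r// exprS -mulrA ler_wpM2l ?(ltW (ls_c0 LS))//.
exact: ainv_bnd.
Qed.

Lemma bform_ell z q : box z -> `|q| ^+ 2 <= c ^+ 3 * bform z q q.
Proof.
move=> zB; have c0 := ls_c0 LS.
have := sqr_le_mono (normr_ge0 _) (ls_bnd LS (ainv z q) zB); rewrite ainvK//.
move=> /le_trans; apply; rewrite exprMn (exprSr _ 2) -mulrA ler_wpM2l ?sqr_ge0//.
by have := aform_ell (ainv z q) zB; rewrite /aform ainvK// dotvC.
Qed.

Lemma bform_ge0 z q : box z -> 0 <= bform z q q.
Proof.
by move=> zB; rewrite /bform -[X in dotv _ X](ainvK q zB) dotvC aform_ge0.
Qed.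

(** Expand the energy of [s q - A^-1 e], which is nonnegative, and divide by [2 s]: Young's
    inequality for the dual forms of [A] and [A^-1]. *)
Lemma young z q e (s : R) : box z -> 0 < s ->
  dotv q e <= 2^-1 * s * aform z q q + (2 * s)^-1 * bform z e e.
Proof.
move=> zB sp; have := aform_ge0 (s *: q - ainv z e) zB.
rewrite !aformE (aformC q (ainv z e) zB) {2 3}/aform ainvK//.
rewrite [in X in X -> _]dotvC.
set d := dotv q e; set b := bform z e e; set a := aform z q q.
have -> : aform z (ainv z e) (ainv z e) = b by rewrite {1}/aform ainvK// dotvC.
move=> h; have -> : (2 * s)^-1 = 2^-1 * s^-1 by rewrite invfM.
rewrite -(ler_pM2l sp).
have -> : s * (2^-1 * s * a + 2^-1 / s * b) = 2^-1 * (s ^+ 2 * a + b).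
  by field; rewrite gt_eqF.
by lra.
Qed.

(* Completing the square around the optimal momentum [p] of the velocity
   [A(z) p]. *)
Lemma fenchel_expand z z' p k q (al : R) :
  box z -> box z' ->
  dotv q (mxact (A z) p + k) - (1 + al) * H z' q =
  lagr z p + dotv p k - al * H z p - (1 + al) * (H z' p - H z p)
  + (dotv (q - p) (k + mxact (A z) p - (1 + al) *: mxact (A z') p)
     - 2^-1 * (1 + al) * aform z' (q - p) (q - p)).
Proof.
move=> zB zB'; rewrite !hamiltonianE /lagr.
have -> : k + mxact (A z) p = mxact (A z) p + k by rewrite addrC.
set v := mxact (A z) p + k.
have pv : dotv p v = aform z p p + dotv p k by rewrite dotvDr dotvC.
clearbody v.
rewrite dotvDl !dotvDr !dotvNr !dotvZr !dotvNl pv !aformE (aformC q p zB').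
rewrite (dotvC q (mxact _ _)) (dotvC p (mxact _ _)) -!/(aform _ _ _).
by field.
Qed.

Lemma sqr_sum3_le (x y w : R) : (x + y + w) ^+ 2 <= 3 * (x ^+ 2 + y ^+ 2 + w ^+ 2).
Proof.
by have := sqr_ge0 (x - y); have := sqr_ge0 (x - w); have := sqr_ge0 (y - w); nra.
Qed.

Lemma fenchel_error_le z z' p k (al : R) : box z -> box z' ->
  `|k + mxact (A z) p - (1 + al) *: mxact (A z') p| ^+ 2 <=
  3 * c ^+ 2 * (1 + `|p| ^+ 2) * (`|k| ^+ 2 + al ^+ 2 + dist1 z z' ^+ 2).
Proof.
move=> zB zB'; set D := dist1 z z'.
have -> : k + mxact (A z) p - (1 + al) *: mxact (A z') p =
    k - (mxact (A z') p - mxact (A z) p) - al *: mxact (A z') p.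
  by apply/rowP => i; rewrite !mxE; ring.
have D0 : 0 <= D by rewrite addr_ge0.
have c1 := ls_c LS; have p0 := normr_ge0 p; have k0 := normr_ge0 k.
have : `|k - (mxact (A z') p - mxact (A z) p) - al *: mxact (A z') p| <=
    `|k| + c * D * `|p| + `|al| * (c * `|p|).
  apply: le_trans (ler_normB _ _) _; apply: lerD.
    by apply: le_trans (ler_normB _ _) _; rewrite lerD2l; exact: ls_lip LS _ _ _ zB zB'.
  by rewrite normrZ ler_wpM2l// (ls_bnd LS).
move=> /(sqr_le_mono (normr_ge0 _)) /le_trans; apply.
apply: le_trans (sqr_sum3_le _ _ _) _.
rewrite !exprMn (real_normK (num_real al)) -!mulrA ler_wpM2l//.
move: `|p| `|k| p0 k0 {zB zB'} => P K P0 K0.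
have c21 : 1 <= c ^+ 2 by nra.
have K2 := sqr_ge0 K; have al2 := sqr_ge0 al; have D2 := sqr_ge0 D.
have P2 := sqr_ge0 P.
have KP : 0 <= K ^+ 2 * P ^+ 2 by apply: mulr_ge0.
rewrite -(ler_pM2l (ltr01 : 0 < 1 :> R)) !mul1r.
have : K ^+ 2 <= c ^+ 2 * K ^+ 2 by rewrite ler_peMl.
have : 0 <= c ^+ 2 * (K ^+ 2 * P ^+ 2) by rewrite mulr_ge0// sqr_ge0.
have : 0 <= c ^+ 2 * D ^+ 2 by rewrite mulr_ge0// sqr_ge0.
have : 0 <= c ^+ 2 * al ^+ 2 by rewrite mulr_ge0// sqr_ge0.
by lra.
Qed.

(** The terms linear in [k], [al] and [z' - z] are kept exactly, since they will form the
    first-order part of a semiconcavity inequality; the other terms may be estimated crudely. The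
    factor [1 + al] anticipates a dilation of time. *)
Lemma fenchel_rough z p : box z -> exists h0 h1,
  [/\ `|h0| <= c * (1 + `|p| ^+ 2), `|h1| <= c * (1 + `|p| ^+ 2) &
  forall z' (al : R) k q, box z' -> `|al| <= 2^-1 ->
    dotv q (mxact (A z) p + k) - (1 + al) * H z' q <=
    lagr z p + dotv p k - al * H z p - h0 * (z'.1 - z.1) - dotv h1 (z'.2 - z.2)
    + 6 * c ^+ 5 * (1 + `|p| ^+ 2) * (`|k| ^+ 2 + al ^+ 2 + dist1 z z' ^+ 2)].
Proof.
move=> zB; have [h0 [h1 [h0P h1P hP]]] := ls_C11 LS p zB.
exists h0, h1; split=> // z' al k q zB' al2.
rewrite fenchel_expand//; have := hP _ zB'.
set e := k + _ - _; set X := H z' p - H z p; set D := dist1 z z' => Xle.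
have c1 := ls_c LS; have c0 := ls_c0 LS.
have D0 : 0 <= D by rewrite addr_ge0.
have P1 : 1 <= 1 + `|p| ^+ 2 by rewrite lerDl sqr_ge0.
move: al2; rewrite ler_norml => /andP[alm alp].
have eE : dotv (q - p) e - 2^-1 * (1 + al) * aform z' (q - p) (q - p) <=
    3 * c ^+ 5 * (1 + `|p| ^+ 2) * (`|k| ^+ 2 + al ^+ 2 + D ^+ 2).
  have al0 : 0 < 1 + al by clear -LS alm; lra.
  have yg := young (q - p) e zB' al0.
  have be : bform z' e e <= c ^+ 3 * `|e| ^+ 2.
    by rewrite expr2 mulrA; exact: bform_le.
  have e2 : c ^+ 3 * `|e| ^+ 2 <= c ^+ 3 * (3 * c ^+ 2 * (1 + `|p| ^+ 2) *
      (`|k| ^+ 2 + al ^+ 2 + D ^+ 2)).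
    by rewrite ler_wpM2l ?exprn_ge0 ?(ltW c0)//; exact: fenchel_error_le.
  have b2 : (2 * (1 + al))^-1 * bform z' e e <= bform z' e e.
    rewrite ler_piMl ?bform_ge0// invf_le1; clear -LS alm; lra.
  have -> : 3 * c ^+ 5 * (1 + `|p| ^+ 2) * (`|k| ^+ 2 + al ^+ 2 + D ^+ 2) =
    c ^+ 3 * (3 * c ^+ 2 * (1 + `|p| ^+ 2) * (`|k| ^+ 2 + al ^+ 2 + D ^+ 2)) by ring.
  by clear -LS yg be e2 b2; lra.
set l0 := h0 * (z'.1 - z.1) in Xle *; set l1 := dotv h1 (z'.2 - z.2) in Xle *.
have XE : - ((1 + al) * X) <= - l0 - l1
    + 3 * c ^+ 5 * (1 + `|p| ^+ 2) * (`|k| ^+ 2 + al ^+ 2 + D ^+ 2).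
  have l0le : `|l0| <= c * (1 + `|p| ^+ 2) * `|z'.1 - z.1| by rewrite normrM ler_wpM2r.
  have l1le : `|l1| <= c * (c * (1 + `|p| ^+ 2)) * `|z'.2 - z.2|.
    apply: le_trans (ls_dot LS _ _) _; apply: ler_wpM2r => //.
    by apply: ler_wpM2l => //; exact: ltW.
  exact: (@linearization_error_le _ c (1 + `|p| ^+ 2) D _ _ al X l0 l1 `|k| c1 P1
    (normr_ge0 _) (normr_ge0 _) erefl alm alp l0le l1le Xle).
by clear -LS eE XE; lra.
Qed.

(* The quadratic error is measured by the inverse metric at a third point [w],
   with a factor tending to the sharp constant [1/2] as [z'] tends to [w]. *)
Lemma fenchel_sharp z z' w p k q e : box z -> box z' -> box w ->
  c ^+ 3 * dist1 w z' <= 2^-1 ->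
  e = k - (mxact (A z') p - mxact (A z) p) ->
  dotv q (mxact (A z) p + k) - H z' q <=
  lagr z p + dotv p k - (H z' p - H z p)
  + 2^-1 * (1 + 2 * (c ^+ 3 * dist1 w z')) * bform w e e.
Proof.
move=> zB zB' wB; set mu := c ^+ 3 * dist1 w z' => mu2 eE.
have mu0 : 0 <= mu by rewrite mulr_ge0 ?exprn_ge0 ?addr_ge0// ltW// (ls_c0 LS).
have := fenchel_expand p k q 0 zB zB'; rewrite addr0 !mul1r mul0r subr0 scale1r => ->.
have -> : k + mxact (A z) p - mxact (A z') p = e by rewrite eE opprB addrA addrAC.
rewrite lerD2l mulr1; set r := q - p.
have a1 : aform w r r - mu * aform w r r <= aform z' r r.
  have := aform_lip r r wB zB'; rewrite ler_norml => /andP[+ _].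
  have : c ^+ 2 * dist1 w z' * `|r| * `|r| <= mu * aform w r r.
    have -> : mu * aform w r r = c ^+ 2 * dist1 w z' * (c * aform w r r) by rewrite /mu; ring.
    by rewrite -mulrA -expr2 ler_wpM2l ?aform_ell// mulr_ge0 ?sqr_ge0// addr_ge0.
  clear -LS; lra.
have m1 : 0 < 1 - mu by clear -LS mu2; lra.
have yg := young r e wB m1.
have b0 := bform_ge0 e wB.
have b1 : (2 * (1 - mu))^-1 * bform w e e <= 2^-1 * (1 + 2 * mu) * bform w e e.
  rewrite ler_wpM2r// invfM ler_pM2l ?invr_gt0// -(ler_pM2r m1) mulVf ?gt_eqF//.
  by clear -LS mu0 mu2; nra.
by clear -LS a1 yg b1; lra.
Qed.

End Lagrangian.

(** * Almost optimal backward steps from the supersolution property *)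

Section BackwardStep.
Context {R : realType} {n : nat}.
Variables (A : R * 'rV[R]_n -> 'M[R]_n) (V u : R * 'rV[R]_n -> R).
Variables (y0 : 'rV[R]_n) (s0 rho c : R).
Implicit Types (z : R * 'rV[R]_n) (p q x y d : 'rV[R]_n) (t r dt : R).

Local Notation H := (hamiltonian A V).
Local Notation box := (box y0 s0 rho).
Local Notation bform := (bform A).
Local Notation ainv := (ainv A).
Local Notation lagr := (lagr A V).

Hypothesis LS : local_solution A V u y0 s0 rho c.

(** The function [B(y, y) / r] is the perspective of a quadratic form, and the remainder of its
    first-order expansion is exactly [B(g, g) / (r - dt)] with [g = d + (dt / r) y]. *)
Lemma perspective_le z y d r dt : box z -> 0 < r -> `|dt| <= r / 2 ->
  bform z (y + d) (y + d) / (r - dt) <=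
  bform z y y / r + 2 * bform z y d / r + bform z y y * dt / r ^+ 2
  + 4 * c ^+ 3 / r * (1 + (`|y| / r) ^+ 2) * (dt ^+ 2 + `|d| ^+ 2).
Proof.
move=> zB r0 dtr; have c0 := ls_c0 LS.
have r'0 : r / 2 <= r - dt by move: dtr; rewrite ler_norml => /andP[? ?]; lra.
have rd0 : 0 < r - dt by apply: lt_le_trans r'0; rewrite divr_gt0.
set g := d + (dt / r) *: y.
have gd : `|g| ^+ 2 <= 2 * (1 + (`|y| / r) ^+ 2) * (dt ^+ 2 + `|d| ^+ 2).
  have : `|g| <= `|d| + `|dt| * (`|y| / r).
    by rewrite (le_trans (ler_normD _ _))// normrZ normrM normfV (gtr0_norm r0) mulrAC mulrA.
  move=> /(sqr_le_mono (normr_ge0 _)) /le_trans; apply.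
  apply: le_trans (sqrD_le _ _) _; rewrite exprMn (real_normK (num_real dt)).
  have := sqr_ge0 dt; have := sqr_ge0 `|d|; have := sqr_ge0 (`|y| / r).
  move: (dt ^+ 2) (`|d| ^+ 2) ((`|y| / r) ^+ 2) => a b e e0 b0 a0.
  have := mulr_ge0 e0 b0; clear -LS a0; lra.
have -> : bform z (y + d) (y + d) / (r - dt) =
    bform z y y / r + 2 * bform z y d / r + bform z y y * dt / r ^+ 2
    + bform z g g / (r - dt).
  rewrite /g !bformE (bformC LS d y zB).
  by field; rewrite !gt_eqF.
rewrite lerD2l ler_pdivrMr//.
have bg : bform z g g <= c ^+ 3 * `|g| ^+ 2 by rewrite expr2 mulrA; exact: bform_le LS _ _ _ zB.
apply: le_trans bg _.
have -> : 4 * c ^+ 3 / r * (1 + (`|y| / r) ^+ 2) * (dt ^+ 2 + `|d| ^+ 2) * (r - dt) =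
   c ^+ 3 * (2 * (1 + (`|y| / r) ^+ 2) * (dt ^+ 2 + `|d| ^+ 2) * ((r - dt) / (r / 2))).
  by field; rewrite gt_eqF.
rewrite ler_wpM2l ?exprn_ge0 ?(ltW c0)//; apply: le_trans gd _.
rewrite ler_peMr ?ler_pdivlMr ?divr_gt0 ?mul1r//.
by rewrite mulr_ge0 ?addr_ge0 ?sqr_ge0// mulr_ge0// addr_ge0 ?sqr_ge0.
Qed.

(** The factor [1 - de] pays for freezing [A] at [z0], because [(1 - de)^2 (1 + de) <= 1 - de]; the
    constant [ka] pays for freezing [V]. *)
Lemma barrier_subsolution z0 t x (de ka : R) : box z0 -> box (t, x) -> t < z0.1 ->
  let r := z0.1 - t in let y := x - z0.2 in
  c ^+ 3 * (`|y| + r) <= de -> de <= 2^-1 -> c * (`|y| + r) <= ka ->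
  - (2^-1 * (1 - de) * (bform z0 y y / r ^+ 2)) - (V z0 + ka)
  + H (t, x) (- ((1 - de) / r *: ainv z0 y)) <= 0.
Proof.
move=> z0B zB tt0 r y deD de2 kaD; have c0 := ls_c0 LS; have c1 := ls_c LS.
have r0 : 0 < r by rewrite subr_gt0.
have D : dist1 z0 (t, x) = `|y| + r by rewrite /dist1 /= distrC gtr0_norm// addrC.
rewrite hamiltonianE !aformE.
set a := aform A (t, x) (ainv z0 y) (ainv z0 y).
have b0 := bform_ge0 LS y z0B.
have aE : aform A z0 (ainv z0 y) (ainv z0 y) = bform z0 y y.
  by rewrite /aform (ainvK LS)// dotvC.
have ale : a <= (1 + de) * bform z0 y y.
  have := aform_lip LS (ainv z0 y) (ainv z0 y) z0B zB; rewrite ler_norml => /andP[_].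
  rewrite D -/a aE -mulrA -expr2 => h.
  have := aform_ell LS (ainv z0 y) z0B; rewrite aE => /(ler_wpM2l _) h2.
  have := h2 _ (mulr_ge0 (sqr_ge0 c) (addr_ge0 (normr_ge0 y) (ltW r0))) => h3.
  have := ler_wpM2r b0 deD.
  move: h h3; rewrite exprSr; clear -LS; set N := _ * `|_| ^+ 2; lra.
have Vle : V (t, x) <= V z0 + ka.
  have := ls_Vlip LS z0B zB; rewrite D ler_norml => /andP[_]; clear -LS kaD; lra.
have d1 : 0 <= (1 - de) ^+ 2 / r ^+ 2 by rewrite divr_ge0 ?sqr_ge0.
have h := ler_wpM2l d1 ale.
have d0 : 0 <= de.
  by apply: le_trans deD; rewrite mulr_ge0 ?exprn_ge0 ?(ltW c0)// addr_ge0 ?(ltW r0).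
have h2 : (1 - de) ^+ 2 / r ^+ 2 * ((1 + de) * bform z0 y y) <= (1 - de) * (bform z0 y y / r ^+ 2).
  have -> : (1 - de) ^+ 2 / r ^+ 2 * ((1 + de) * bform z0 y y) =
    (1 - de ^+ 2) * ((1 - de) * (bform z0 y y / r ^+ 2)) by field; rewrite gt_eqF.
  rewrite ler_piMl//; last by rewrite gerBl sqr_ge0.
  by rewrite mulr_ge0 ?divr_ge0 ?sqr_ge0//; clear -LS de2; lra.
have -> : 2^-1 * - - ((1 - de) / r * ((1 - de) / r * a)) = 2^-1 * ((1 - de) ^+ 2 / r ^+ 2 * a).
  by field; rewrite gt_eqF.
clear -LS h h2 Vle; lra.
Qed.

Lemma cvg_bform (T : Type) (F : set_system T) (FF : Filter F) z0
    (f g : T -> 'rV[R]_n) p q :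
  f @ F --> p -> g @ F --> q -> bform z0 (f x) (g x) @[x --> F] --> bform z0 p q.
Proof. exact: cvg_form. Qed.

(* A supersolution lies above the frozen-coefficient barrier
   [(1 - de) Q(x - x0) / (2 (t0 - t)) - (V(z0) + de) (t0 - t)]; otherwise its
   sum with the barrier would have an interior minimum with negative slope. *)
Lemma backward_barrier t0 x0 eta de kr : box (t0, x0) ->
  0 < eta -> eta ^+ 2 <= t0 -> 0 < kr -> `|x0 - y0| + kr < rho ->
  c ^+ 3 * (kr + eta ^+ 2) <= de -> de <= 2^-1 -> 24 * c ^+ 4 * eta ^+ 2 < kr ^+ 2 ->
  eta ^+ 3 <= 1 ->
  exists2 x, `|x - x0| <= kr &
    u (t0 - eta ^+ 2, x) + 2^-1 * (1 - de) * (bform (t0, x0) (x - x0) (x - x0) / eta ^+ 2)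
    - (V (t0, x0) + de) * eta ^+ 2 <= u (t0, x0) + eta ^+ 3.
Proof.
set z0 := (t0, x0) => zB eta0 ht0 kr0 krr deD de2 kr2 eta1.
have c0 := ls_c0 LS; have c1 := ls_c LS.
have [/andP[t00 t0s] x0r] : 0 <= t0 <= s0 /\ `|x0 - y0| <= rho := zB.
set h : R := eta ^+ 2 in ht0 deD kr2 *.
have h_gt0 : 0 < h by rewrite exprn_gt0.
have e30 : 0 < eta ^+ 3 by rewrite exprn_gt0.
apply: contrapT => nex.
have far x : `|x - x0| <= kr -> u z0 + eta ^+ 3 <
    u (t0 - h, x) + 2^-1 * (1 - de) * (bform z0 (x - x0) (x - x0) / h) - (V z0 + de) * h.
  by move=> xk; rewrite ltNge; apply/negP => ?; apply: nex; exists x.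
have s01 : s0 <= 1 by have /andP[] := ls_s0 LS.
have Vc : `|V z0| <= c := ls_V LS zB.
have Vde : `|V z0 + de| <= 2 * c.
  have de0 : 0 <= de by apply: le_trans deD; rewrite mulr_ge0 ?exprn_ge0 ?addr_ge0// ltW.
  by rewrite (le_trans (ler_normD _ _))// (ger0_norm de0); clear -LS Vc de2 c1; lra.
have e32 : 0 < eta ^+ 3 / 2 by rewrite divr_gt0.
have [d d0 ud] := within_continuous_dist (ls_cont LS) zB e32.
(* The barrier is singular at [t0], so the comparison stops at [t0 - r1]. There the continuity of
   [u] spends half of the margin [eta ^+ 3] and the term [(V z0 + de) r1] at most a quarter. *)
pose r1 := Num.min (Num.min (h / 2) (d / 2)) (eta ^+ 3 / (8 * c)).
have r10 : 0 < r1 by rewrite !lt_min !divr_gt0// mulr_gt0.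
have r1h : r1 <= h / 2 by rewrite !ge_min lexx.
have r1d : r1 <= d / 2 by rewrite !ge_min lexx orbT.
have r1e : r1 <= eta ^+ 3 / (8 * c) by rewrite ge_min lexx orbT.
have r1c : 2 * c * r1 <= eta ^+ 3 / 4.
  have -> : eta ^+ 3 / 4 = 2 * c * (eta ^+ 3 / (8 * c)) by field; rewrite gt_eqF.
  by rewrite ler_wpM2l// mulr_ge0// ltW.
clearbody r1; clear r1e.
pose bar (z : R * 'rV[R]_n) := 2^-1 * (1 - de) * (bform z0 (z.2 - x0) (z.2 - x0) / (t0 - z.1))
  - (V z0 + de) * (t0 - z.1).
pose w z := - u z - bar z.
set B := [set x | `|x - x0| <= kr].
have KB t x : t0 - h <= t -> t <= t0 - r1 -> B x -> box (t, x).
  move=> th tr Bx; split => /=; first by apply/andP; split; clear -LS th tr ht0 t0s r10; lra.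
  rewrite -(subrK x0 x) -addrA (le_trans (ler_normD _ _))//.
  by move: Bx; rewrite /B /= => Bx; clear -LS Bx krr; lra.
have cw : {within `[t0 - h, t0 - r1] `*` B, continuous w}.
  have cu : {within `[t0 - h, t0 - r1] `*` B, continuous u}.
    apply: continuous_subspaceW (ls_cont LS) => -[t x] [/= + Bx].
    by rewrite in_itv /= => /andP[? ?]; exact: KB.
  apply/subspace_continuousP => -[t x] Ktx; case: (Ktx) => /= + Bx.
  rewrite in_itv /= => /andP[th tr]; rewrite /w; apply: cvgB.
    by apply: cvgN; exact: ((subspace_continuousP _ _).1 cu).
  apply: cvg_within_filter; rewrite /bar /=.
  have cx : (fun z : R * 'rV[R]_n => z.2 - x0) @ (t, x) --> x - x0.
    by apply: cvgB; [exact: cvg_snd|exact: cvg_cst].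
  have ct : (fun z : R * 'rV[R]_n => t0 - z.1 : R) @ (t, x) --> t0 - t.
    by apply: cvgB; [exact: cvg_cst|exact: cvg_fst].
  apply: cvgB; last by apply: cvgM; [exact: cvg_cst|exact: ct].
  apply: cvgM; first exact: cvg_cst.
  apply: cvgM; first exact: cvg_bform.
  by apply: cvgV ct; rewrite subr_eq0 gt_eqF//; clear -LS tr r10; lra.
have ab : t0 - h < t0 - r1 by clear -LS r1h h_gt0; lra.
have Bx0 : B x0 by rewrite /B /= subrr normr0 ltW.
have [x xB||t [x [tau [C [/andP[ta tb] xB mw tau0 wmax]]]]] :=
  @parabolic_max _ _ w _ _ (- (u z0 + eta ^+ 3)) B x0 ab (@compact_norm_ball _ _ x0 kr) cw _ Bx0.
- have := far _ xB; rewrite /w /bar /= (_ : t0 - (t0 - h) = h); last by ring.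
  by clear -LS; lra.
- rewrite /w /bar /= subrr (_ : t0 - (t0 - r1) = r1); last by ring.
  rewrite /bform /ainv mxact0 dotv0l mul0r mulr0 sub0r opprK.
  have Bz : box (t0 - r1, x0) by apply: KB => //; clear -LS r1h h_gt0; lra.
  have := ud _ Bz; rewrite /= subrr normr0 addrAC subrr sub0r normrN gtr0_norm//.
  have rd : r1 < d by clear -LS r1d d0; lra.
  move=> /(_ rd d0); rewrite ltr_norml => /andP[_ ul].
  have : `|(V z0 + de) * r1| <= 2 * c * r1 by rewrite normrM (gtr0_norm r10) ler_wpM2r// ltW.
  rewrite ler_norml => /andP[vr _]; clear -LS ul r1c e30 vr; lra.
have zB' : box (t, x) by apply: KB => //; exact: ltW.
set r := t0 - t.
have r_gt0 : 0 < r by rewrite subr_gt0; clear -LS tb r10; lra.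
have rh : r < h by rewrite /r; clear -LS ta; lra.
set y := x - x0; set Q := bform z0 y y.
(* On the sphere of radius [kr] the quadratic part of the barrier would exceed [6 c], by the
   hypothesis with the factor 24, while the values of [u], the potential term and [eta ^+ 3]
   together offer at most [5 c]. *)
have ykr : `|y| < kr.
  rewrite ltNge; apply/negP => kry.
  have Q0 : 0 <= Q := bform_ge0 LS y zB.
  have QQ : kr ^+ 2 <= c ^+ 3 * Q.
    by apply: le_trans (bform_ell LS y zB); apply: sqr_le_mono => //; exact: ltW.
  have Qh : Q / h <= Q / r by rewrite ler_wpM2l// lef_pV2 ?posrE// ltW.
  have uB : `|u (t, x)| <= c := ls_u LS zB'.
  have uz : `|u z0| <= c := ls_u LS zB.
  move: mw; rewrite /w /bar /= -/r -/y -/Q.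
  have Vr : `|(V z0 + de) * r| <= 2 * c.
    rewrite normrM (gtr0_norm r_gt0) -[leRHS]mulr1; apply: ler_pM => //; first exact: ltW.
    by clear -LS rh ht0 t0s s01; lra.
  have Qh2 : 24 * c < Q / h.
    rewrite ltr_pdivlMr// -(ltr_pM2l (exprn_gt0 3 c0)) (lt_le_trans _ QQ)//.
    by rewrite (_ : c ^+ 3 * _ = 24 * c ^+ 4 * h)//; ring.
  move: uB uz Vr; rewrite !ler_norml => /andP[u1 u2] /andP[u3 u4] /andP[v1 v2].
  have de1 : 2^-1 * (Q / r) <= (1 - de) * (Q / r).
    by rewrite ler_wpM2r ?divr_ge0 ?(ltW r_gt0)//; clear -LS de2; lra.
  by clear -LS Qh Qh2 de1 u1 u2 u3 u4 v1 v2 eta1 c1; lra.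
have xin : `|x - y0| < rho.
  rewrite -(subrK x0 x) -addrA (le_lt_trans (ler_normD _ _))// -/y.
  by clear -LS ykr krr; lra.
have sub := @barrier_subsolution z0 t x de de zB zB' _.
have {sub} sub : - (2^-1 * (1 - de) * (Q / r ^+ 2)) - (V z0 + de)
    + H (t, x) (- ((1 - de) / r *: ainv z0 y)) <= 0.
  apply: sub => //=; first by rewrite -subr_gt0.
    apply: le_trans deD; rewrite ler_wpM2l ?exprn_ge0 ?(ltW c0)//.
    by rewrite lerD// ltW.
  apply: le_trans deD; rewrite -/r -/y.
  apply: ler_pM; [exact: ltW|by apply: addr_ge0 => //; exact: ltW| |].
    by rewrite -[leLHS]expr1 ler_weXn2l.
  by apply: lerD; exact: ltW.
pose tau' := - tau - 2^-1 * (1 - de) * (Q / r ^+ 2) - (V z0 + de).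
suff : 0 <= tau' + H (t, x) (- ((1 - de) / r *: ainv z0 y)).
  by rewrite /tau'; clear -LS sub tau0; lra.
have tts : 0 < t < s0.
  by apply/andP; split; clear -LS ta tb ht0 t0s r10; lra.
pose rr := Num.min (Num.min (t - (t0 - h)) (t0 - r1 - t)) (Num.min (r / 2) (kr - `|y|)).
have rr0 : 0 < rr by rewrite !lt_min !subr_gt0 ta tb divr_gt0.
have rr1 : rr <= t - (t0 - h) by rewrite !ge_min lexx.
have rr2 : rr <= t0 - r1 - t by rewrite !ge_min lexx orbT.
have rr3 : rr <= r / 2 by rewrite !ge_min lexx !orbT.
have rr4 : rr <= kr - `|y| by rewrite !ge_min lexx !orbT.
clearbody rr.
pose C1 := 4 * c ^+ 3 / r * (1 + (`|y| / r) ^+ 2).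
have C10 : 0 <= C1.
  apply: mulr_ge0; last by apply: addr_ge0 => //; exact: sqr_ge0.
  by apply: divr_ge0; [apply: mulr_ge0 => //; apply: exprn_ge0|]; exact: ltW.
apply: (@ls_super _ _ _ _ _ _ _ _ _ LS t x _ _ (`|C| + C1) rr tts xin rr0) => t' x' t'r x'r.
have t'in : t0 - h <= t' <= t0 - r1.
  by move: t'r; rewrite ltr_norml => /andP[t1 t2]; apply/andP; split; clear -LS rr1 rr2 t1 t2; lra.
have x'B : B x'.
  rewrite /B /= -(subrK x x') -addrA (le_trans (ler_normD _ _))// -/y.
  by clear -LS x'r rr4; lra.
have := wmax t' x' t'in x'B; rewrite /w /bar /= -/r -/y -/Q.
have -> : x' - x0 = y + (x' - x) by rewrite /y [RHS]addrC addrA subrK.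
have dtr : `|t' - t| <= r / 2 by rewrite (le_trans (ltW t'r)).
have := perspective_le y (x' - x) zB r_gt0 dtr.
have -> : t0 - t' = r - (t' - t) by rewrite /r; ring.
rewrite -/C1 -/Q dotvNl dotvZl -/(bform z0 y (x' - x)).
set d' := x' - x; set dt := t' - t; set Q' := bform z0 (y + d') (y + d') / _.
set b := bform z0 y d'; set dd := dt ^+ 2 + `|d'| ^+ 2 => pq.
have d10 : 0 <= 2^-1 * (1 - de) by rewrite mulr_ge0//; clear -LS de2; lra.
have d11 : 2^-1 * (1 - de) <= 1.
  have : 0 <= de by apply: le_trans deD; rewrite mulr_ge0 ?exprn_ge0 ?addr_ge0// ltW.
  by clear -LS; lra.
have dd0 : 0 <= dd by rewrite addr_ge0 ?sqr_ge0.
have C1dd : 2^-1 * (1 - de) * (C1 * dd) <= C1 * dd by rewrite ler_piMl// mulr_ge0.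
have Ct : C * dt ^+ 2 <= `|C| * dd.
  apply: (@le_trans _ _ (`|C| * dt ^+ 2)); first by rewrite ler_wpM2r ?sqr_ge0// ler_norm.
  by rewrite ler_wpM2l// lerDl sqr_ge0.
have := ler_wpM2l d10 pq.
rewrite /tau' -/dt; clear -LS C1dd Ct.
rewrite -[Q * dt / r ^+ 2]mulrAC.
set X := Q / r; set Y := Q / r ^+ 2.
have -> : (1 - de) / r * b = (1 - de) * (b / r) by ring.
have -> : 2 * b / r = 2 * (b / r) by ring.
set Z := b / r; lra.
Qed.

(** Boundedness of [u] alone locates the almost optimal point only within [O(eta)] after a time
    [eta ^+ 2], so the momentum may be of size [1 / eta]. The error [eta ^+ 3 (1 + |p|^2)] is still
    [eta] times the sum of duration and energy of the step, so it disappears in the sum over a chain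
    of bounded energy. *)
Lemma backward_step : exists C e0 : R, [/\ 1 <= C, 0 < e0 &
  forall t0 x0 eta, 0 < eta <= e0 -> eta ^+ 2 <= t0 -> t0 <= s0 -> `|x0 - y0| <= rho / 2 ->
  exists p, eta ^+ 2 * `|p| ^+ 2 <= C /\
    u (t0 - eta ^+ 2, x0 - eta ^+ 2 *: mxact (A (t0, x0)) p) + eta ^+ 2 * lagr (t0, x0) p
    <= u (t0, x0) + C * eta ^+ 3 * (1 + `|p| ^+ 2)].
Proof.
have c0 := ls_c0 LS; have c1 := ls_c LS; have /andP[rho0 rho1] := ls_rho LS.
(* [K ^+ 2 = 25 c ^+ 4] beats the [24 c ^+ 4] required by [backward_barrier] with [kr = K eta], and
   [K'] makes [de = K' eta] admissible. *)
pose K := 5 * c ^+ 2; pose K' := c ^+ 3 * (K + 1).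
have K0 : 0 < K by rewrite mulr_gt0 ?exprn_gt0.
have K'0 : 0 < K' by rewrite mulr_gt0 ?exprn_gt0 ?addr_gt0.
pose e0 := Num.min 1 (Num.min (rho / 4 / K) (2^-1 / K')).
have e00 : 0 < e0 by rewrite !lt_min ltr01 !divr_gt0.
have e01 : e0 <= 1 by rewrite ge_min lexx.
have eK : e0 * K <= rho / 4 by rewrite -ler_pdivlMr// !ge_min lexx orbT.
have eK' : e0 * K' <= 2^-1 by rewrite -ler_pdivlMr// !ge_min lexx !orbT.
clearbody e0.
pose C := 1 + K' * c ^+ 2 + K' + c ^+ 4 * K ^+ 2.
have K'c : 0 <= K' * c ^+ 2 by rewrite mulr_ge0 ?sqr_ge0// ltW.
have cK : 0 <= c ^+ 4 * K ^+ 2 by rewrite mulr_ge0 ?exprn_ge0 ?sqr_ge0// ltW.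
exists C, e0; split=> //; first by rewrite /C; clear -LS K'c cK K'0; lra.
move=> t0 x0 eta /andP[eta0 etae] ht0 t0s x0r.
have eta1 : eta <= 1 by exact: le_trans e01.
have etaK : eta * K <= rho / 4 by apply: le_trans eK; rewrite ler_wpM2r// ltW.
have etaK' : eta * K' <= 2^-1 by apply: le_trans eK'; rewrite ler_wpM2r// ltW.
have h0 : 0 < eta ^+ 2 by rewrite exprn_gt0.
have zB : box (t0, x0).
  by split => /=; [apply/andP; split|]; clear -LS h0 ht0 t0s x0r rho0; lra.
have [||||||x xk ux] := @backward_barrier t0 x0 eta (K' * eta) (K * eta) zB eta0 ht0.
- exact: mulr_gt0.
- by clear -LS etaK x0r rho0; lra.
- rewrite /K' -mulrA ler_wpM2l ?exprn_ge0 ?(ltW c0)// mulrDl lerD2l mul1r expr2.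
  by rewrite ler_piMl// ltW.
- by rewrite mulrC.
- rewrite exprMn ltr_pM2r// /K exprMn -exprM (_ : 5 ^+ 2 = 25 :> R); last by ring.
  by rewrite ltr_pM2r ?exprn_gt0//; lra.
- by rewrite exprn_ile1// ltW.
pose p := (eta ^+ 2)^-1 *: ainv (t0, x0) (x0 - x).
have pE : eta ^+ 2 *: mxact (A (t0, x0)) p = x0 - x.
  by rewrite mxactZ (ainvK LS)// scalerA divff ?scale1r// gt_eqF.
have xp : x0 - eta ^+ 2 *: mxact (A (t0, x0)) p = x by rewrite pE opprB addrC subrK.
exists p; rewrite xp.
have Qp : bform (t0, x0) (x - x0) (x - x0) = (eta ^+ 2) ^+ 2 * aform A (t0, x0) p p.
  have hp : ainv (t0, x0) (x0 - x) = eta ^+ 2 *: p.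
    by rewrite /p scalerA divff ?scale1r// gt_eqF.
  have -> : x - x0 = - (x0 - x) by rewrite opprB.
  rewrite bformNl bformNr opprK /bform hp -pE dotvZl dotvZr dotvC /aform.
  by rewrite mulrA -expr2.
have pn : eta * `|p| <= c ^+ 2 * K.
  have -> : eta * `|p| = `|ainv (t0, x0) (x0 - x)| / eta.
    rewrite /p norm_scale_ge0 ?invr_ge0 ?sqr_ge0//.
    by field; rewrite gt_eqF.
  rewrite ler_pdivrMr//; apply: le_trans (ainv_bnd LS (x0 - x) zB) _.
  by rewrite -(mulrA _ K) distrC; apply: ler_wpM2l => //; exact: sqr_ge0.
split.
  rewrite -exprMn; apply: le_trans (sqr_le_mono _ pn) _.
    by rewrite mulr_ge0// ltW.
  rewrite exprMn -exprM /C; clear -LS K'c cK K'0; lra.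
have ap : aform A (t0, x0) p p <= c ^+ 2 * `|p| ^+ 2.
  by rewrite expr2 [X in _ <= _ * X]expr2 mulrA; exact: (aform_le LS).
have e30 : 0 <= eta ^+ 3 by rewrite exprn_ge0// ltW.
have p2 : 0 <= `|p| ^+ 2 by rewrite sqr_ge0.
move: ux; rewrite Qp /lagr.
set a := aform A _ p p in ap *.
have -> : 2^-1 * (1 - K' * eta) * (eta ^+ 2 ^+ 2 * a / eta ^+ 2) =
   eta ^+ 2 * (2^-1 * a) - 2^-1 * (eta ^+ 3 * (K' * a)) by field; rewrite gt_eqF.
have -> : (V (t0, x0) + K' * eta) * eta ^+ 2 = eta ^+ 2 * V (t0, x0) + eta ^+ 3 * K' by ring.
have a1 : eta ^+ 3 * (K' * a) <= eta ^+ 3 * (K' * c ^+ 2 * `|p| ^+ 2).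
  by rewrite ler_wpM2l// -mulrA ler_wpM2l// ltW.
have Ce : eta ^+ 3 * (1 + K' + K' * c ^+ 2 * `|p| ^+ 2) <= C * eta ^+ 3 * (1 + `|p| ^+ 2).
  rewrite [leRHS]mulrAC mulrC ler_wpM2r//.
  have p3 : 0 <= K' * `|p| ^+ 2 by rewrite mulr_ge0// ltW.
  have p4 : 0 <= (c ^+ 4 * K ^+ 2) * `|p| ^+ 2 by rewrite mulr_ge0.
  have p5 : 0 <= K' * c ^+ 2 * `|p| ^+ 2 by rewrite mulr_ge0.
  by rewrite /C; clear -LS p2 p3 p4 p5 K'c cK K'0; lra.
have a2 : 0 <= eta ^+ 3 * (K' * c ^+ 2 * `|p| ^+ 2) by rewrite mulr_ge0// mulr_ge0.
clear -LS a1 Ce a2; lra.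
Qed.

End BackwardStep.

(** * Chains of almost optimal steps and their perturbations *)

Lemma chain_error_le {R : realType} (c C0 P a b d eta G h hp hd D : R) :
  1 <= c -> 1 <= C0 -> 1 <= P -> 0 <= a -> 0 <= b -> 0 <= d -> 0 <= eta <= 1 ->
  G = 3 + c * C0 -> h <= eta -> hp <= C0 * eta -> 0 <= D ->
  D <= a + b + 2 * d + G * eta -> hd <= 2^-1 * (eta + d ^+ 2) ->
  2 * c * P * h + c ^+ 2 * P * (c * hp + hd + h) + 6 * c ^+ 5 * P * (d ^+ 2 + a ^+ 2 + D ^+ 2)
  <= 120 * c ^+ 5 * G ^+ 2 * P * (a ^+ 2 + b ^+ 2 + d ^+ 2 + eta).
Proof.
move=> c1 C01 P1 a0 b0 d0 /andP[eta0 eta1] GE heta hpe D0 DE hdE.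
set S := a ^+ 2 + b ^+ 2 + d ^+ 2 + eta.
have a2 := sqr_ge0 a; have b2 := sqr_ge0 b; have d2 := sqr_ge0 d.
have S0 : 0 <= S by rewrite /S; lra.
have cC : 1 <= c * C0 by rewrite -[1]mulr1 ler_pM.
have G1 : 1 <= G by lra.
have G2 : G <= G ^+ 2 by nra.
have D2 : D ^+ 2 <= 16 * (G ^+ 2 * S).
  apply: le_trans (sqr_le_mono D0 DE) _.
  have -> : a + b + 2 * d + G * eta = (a + b) + (2 * d + G * eta) by ring.
  apply: le_trans (sqrD_le _ _) _.
  have := sqrD_le a b; have := sqrD_le (2 * d) (G * eta).
  have e2 : eta ^+ 2 <= eta by nra.
  have : (G * eta) ^+ 2 <= G ^+ 2 * eta by rewrite exprMn ler_wpM2l// sqr_ge0.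
  have : a ^+ 2 <= G ^+ 2 * a ^+ 2 by rewrite ler_peMl//; lra.
  have : b ^+ 2 <= G ^+ 2 * b ^+ 2 by rewrite ler_peMl//; lra.
  have : d ^+ 2 <= G ^+ 2 * d ^+ 2 by rewrite ler_peMl//; lra.
  have : 0 <= G ^+ 2 * eta by rewrite mulr_ge0// sqr_ge0.
  rewrite exprMn /S !mulrDr; lra.
have c25 : c ^+ 2 <= c ^+ 5 by rewrite ler_weXn2l.
have c15 : c <= c ^+ 5 by rewrite -[leLHS]expr1 ler_weXn2l.
have c35 : c ^+ 3 <= c ^+ 5 by rewrite ler_weXn2l.
have c51 : 1 <= c ^+ 5 by lra.
have GS : S <= G ^+ 2 * S by rewrite ler_peMl//; lra.
have etaS : eta <= G ^+ 2 * S by rewrite /S in GS *; lra.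
set W := G ^+ 2 * S in GS etaS D2 *.
have W0 : 0 <= W by lra.
have t1 : c * h <= c ^+ 5 * W by apply: le_trans (ler_wpM2l _ heta) _; [lra|apply: ler_pM; lra].
have t2 : c ^+ 2 * h <= c ^+ 5 * W.
  by apply: le_trans (ler_wpM2l (sqr_ge0 c) heta) _; apply: ler_pM => //; exact: sqr_ge0.
have t3 : c ^+ 2 * (c * hp) <= c ^+ 5 * W.
  have : c * hp <= W.
    apply: le_trans (ler_wpM2l _ hpe) _; first lra.
    rewrite mulrA /W; apply: ler_pM; rewrite /S; lra.
  by move=> /(ler_wpM2l (sqr_ge0 c)) /le_trans; apply; rewrite ler_wpM2r.
have t4 : c ^+ 2 * hd <= c ^+ 5 * W.
  have : hd <= W by rewrite /S in GS; lra.
  by move=> /(ler_wpM2l (sqr_ge0 c)) /le_trans; apply; rewrite ler_wpM2r.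
have t5 : d ^+ 2 + a ^+ 2 + D ^+ 2 <= 17 * W by rewrite /S in GS; lra.
have c50 : 0 <= c ^+ 5 by lra.
have t6 := ler_wpM2l c50 t5.
have -> : 120 * c ^+ 5 * G ^+ 2 * P * S = P * (120 * (c ^+ 5 * W)) by rewrite /W; ring.
rewrite (_ : _ + _ = P * (2 * (c * h) + (c ^+ 2 * (c * hp) + c ^+ 2 * hd + c ^+ 2 * h)
  + 6 * (c ^+ 5 * (d ^+ 2 + a ^+ 2 + D ^+ 2)))); last by ring.
apply: ler_wpM2l; first lra.
clear -t1 t2 t3 t4 t6 W0 c50; have := mulr_ge0 c50 W0; lra.
Qed.

Section Chain.
Context {R : realType} {n : nat}.
Variables (A : R * 'rV[R]_n -> 'M[R]_n) (V u : R * 'rV[R]_n -> R).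
Variables (y0 : 'rV[R]_n) (s0 rho c : R).
Implicit Types (z : R * 'rV[R]_n) (p q x y d : 'rV[R]_n) (t r dt : R).

Local Notation H := (hamiltonian A V).
Local Notation box := (box y0 s0 rho).
Local Notation lagr := (lagr A V).

Hypothesis LS : local_solution A V u y0 s0 rho c.

Lemma norm_le_1Dsqr p : `|p| <= 1 + `|p| ^+ 2.
Proof. by have := sqr_ge0 (`|p| - 2^-1); nra. Qed.

Lemma hamiltonian_bnd z p : box z -> `|H z p| <= c ^+ 2 * (1 + `|p| ^+ 2).
Proof.
move=> zB; have c1 := ls_c LS; have := ls_V LS zB.
have := aform_le LS p p zB; rewrite -mulrA -expr2.
have := aform_ge0 LS p zB; rewrite hamiltonianE ler_norml => a0 a1 /andP[V1 V2].
have c2 : c <= c ^+ 2 by rewrite -[leLHS]expr1 ler_weXn2l.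
rewrite mulrDr mulr1 ler_norml; apply/andP; split; clear -LS a0 a1 V1 V2 c2; lra.
Qed.

Lemma lagr_ge z p : box z -> (2 * c)^-1 * `|p| ^+ 2 - c <= lagr z p.
Proof.
move=> zB; have c0 := ls_c0 LS; have := ls_V LS zB.
have := aform_ell LS p zB; rewrite ler_norml /lagr => ae /andP[_ V2].
have : (2 * c)^-1 * `|p| ^+ 2 <= 2^-1 * aform A z p p.
  by rewrite invfM -mulrA ler_pM2l ?invr_gt0// ler_pdivrMl.
by clear -LS V2; lra.
Qed.

(* Moving the end points of an almost optimal step by [(al s, k0 + s k)]:
   first-order terms are linear in [(al, k0, k)], the rest is quadratic. *)
Lemma step_perturbation (s h C0 eta : R) y y' p : box (s, y) ->
  y' = y - h *: mxact (A (s, y)) p ->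
  0 < h -> h <= s -> h <= eta -> eta <= 1 -> 1 <= C0 -> h * `|p| <= C0 * eta ->
  h = eta ^+ 2 -> 0 < eta ->
  exists h0 h1,
  [/\ `|h0| <= c * (1 + `|p| ^+ 2), `|h1| <= c * (1 + `|p| ^+ 2) &
  forall (al : R) (k0 k : 'rV[R]_n), `|al| <= 2^-1 -> (1 + al) * s <= s0 ->
  `|y + k0 + s *: k - y0| < rho -> `|y' + k0 + (s - h) *: k - y0| < rho ->
  u ((1 + al) * s, y + k0 + s *: k) <= u ((1 + al) * (s - h), y' + k0 + (s - h) *: k)
  + h * (lagr (s, y) p + dotv p k - al * H (s, y) p - h0 * (al * s) - dotv h1 (k0 + s *: k)
  + 120 * c ^+ 5 * (3 + c * C0) ^+ 2 * (1 + `|p| ^+ 2)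
    * (al ^+ 2 + `|k0| ^+ 2 + `|k| ^+ 2 + eta))].
Proof.
move=> zB y'E h_gt0 hs heta eta1 C01 hpe hE eta0.
have [h0 [h1 [h0P h1P hP]]] := fenchel_rough LS p zB.
exists h0, h1; split=> // al k0 k al2 als x2r x1r.
have c1 := ls_c LS; have c0 := ls_c0 LS.
have s01 : s0 <= 1 by have /andP[] := ls_s0 LS.
have [/andP[s_ge0 ss0] yr] : 0 <= s <= s0 /\ `|y - y0| <= rho := zB.
have [alm alp] : - 2^-1 <= al /\ al <= 2^-1 by apply/andP; rewrite -ler_norml.
have al0 : 0 < 1 + al by clear -LS alm; lra.
have al32 : 1 + al <= 2 by clear -LS alp; lra.
set P := 1 + `|p| ^+ 2; have P1 : 1 <= P by rewrite lerDl sqr_ge0.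
set err := 120 * _ * _ * _ * _; set lam := lagr _ _ + _ - _ - _ - _ + err.
(* The dilated step lasts [(1 + al) h], which divides the velocity by [1 + al]. Multiplied by
   [1 + al], the required Lagrangian bound is the one of [fenchel_rough]. *)
pose v := (1 + al)^-1 *: (mxact (A (s, y)) p + k).
have -> : h * lam = ((1 + al) * s - (1 + al) * (s - h)) * ((1 + al)^-1 * lam).
  by field; rewrite gt_eqF.
have t12 : (1 + al) * (s - h) < (1 + al) * s by rewrite ltr_pM2l// gtrBl.
have hv : ((1 + al) * s - (1 + al) * (s - h)) *: v = h *: (mxact (A (s, y)) p + k).
  by rewrite /v scalerA; congr (_ *: _); field; rewrite gt_eqF.
have t10 : 0 <= (1 + al) * (s - h) by rewrite mulr_ge0 ?subr_ge0// ltW.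
apply: (@segment_bound _ _ _ _ _ _ _ _ _ LS _ _ _ h _ _ v t10 t12 als x1r x2r h_gt0).
  by rewrite hv y'E; apply/rowP => i; rewrite !mxE; ring.
move=> t x q /andP[tt1 tt2] xr xnear.
have z'B : box (t, x) by split => //=; apply/andP; split; [exact: le_trans tt1|exact: le_trans als].
rewrite -(ler_pM2l al0) mulrA divff ?gt_eqF// mul1r mulrBr -dotvZr.
have -> : (1 + al) *: v = mxact (A (s, y)) p + k by rewrite scalerA divff ?scale1r// gt_eqF.
apply: le_trans (hP _ al k q z'B al2) _; rewrite /lam /=.
set tau := t - s; set xi := x - y; set D := dist1 _ _.
have Ap : `|mxact (A (s, y)) p| <= c * `|p| := ls_bnd LS p zB.
have tauE : `|tau - al * s| <= 2 * h.
  have : (1 + al) * h <= 2 * h by rewrite ler_wpM2r// ltW.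
  rewrite /tau ler_norml; move: tt1 tt2; rewrite mulrBr => tt1 tt2.
  by move=> e; apply/andP; split; clear -LS tt1 tt2 e h_gt0; lra.
have xiE : `|xi - (k0 + s *: k)| <= c * (h * `|p|) + h * `|k| + h.
  set th := (1 + al) * s - t.
  have th0 : 0 <= th by rewrite subr_ge0.
  have thh : th <= (1 + al) * h by rewrite /th; clear -LS tt1; lra.
  have -> : xi - (k0 + s *: k) = (x - (y' + k0 + (s - h) *: k + (t - (1 + al) * (s - h)) *: v)) - th *: v.
    have -> : (t - (1 + al) * (s - h)) *: v = h *: (mxact (A (s, y)) p + k) - th *: v.
      by rewrite -hv -scalerBl; congr (_ *: _); rewrite /th; ring.
    by rewrite /xi y'E; apply/rowP => i; rewrite !mxE; ring.
  apply: le_trans (ler_normB _ _) _; rewrite addrC; apply: lerD => //.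
  rewrite norm_scale_ge0// /v norm_scale_ge0 ?invr_ge0 ?(ltW al0)// mulrA.
  have thq : th / (1 + al) <= h by rewrite ler_pdivrMr// mulrC.
  have : `|mxact (A (s, y)) p + k| <= c * `|p| + `|k|.
    by rewrite (le_trans (ler_normD _ _))// lerD2r.
  move=> /(ler_pM (divr_ge0 th0 (ltW al0)) (normr_ge0 _) thq) /le_trans; apply.
  by rewrite mulrDr (mulrCA h).
set hd := h * `|k|; set hp := h * `|p|.
have hdE : hd <= 2^-1 * (eta + `|k| ^+ 2).
  have := sqr_ge0 (eta - eta * `|k|).
  have e2 : eta ^+ 2 <= eta by rewrite expr2 ler_piMl// ltW.
  have e3 : eta ^+ 2 * `|k| ^+ 2 <= `|k| ^+ 2.
    by rewrite ler_piMl ?sqr_ge0// exprn_ile1// ltW.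
  rewrite /hd hE sqrrB exprMn; clear -LS e2 e3; lra.
have DE : D <= `|al| + `|k0| + 2 * `|k| + (3 + c * C0) * eta.
  have t1 : `|tau| <= `|al| + 2 * h.
    rewrite -[tau](subrK (al * s)) (le_trans (ler_normD _ _))// addrC lerD//.
    by rewrite normrM ler_piMr// (ger0_norm s_ge0); clear -LS ss0 s01; lra.
  have t2 : `|xi| <= `|k0| + `|k| + (c * hp + hd + h).
    rewrite -[xi](subrK (k0 + s *: k)) (le_trans (ler_normD _ _))// addrC lerD//.
    rewrite (le_trans (ler_normD _ _))// lerD2l norm_scale_ge0// ler_piMl//.
    by clear -LS ss0 s01; lra.
  have t3 : hd <= `|k| by rewrite ler_piMl//; clear -LS hs ss0 s01; lra.
  have t4 : c * hp <= c * C0 * eta by rewrite -mulrA ler_wpM2l// ltW.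
  by rewrite /D /dist1 /= -/tau -/xi; clear -LS t1 t2 t3 t4 heta; lra.
have D0 : 0 <= D by rewrite addr_ge0.
have e01 : 0 <= eta <= 1 by rewrite ltW.
have := chain_error_le c1 C01 P1 (normr_ge0 al) (normr_ge0 k0) (normr_ge0 k) e01 erefl heta hpe D0 DE hdE.
rewrite (real_normK (num_real al)) -/P -/err.
have l0 : - (h0 * tau) <= - (h0 * (al * s)) + 2 * c * P * h.
  have : `|h0 * (tau - al * s)| <= c * P * (2 * h) by rewrite normrM ler_pM.
  by rewrite mulrBr ler_norml => /andP[e _]; clear -LS e; lra.
have l1 : - dotv h1 xi <= - dotv h1 (k0 + s *: k) + c ^+ 2 * P * (c * hp + hd + h).
  have := ls_dot LS h1 (xi - (k0 + s *: k)).
  have : c * `|h1| * `|xi - (k0 + s *: k)| <= c ^+ 2 * P * (c * hp + hd + h).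
    by apply: ler_pM => //; rewrite ?mulr_ge0 ?(ltW c0)// expr2 -mulrA ler_wpM2l// ltW.
  rewrite dotvDr dotvNr ler_norml => e /andP[f _]; clear -LS e f; lra.
clear -LS l0 l1.
by rewrite -/hp; lra.
Qed.

(** The momentum is replaced by the energy [e = h |p|^2], the quantity that can be summed. By
    coercivity of the Lagrangian it is bounded by the drop of [u], which telescopes; by Young's
    inequality with a free weight [m] it controls the displacement; and it bounds the coefficients
    [l0], [l1], [l2] of the perturbation. *)
Lemma chain_step : exists C e1 : R, [/\ 1 <= C, 0 < e1 &
  forall (s eta h : R) y, 0 < eta <= e1 -> h = eta ^+ 2 -> h <= s -> s <= s0 -> `|y - y0| <= rho / 2 ->
  exists (e : R) y' (l0 : R) (l1 l2 : 'rV[R]_n), (0 <= e /\ `|y - y'| <= rho / 4) /\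
    [/\ e / (4 * c) <= u (s, y) - u (s - h, y') + 2 * c * h,
        forall m : R, 0 < m -> `|y - y'| <= c * (m * e + h / m),
        [/\ `|l0| <= C * (h + e), `|l1| <= C * (h + e) & `|l2| <= C * (h + e)] &
        forall (al : R) (k0 k : 'rV[R]_n), `|al| <= 2^-1 -> (1 + al) * s <= s0 ->
        `|y + k0 + s *: k - y0| < rho -> `|y' + k0 + (s - h) *: k - y0| < rho ->
        u ((1 + al) * s, y + k0 + s *: k) <= u ((1 + al) * (s - h), y' + k0 + (s - h) *: k)
        + (u (s, y) - u (s - h, y')) + (l0 * al + dotv l1 k0 + dotv l2 k)
        + C * (h + e) * (al ^+ 2 + `|k0| ^+ 2 + `|k| ^+ 2 + eta)]].
Proof.
have [Cb [e0 [Cb1 e00 back]]] := backward_step LS.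
have c0 := ls_c0 LS; have c1 := ls_c LS.
have /andP[s00 s01] := ls_s0 LS.
have /andP[rho0 rho1] := ls_rho LS.
have cC0 : 0 < 4 * c * Cb by rewrite mulr_gt0 ?mulr_gt0//; exact: lt_le_trans Cb1.
pose e1 := Num.min (Num.min 1 e0) (rho / (4 * c * Cb)).
have e10 : 0 < e1 by rewrite !lt_min ltr01 e00 divr_gt0.
pose C1 := 120 * c ^+ 5 * (3 + c * Cb) ^+ 2.
have C10 : 0 <= C1 by rewrite mulr_ge0 ?sqr_ge0// mulr_ge0// exprn_ge0// ltW.
pose C := C1 + Cb + 2 * c ^+ 2.
exists C, e1; split=> //.
  by rewrite /C; have := sqr_ge0 c; clear -LS C10 Cb1; lra.
move=> s eta h y /andP[eta0 etae] hE hs ss0 yr.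
have eta1 : eta <= 1 by apply: le_trans etae _; rewrite !ge_min lexx.
have ee0 : eta <= e0 by apply: le_trans etae _; rewrite !ge_min lexx orbT.
have er : 4 * c * Cb * eta <= rho.
  by rewrite -ler_pdivlMl// mulrC; apply: le_trans etae _; rewrite !ge_min lexx orbT.
have ec : 4 * c * Cb * eta <= 1 by exact: le_trans rho1.
have h0 : 0 < h by rewrite hE exprn_gt0.
have heta : h <= eta by rewrite hE expr2 ler_piMl// ltW.
have e_in : 0 < eta <= e0 by rewrite eta0.
have hs' : eta ^+ 2 <= s by rewrite -hE.
have [p []] := back s y eta e_in hs' ss0 yr.
rewrite -!hE; set y' := y - _; set e := h * _ ^+ 2 => hp2 ub.
have zB : box (s, y).
  by split => /=; [apply/andP; split|]; clear -LS h0 hs ss0 yr rho0; lra.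
have e_ge0 : 0 <= e by rewrite mulr_ge0 ?sqr_ge0// ltW.
have hp : h * `|p| <= Cb * eta.
  rewrite -(@ler_pXn2r _ 2) ?nnegrE//; last 2 first.
    by rewrite mulr_ge0// ltW.
    by rewrite mulr_ge0 ?(ltW eta0)//; clear -LS Cb1; lra.
  rewrite !exprMn [h ^+ 2]expr2 -mulrA -hE [leRHS]mulrC ler_wpM2l ?(ltW h0)//.
  apply: le_trans hp2 _; rewrite expr2 ler_peMl//; clear -LS Cb1; lra.
have [h0' [h1 [h0P h1P hP]]] := step_perturbation zB erefl h0 hs heta eta1 Cb1 hp hE eta0.
have hPe : h * (1 + `|p| ^+ 2) = h + e by rewrite mulrDr mulr1.
have he0 : 0 <= h + e by rewrite addr_ge0// ltW.
have ub2 : h * lagr (s, y) p <= u (s, y) - u (s - h, y') + Cb * eta * (h + e).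
  have -> : Cb * eta * (h + e) = Cb * eta ^+ 3 * (1 + `|p| ^+ 2) by rewrite -hPe hE; ring.
  by clear -LS ub; lra.
have c2 : c <= c ^+ 2 by rewrite -[leLHS]expr1 ler_weXn2l.
have s_ge0 : 0 <= s by apply: le_trans hs; exact: ltW.
have s1 : s <= 1 by exact: le_trans s01.
exists e, y', (h * (- H (s, y) p - h0' * s)), (- h *: h1), (h *: (p - s *: h1)).
have yy' : y - y' = h *: mxact (A (s, y)) p by rewrite /y' opprB addrC subrK.
have yn : `|y - y'| <= c * (h * `|p|).
  by rewrite yy' norm_scale_ge0 ?(ltW h0)// mulrCA ler_wpM2l ?(ltW h0)// (ls_bnd LS).
split; first split=> //.
  apply: le_trans yn _; have := ler_wpM2l (ltW c0) hp; clear -LS er; lra.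
split.
- have := lagr_ge p zB; rewrite -(ler_pM2l h0) => lg.
  have : Cb * eta * (h + e) <= (4 * c)^-1 * (h + e).
    by rewrite ler_wpM2r// -[leRHS]mulr1 ler_pdivlMl ?mulr_gt0// mulrA.
  have -> : e / (4 * c) = (4 * c)^-1 * e by rewrite mulrC.
  have : h * ((2 * c)^-1 * `|p| ^+ 2 - c) = 2 * ((4 * c)^-1 * e) - h * c.
    by rewrite /e; field; rewrite gt_eqF.
  have : (4 * c)^-1 * h <= c * h.
    rewrite ler_pM2r// -[leLHS]mulr1 ler_pdivrMl ?mulr_gt0//; clear -LS c1; nra.
  rewrite (mulrDr (4 * c)^-1); move: lg ub2.
  set W := h * (_ - c); move: W ((4 * c)^-1 * e) ((4 * c)^-1 * h) => W X Y.
  by clear -LS; lra.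
- move=> m m0; apply: le_trans yn _; rewrite mulrCA.
  have -> : c * (m * e + h / m) = h * (c * (m * `|p| ^+ 2 + m^-1)).
    by rewrite /e; field; rewrite gt_eqF.
  rewrite ler_wpM2l ?(ltW h0)// ler_wpM2l ?(ltW c0)//.
  rewrite -(ler_pM2l m0) mulrDr divff ?gt_eqF//.
  have := sqr_ge0 (m * `|p| - 2^-1); clear -LS; nra.
- have hC : 2 * c ^+ 2 * (h + e) <= C * (h + e).
    by rewrite ler_wpM2r// /C; clear -LS C10 Cb1; lra.
  have hb (x : R) : x <= 2 * c ^+ 2 * (1 + `|p| ^+ 2) -> h * x <= C * (h + e).
    move=> xle; apply: le_trans hC; rewrite -hPe mulrCA ler_wpM2l//; exact: ltW.
  have P0 : 0 <= 1 + `|p| ^+ 2 by rewrite addr_ge0 ?sqr_ge0.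
  have cP := ler_wpM2r P0 c2; have cP1 := ler_wpM2r P0 c1.
  split.
  + rewrite normrM (gtr0_norm h0); apply: hb.
    apply: le_trans (ler_normB _ _) _; rewrite normrN normrM (ger0_norm s_ge0).
    have : `|h0'| * s <= `|h0'| by rewrite ler_piMr.
    by have := hamiltonian_bnd p zB; clear -LS P0 h0P cP; lra.
  + by rewrite scaleNr normrN norm_scale_ge0 ?(ltW h0)//; apply: hb; clear -LS P0 h1P cP cP1; lra.
  + rewrite norm_scale_ge0 ?(ltW h0)//; apply: hb.
    apply: le_trans (ler_normB _ _) _; rewrite norm_scale_ge0//.
    have : s * `|h1| <= `|h1| by rewrite ler_piMl.
    by have := norm_le_1Dsqr p; clear -LS P0 h1P cP cP1; lra.
- move=> al k0 k al2 als x2r x1r; apply: le_trans (hP al k0 k al2 als x2r x1r) _.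
  rewrite -/y'.
  rewrite [in X in _ <= X]scaleNr dotvNl !dotvZl !dotvDl dotvNl dotvZl !dotvDr dotvZr -/C1.
  set S := al ^+ 2 + _ + _ + eta.
  have etaS : eta <= S by rewrite /S lerDr !addr_ge0 ?sqr_ge0.
  have S0 : 0 <= S by apply: le_trans etaS; exact: ltW.
  have err1 : Cb * eta * (h + e) <= Cb * (h + e) * S.
    by rewrite mulrAC ler_wpM2l// mulr_ge0//; clear -LS Cb1; lra.
  have err2 : C1 * (h + e) * S + Cb * (h + e) * S <= C * (h + e) * S.
    rewrite -!mulrDl ler_wpM2r// ler_wpM2r// /C; have := sqr_ge0 c; clear -LS; lra.
  have -> : h * (lagr (s, y) p + dotv p k - al * H (s, y) p - h0' * (al * s)
    - (dotv h1 k0 + s * dotv h1 k) + C1 * (1 + `|p| ^+ 2) * S) =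
    h * lagr (s, y) p + C1 * (h + e) * S
    + (h * (- H (s, y) p - h0' * s) * al + - (h * dotv h1 k0) + h * (dotv p k - s * dotv h1 k)).
    by rewrite -hPe; ring.
  clear -LS ub2 err1 err2; lra.
Qed.

(** One affine motion takes every vertex [(s, y)] to [((1 + al) s, y + k0 + s k)], so the perturbed
    steps telescope. Dilation fixes time 0, hence only [k0] moves the starting point. With [k0 = 0]
    the end point moves freely in space-time and the initial datum does not enter, which yields
    semiconcavity; with [al = 0] and [k = 0] the chain is translated and inherits the Lipschitz
    bound of [u] at time 0. *)
Lemma chain : exists C sigma e1 : R, [/\ 1 <= C, 0 < sigma, sigma <= s0, 0 < e1 &
  forall (t0 eta : R) (N : nat) x0, 0 < eta <= e1 -> t0 = N%:R * eta ^+ 2 -> t0 <= sigma ->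
  `|x0 - y0| <= rho / 4 -> exists y (l0 : R) (l1 l2 : 'rV[R]_n),
    [/\ `|x0 - y| <= rho / 8, [/\ `|l0| <= C, `|l1| <= C & `|l2| <= C] &
    forall (al : R) (k0 k : 'rV[R]_n), `|al| <= 2^-1 -> (1 + al) * t0 <= s0 ->
      `|k0| <= rho / 8 -> t0 * `|k| <= rho / 8 ->
      u ((1 + al) * t0, x0 + k0 + t0 *: k) <= u (0, y + k0) - u (0, y) + u (t0, x0)
      + (l0 * al + dotv l1 k0 + dotv l2 k) + C * (al ^+ 2 + `|k0| ^+ 2 + `|k| ^+ 2 + eta)]].
Proof.
have [C [e1 [C1 e10 step]]] := chain_step.
have c0 := ls_c0 LS; have c1 := ls_c LS.
have /andP[s00 s01] := ls_s0 LS; have /andP[rho0 rho1] := ls_rho LS.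
(* The total energy will be at most [16 c ^+ 2], as [u] and the running cost vary by at most [4 c].
   This weight gives the energy a share [rho / 16] of the displacement, and [sg] limits the share of
   the elapsed time in the same way. *)
pose m := rho / 16 / (16 * c ^+ 3).
have m0 : 0 < m by apply: divr_gt0; [exact: divr_gt0|apply: mulr_gt0 => //; exact: exprn_gt0].
pose sg := Num.min s0 (m * rho / (16 * c)).
have sg0 : 0 < sg by rewrite lt_min s00; apply: divr_gt0; exact: mulr_gt0.
have sgs : sg <= s0 by rewrite ge_min lexx.
have sgm : c * (sg / m) <= rho / 16.
  have : sg <= m * rho / (16 * c) by rewrite ge_min lexx orbT.
  rewrite ler_pdivlMr ?mulr_gt0// => h; rewrite mulrA ler_pdivrMr//.
  by clear -LS h; lra.
have mc : c * (m * (16 * c ^+ 2)) = rho / 16 by rewrite /m; field; rewrite gt_eqF.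
clearbody m sg.
pose C' := C * (1 + 16 * c ^+ 2).
have c20 := sqr_ge0 c.
have C'1 : 1 <= C' by rewrite /C'; clear -LS C1 c20; nra.
exists C', sg, e1; split=> // t0 eta N x0 etae t0E t0s x0r.
have /andP[eta0 _] := etae.
set h := eta ^+ 2 in t0E; have h0 : 0 < h by rewrite exprn_gt0.
have t00 : 0 <= t0 by rewrite t0E mulr_ge0// ltW.
have t01 : t0 <= 1 by apply: le_trans t0s _; exact: le_trans s01.
have zB : box (t0, x0).
  by split => /=; [apply/andP; split|]; clear -LS t00 t0s sgs x0r rho0; lra.
have uB : `|u (t0, x0)| <= c := ls_u LS zB.
suff /(_ N (leqnn N)) : forall j, (j <= N)%N -> exists e y (l0 : R) (l1 l2 : 'rV[R]_n),
  let s := t0 - j%:R * h in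
  [/\ [/\ 0 <= e, e <= 16 * c ^+ 2, e / (4 * c) <= u (t0, x0) - u (s, y) + 2 * c * (j%:R * h) &
      `|x0 - y| <= rho / 8],
      `|x0 - y| <= c * (m * e + j%:R * h / m),
      [/\ `|l0| <= C * (j%:R * h + e), `|l1| <= C * (j%:R * h + e) & `|l2| <= C * (j%:R * h + e)] &
      forall (al : R) (k0 k : 'rV[R]_n), `|al| <= 2^-1 -> (1 + al) * t0 <= s0 ->
      `|k0| <= rho / 8 -> t0 * `|k| <= rho / 8 ->
      u ((1 + al) * t0, x0 + k0 + t0 *: k) <= u ((1 + al) * s, y + k0 + s *: k) - u (s, y) + u (t0, x0)
      + (l0 * al + dotv l1 k0 + dotv l2 k)
      + C * (j%:R * h + e) * (al ^+ 2 + `|k0| ^+ 2 + `|k| ^+ 2 + eta)].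
  move=> [e [y [l0 [l1 [l2 [[e0 ec _ xy] _ [l0C l1C l2C] H]]]]]].
  have Ce : C * (N%:R * h + e) <= C'.
    by rewrite /C' ler_wpM2l//; [clear -LS C1; lra|rewrite -t0E; clear -LS t01 ec; lra].
  exists y, l0, l1, l2; split=> //.
    by split; apply: le_trans Ce.
  move=> al k0 k al2 als k0r kr; apply: le_trans (H al k0 k al2 als k0r kr) _.
  rewrite -t0E subrr mulr0 scale0r addr0 lerD2l ler_wpM2r ?addr_ge0 ?sqr_ge0 ?(ltW eta0)//.
  by rewrite t0E.
elim=> [_|j IH jN].
  exists 0, x0, 0, 0, 0; rewrite /= mulr0n !mul0r !subr0 !subrr !normr0 !mulr0 !addr0 ?mul0r ?mulr0.
  split=> //.
  - by split; clear -LS c20 rho0; lra.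
  - by move=> al k0 k *; rewrite !dotv0l !mul0r !addr0 subrK.
have [e [y [l0 [l1 [l2 [[e0 ec eu xy] xym [l0C l1C l2C] P]]]]]] := IH (ltnW jN).
set s := t0 - j%:R * h in eu P.
have jh : j.+1%:R * h <= t0 by rewrite t0E ler_pM2r// ler_nat.
have jhE : j.+1%:R * h = j%:R * h + h by rewrite -natr1 mulrDl mul1r.
have jh0 : 0 <= j%:R * h by rewrite mulr_ge0// ltW.
have hs : h <= s by rewrite /s; move: jh; rewrite jhE; clear -LS; lra.
have ss0 : s <= s0 by rewrite /s; clear -LS jh0 t0s sgs; lra.
have yr : `|y - y0| <= 3 / 8 * rho.
  rewrite -(subrK x0 y) -addrA (le_trans (ler_normD _ _))// distrC; clear -LS xy x0r; lra.
have yr2 : `|y - y0| <= rho / 2 by clear -LS yr rho0; lra.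
have [e' [y' [l0' [l1' [l2' [[e'0 yy'] [e'u yym' [l0C' l1C' l2C'] P']]]]]]] :=
  step s eta h y etae erefl hs ss0 yr2.
have sE : s - h = t0 - j.+1%:R * h by rewrite jhE /s; ring.
have y'r : `|y' - y0| < rho.
  rewrite -(subrK y y') -addrA (le_lt_trans (ler_normD _ _))// distrC; clear -LS yr yy' rho0; lra.
have z'B : box (s - h, y').
  by split => /=; [apply/andP; split|exact: ltW]; clear -LS hs ss0 h0; lra.
have uB' : `|u (s - h, y')| <= c := ls_u LS z'B.
have eu2 : (e + e') / (4 * c) <= u (t0, x0) - u (s - h, y') + 2 * c * (j.+1%:R * h).
  by rewrite jhE mulrDl; clear -LS eu e'u; lra.
have ec2 : e + e' <= 16 * c ^+ 2.
  move: eu2; rewrite ler_pdivrMr ?mulr_gt0// => /le_trans; apply.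
  have : j.+1%:R * h <= 1 by exact: le_trans t01.
  move: uB uB'; rewrite !ler_norml => /andP[_ u1] /andP[u2 _] jh1.
  have : u (t0, x0) - u (s - h, y') + 2 * c * (j.+1%:R * h) <= 4 * c by clear -LS u1 u2 jh1 c0; nra.
  have c40 : 0 <= 4 * c by rewrite mulr_ge0// ltW.
  by move=> /(ler_wpM2r c40); clear -LS; lra.
have xym2 : `|x0 - y'| <= c * (m * (e + e') + j.+1%:R * h / m).
  rewrite -(subrK y x0) -addrA (le_trans (ler_normD _ _))//.
  have := yym' m m0; rewrite jhE (mulrDl _ _ m^-1); clear -LS xym; lra.
have xy2 : `|x0 - y'| <= rho / 8.
  apply: le_trans xym2 _; rewrite mulrDr.
  have : c * (m * (e + e')) <= rho / 16 by rewrite -mc !ler_wpM2l// ltW.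
  have : c * (j.+1%:R * h / m) <= c * (sg / m).
    rewrite ler_wpM2l ?(ltW c0)// ler_wpM2r ?invr_ge0 ?(ltW m0)//; exact: le_trans t0s.
  by clear -LS sgm; lra.
exists (e + e'), y', (l0 + l0'), (l1 + l1'), (l2 + l2'); rewrite /= -sE.
have CE : C * (j.+1%:R * h + (e + e')) = C * (j%:R * h + e) + C * (h + e') by rewrite jhE; ring.
split=> //.
- by split=> //; exact: addr_ge0.
- by rewrite CE; split; rewrite (le_trans (ler_normD _ _))// lerD.
move=> al k0 k al2 als k0r kr.
have kn : 0 <= `|k| := normr_ge0 k.
have alm : - 2^-1 <= al by move: al2; rewrite ler_norml => /andP[].
have := P al k0 k al2 als k0r kr.
have sk r' : 0 <= r' <= t0 -> `|r' *: k| <= rho / 8.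
  move=> /andP[r0 rt]; rewrite norm_scale_ge0//; apply: le_trans kr; exact: ler_wpM2r.
have als' : (1 + al) * s <= s0.
  apply: le_trans als; rewrite ler_wpM2l//; [clear -LS alm|rewrite /s; clear -LS jh0]; lra.
have := P' al k0 k al2 als'.
have x2r : `|y + k0 + s *: k - y0| < rho.
  have -> : y + k0 + s *: k - y0 = (y - y0) + (k0 + s *: k).
    by apply/rowP => i; rewrite !mxE; ring.
  have := sk s; rewrite (le_trans (ltW h0) hs) /s gerBl jh0 => /(_ isT).
  have := ler_normD k0 (s *: k); have := ler_normD (y - y0) (k0 + s *: k).
  by clear -LS yr k0r rho0; rewrite -/s; lra.
have x1r : `|y' + k0 + (s - h) *: k - y0| < rho.
  have -> : y' + k0 + (s - h) *: k - y0 = (y' - x0) + (x0 - y0) + (k0 + (s - h) *: k).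
    by apply/rowP => i; rewrite !mxE; ring.
  have sh : 0 <= s - h <= t0 by apply/andP; split; rewrite /s in hs *; clear -LS hs h0 jh0; lra.
  have := sk _ sh; have := ler_normD k0 ((s - h) *: k).
  have := ler_normD (y' - x0 + (x0 - y0)) (k0 + (s - h) *: k); have := ler_normD (y' - x0) (x0 - y0).
  by rewrite (distrC y' x0); clear -LS xy2 x0r k0r rho0; lra.
move=> /(_ x2r x1r).
rewrite CE !dotvDl.
set S := al ^+ 2 + _ + _ + eta.
set u1 := u (_, y' + _ + _); set u2 := u (_, y + _ + _); set u3 := u (_, x0 + _ + _).
by clear -LS; lra.
Qed.

End Chain.

Lemma uniform_partition {R : realType} (t e : R) : 0 < t -> 0 < e ->
  exists (N : nat) (eta : R), 0 < eta <= e /\ t = N%:R * eta ^+ 2.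
Proof.
move=> t0 e0; pose N := (Num.truncn (t / e ^+ 2)).+1.
have N0 : 0 < N%:R :> R by rewrite ltr0n.
have tN : t / e ^+ 2 < N%:R by exact: truncnS_gt.
exists N, (Num.sqrt (t / N%:R)); split; last first.
  by rewrite sqr_sqrtr ?divr_ge0 ?(ltW t0)// mulrC divfK// gt_eqF.
rewrite sqrtr_gt0 divr_gt0//=.
rewrite -(ger0_norm (ltW e0)) -sqrtr_sqr ler_wsqrtr// ler_pdivrMr// mulrC.
by rewrite -ler_pdivrMr ?exprn_gt0// ltW.
Qed.

(** Both sequences are packed into one row of length [1 + n], so that a single index serves both. *)
Lemma bounded_cluster_point2 {R : realType} {n : nat} (f : nat -> R) (g : nat -> 'rV[R]_n) (M : R) :
  (forall i, `|f i| <= M) -> (forall i, `|g i| <= M) ->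
  exists l m, [/\ `|l| <= M, `|m| <= M &
    forall e k, 0 < e -> exists2 i, (k <= i)%N & `|f i - l| < e /\ `|g i - m| < e].
Proof.
move=> fM gM; pose h i : 'rV[R]_(1 + n) := row_mx (const_mx (f i)) (g i).
have M0 : 0 <= M by apply: le_trans (fM 0%N).
have hM i : `|h i| <= M.
  apply: norm_row_le => // j; case: (fintype.splitP j) => k jk.
    have -> : j = lshift n k by exact/val_inj.
    by rewrite row_mxEl mxE.
  have -> : j = rshift 1 k by exact/val_inj.
  by rewrite row_mxEr; apply: le_trans (norm_coord _ _) (gM i).
have [v [vM hv]] := bounded_cluster_point hM.
pose l := v ord0 (lshift n ord0); pose m : 'rV[R]_n := rsubmx v.
exists l, m; split; first by apply: le_trans vM; exact: norm_coord.
  apply: norm_row_le => // j; rewrite mxE; apply: le_trans vM; exact: norm_coord.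
move=> e k e0; have [i ki hi] := hv e k e0; exists i => //; split.
  apply: le_lt_trans hi; have := norm_coord (h i - v) (lshift n ord0).
  have hl : h i ord0 (lshift n ord0) = f i by rewrite row_mxEl mxE.
  by rewrite [(h i - v) _ _]mxE [(- v) _ _]mxE hl.
apply: le_lt_trans hi; apply: norm_row_le => // j.
have := norm_coord (h i - v) (rshift 1 j).
have hr : h i ord0 (rshift 1 j) = g i ord0 j by rewrite row_mxEr.
by rewrite [(h i - v) _ _]mxE [(- v) _ _]mxE hr [(g i - m) _ _]mxE [(- m) _ _]mxE mxE.
Qed.

(** * Lipschitz and semiconcavity estimates; supergradients *)

Section Semiconcavity.
Context {R : realType} {n : nat}.
Variables (A : R * 'rV[R]_n -> 'M[R]_n) (V u : R * 'rV[R]_n -> R).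
Variables (y0 : 'rV[R]_n) (s0 rho c : R).
Implicit Types (z : R * 'rV[R]_n) (p q x y d : 'rV[R]_n) (t r dt : R).

Local Notation H := (hamiltonian A V).
Local Notation box := (box y0 s0 rho).
Local Notation lagr := (lagr A V).

Hypothesis LS : local_solution A V u y0 s0 rho c.

(* Both estimates follow from [chain] by letting the mesh tend to zero. *)
Lemma lipschitz_semiconcave : exists C sigma : R, [/\ 1 <= C, 0 < sigma <= s0,
  (forall t x x', 0 < t <= sigma -> `|x - y0| <= rho / 4 -> `|x' - x| <= rho / 8 ->
    u (t, x') <= u (t, x) + C * `|x' - x|) &
  (forall t x, 0 < t <= sigma -> `|x - y0| <= rho / 4 -> exists (l : R) (m : 'rV[R]_n),
    forall t' x', `|t' - t| <= t / 2 -> t' <= s0 -> `|x' - x| <= rho / 8 ->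
      u (t', x') <= u (t, x) + l * (t' - t) + dotv m (x' - x)
      + C / t ^+ 2 * ((t' - t) ^+ 2 + `|x' - x| ^+ 2))].
Proof.
have [C [sg [e1 [C1 sg0 sgs e10 ch]]]] := chain LS.
have c0 := ls_c0 LS; have c1 := ls_c LS.
have /andP[s00 s01] := ls_s0 LS; have /andP[rho0 rho1] := ls_rho LS.
exists (c + c * C + C), sg; split.
- have : 0 <= c * C by rewrite mulr_ge0// ?(ltW c0)//; clear -LS C1; lra.
  by clear -LS C1 c0; lra.
- by rewrite sg0.
- move=> t x x' /andP[t0 tsg] xr x'r; apply/ler_addgt0Pl => e e0.
  have e2 : 0 < Num.min e1 (e / C) by rewrite lt_min e10 divr_gt0//; clear -LS C1; lra.
  have [N [eta [/andP[eta0]]]] := uniform_partition t0 e2.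
  rewrite le_min => /andP[ee1 eeC] tE.
  have ein : 0 < eta <= e1 by rewrite eta0.
  have [y [l0 [l1 [l2 [xy [_ l1C _] P]]]]] := ch t eta N x ein tE tsg xr.
  have := P 0 (x' - x) 0; rewrite normr0 addr0 mul1r (le_trans tsg sgs) normr0 mulr0.
  have r8 : 0 <= rho / 8 by clear -LS rho0; lra.
  move=> /(_ _ isT x'r r8); rewrite invr_ge0 => /(_ (ler0n _ _)).
  rewrite scaler0 addr0 (addrC x) subrK mulr0 dotv0r addr0 add0r !expr0n /= addr0 add0r.
  have yr : `|y - y0| <= rho / 4 + rho / 8.
    rewrite -(subrK x y) -addrA (le_trans (ler_normD _ _))// distrC; clear -LS xy xr; lra.
  have uy : `|u (0, y + (x' - x)) - u (0, y)| <= c * `|x' - x|.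
    have := @ls_u0 _ _ _ _ _ _ _ _ _ LS y (y + (x' - x)).
    have -> : y + (x' - x) - y = x' - x by rewrite addrAC subrr add0r.
    apply; first by clear -LS yr rho0; lra.
    have -> : y + (x' - x) - y0 = (y - y0) + (x' - x) by rewrite addrAC.
    by rewrite (le_trans (ler_normD _ _))//; clear -LS yr x'r rho0; lra.
  have l1x : dotv l1 (x' - x) <= c * C * `|x' - x|.
    by apply: le_trans (ls_dot_le LS _ _) _; rewrite ler_wpM2r// ler_wpM2l// ltW.
  have xx2 : C * `|x' - x| ^+ 2 <= C * `|x' - x|.
    rewrite ler_wpM2l//; first by clear -LS C1; lra.
    by rewrite expr2 ler_piMr//; clear -LS x'r rho1; lra.
  have Ceta : C * eta <= e.
    by rewrite mulrC -ler_pdivlMr//; clear -LS C1; lra.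
  move: uy; rewrite ler_norml => /andP[_ uy].
  by clear -LS uy l1x xx2 Ceta; lra.
- move=> t x /andP[t0 tsg] xr.
  have tss : t <= s0 := le_trans tsg sgs.
  have t1 : t <= 1 := le_trans tss s01.
  have seq i : exists (eta l0 : R) (l2 : 'rV[R]_n), [/\ 0 < eta <= i.+1%:R^-1, `|l0| <= C /\ `|l2| <= C &
      forall (al : R) (k : 'rV[R]_n), `|al| <= 2^-1 -> (1 + al) * t <= s0 -> t * `|k| <= rho / 8 ->
      u ((1 + al) * t, x + t *: k) <= u (t, x) + (l0 * al + dotv l2 k)
      + C * (al ^+ 2 + `|k| ^+ 2 + eta)].
    have e2 : 0 < Num.min e1 i.+1%:R^-1 by rewrite lt_min e10 invr_gt0 ltr0n.
    have [N [eta [/andP[eta0]]]] := uniform_partition t0 e2.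
    rewrite le_min => /andP[ee1 eeC] tE.
    have ein : 0 < eta <= e1 by rewrite eta0.
    have [y [l0 [l1 [l2 [xy [l0C l1C l2C] P]]]]] := ch t eta N x ein tE tsg xr.
    exists eta, l0, l2; split; [by rewrite eta0|by []|move=> al k al2 als kr].
    have := P al 0 k al2 als; rewrite normr0 expr0n /= !addr0 dotv0r addr0 => /(_ _ kr).
    have -> : 0 <= rho / 8 by clear -LS rho0; lra.
    by move=> /(_ isT); clear -LS; lra.
  have [eta {}seq] := choice seq; have [f {}seq] := choice seq; have [g {}seq] := choice seq.
  have fC i : `|f i| <= C by have [_ []] := seq i.
  have gC i : `|g i| <= C by have [_ []] := seq i.
  (* The coefficients vary with the mesh but stay bounded by [C]; their cluster point serves all
     [(t', x')] at once. *)
  have [l [m [lC mC cl]]] := bounded_cluster_point2 fC gC.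
  exists (l / t), (t^-1 *: m) => t' x' t't t's x'x.
  (* This perturbation takes the end point [(t, x)] to [(t', x')] and leaves the start of the chain
     in place. The two divisions by [t] are the origin of the constant [C / t ^+ 2]. *)
  pose al := (t' - t) / t; pose k := t^-1 *: (x' - x).
  have tn0 : t != 0 by rewrite gt_eqF.
  have al2 : `|al| <= 2^-1.
    by rewrite normrM normfV (gtr0_norm t0) ler_pdivrMr// mulrC.
  have alt : (1 + al) * t = t' by rewrite /al; field.
  have tk : t *: k = x' - x by rewrite /k scalerA divff// scale1r.
  have kr : t * `|k| <= rho / 8 by rewrite -norm_scale_ge0 ?tk// ltW.
  have kt : `|k| = `|x' - x| / t by rewrite /k norm_scale_ge0 ?invr_ge0 ?(ltW t0)// mulrC.
  apply/ler_addgt0Pl => e e0.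
  pose W := `|al| + c * `|k| + C.
  have W0 : 0 < W by rewrite ltr_wpDl ?addr_ge0 ?mulr_ge0 ?(ltW c0)//; clear -LS C1; lra.
  have eW : 0 < e / W by rewrite divr_gt0.
  have [i ik [fi gi]] := cl _ (Num.truncn (W / e)) eW.
  have [/andP[eta0 etai] _ P] := seq i.
  have etaW : eta i <= e / W.
    apply: le_trans etai _; rewrite -[leRHS]invrK lef_pV2 ?posrE ?invr_gt0 ?ltr0n// invf_div.
    apply: ltW; apply: lt_le_trans (truncnS_gt _) _; by rewrite ler_nat ltnS.
  have := P al k al2; rewrite alt tk addrC subrK => /(_ t's kr).
  have fl : f i * al <= l * al + (e / W) * `|al|.
    rewrite -lerBlDl -mulrBl; apply: le_trans (ler_norm _) _.
    by rewrite normrM ler_wpM2r// ltW.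
  have gl : dotv (g i) k <= dotv m k + (e / W) * (c * `|k|).
    rewrite -lerBlDl -dotvNl -dotvDl; apply: le_trans (ls_dot_le LS _ _) _.
    by rewrite mulrAC mulrC ler_wpM2r ?mulr_ge0 ?(ltW c0)// ltW.
  have el : C * eta i <= e / W * C by rewrite mulrC ler_wpM2r//; clear -LS C1; lra.
  have eWE : (e / W) * `|al| + (e / W) * (c * `|k|) + e / W * C = e.
    by rewrite -!mulrDr -/W divfK// gt_eqF.
  have -> : l / t * (t' - t) = l * al by rewrite /al; field.
  have -> : dotv (t^-1 *: m) (x' - x) = dotv m k by rewrite /k dotvZl dotvZr.
  have CC : C * (al ^+ 2 + `|k| ^+ 2) <=
     (c + c * C + C) / t ^+ 2 * ((t' - t) ^+ 2 + `|x' - x| ^+ 2).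
    have -> : al ^+ 2 + `|k| ^+ 2 = ((t' - t) ^+ 2 + `|x' - x| ^+ 2) / t ^+ 2.
      by rewrite /al kt; field.
    rewrite [leRHS]mulrAC -mulrA ler_wpM2r ?divr_ge0 ?addr_ge0 ?sqr_ge0//.
    by have : 0 <= c * C; [rewrite mulr_ge0// ?(ltW c0)//|]; clear -LS C1 c0; lra.
  by clear -LS fl gl el eWE CC; lra.
Qed.

(* Momenta [p] for which [(- H(z, p), p)] is a space-time superdifferential of
   [u] at [z], with a quantified quadratic error. *)
Definition supergrad (K r : R) z : set 'rV[R]_n :=
  [set p | forall t' x', `|t' - z.1| < z.1 / 2 -> `|x' - z.2| <= r ->
    u (t', x') <= u z - H z p * (t' - z.1) + dotv p (x' - z.2)
    + K / z.1 ^+ 2 * ((t' - z.1) ^+ 2 + `|x' - z.2| ^+ 2)].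

(** Test in the direction of the difference of the two jets itself: the left side is linear in the
    length of the step, the right side quadratic. *)
Lemma jet_unique (l0 l1 K r : R) (m0 m1 : 'rV[R]_n) : 0 < r ->
  (forall dt d, `|dt| < r -> `|d| < r ->
    (l0 - l1) * dt + dotv (m0 - m1) d <= K * (dt ^+ 2 + `|d| ^+ 2)) ->
  l0 = l1 /\ m0 = m1.
Proof.
move=> r0 h; set l := l0 - l1 in h; set m := m0 - m1 in h.
pose W := l ^+ 2 + dotv m m.
have W1 : l ^+ 2 + `|m| ^+ 2 <= W by rewrite lerD2l sqr_norm_le_dotv.
have l2 := sqr_ge0 l; have m2 := sqr_ge0 `|m|.
have [W0|Wgt0] := lerP W 0.
  have l0' : l ^+ 2 == 0 by rewrite eq_le l2 andbT; clear -LS W0 W1 m2; lra.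
  have m0' : `|m| ^+ 2 == 0 by rewrite eq_le m2 andbT; clear -LS W0 W1 l2; lra.
  move: l0' m0'; rewrite !expf_eq0 /= normr_eq0 => /eqP l00 /eqP m00.
  by split; apply/eqP; rewrite -subr_eq0 -/l -/m ?l00 ?m00.
pose s := Num.min (r / (2 * (1 + `|l| + `|m|))) (2 * (1 + `|K|))^-1.
have B0 : 0 < 2 * (1 + `|l| + `|m|) by rewrite mulr_gt0// ltr_wpDr// ltr_wpDr.
have K0 : 0 < 2 * (1 + `|K|) by rewrite mulr_gt0// ltr_wpDr.
have s0' : 0 < s by rewrite lt_min divr_gt0// invr_gt0.
have sr : s * (2 * (1 + `|l| + `|m|)) <= r by rewrite -ler_pdivlMr// ge_min lexx.
have sK : s * (2 * (1 + `|K|)) <= 1 by rewrite -ler_pdivlMr// div1r ge_min lexx orbT.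
have sl0 : 0 <= s * `|l| by rewrite mulr_ge0// ltW.
have sm0 : 0 <= s * `|m| by rewrite mulr_ge0// ltW.
have slr : `|s * l| < r by rewrite normrM gtr0_norm//; clear -LS sr s0' sl0 sm0; lra.
have smr : `|s *: m| < r by rewrite norm_scale_ge0 ?ltW//; clear -LS sr s0' sl0 sm0; lra.
have := h _ _ slr smr; rewrite dotvZr norm_scale_ge0 ?(ltW s0')// !exprMn -mulrDr.
have -> : l * (s * l) + s * dotv m m = s * W by rewrite /W; ring.
have : K * (s ^+ 2 * (l ^+ 2 + `|m| ^+ 2)) <= s * (2^-1 * W).
  apply: (@le_trans _ _ (`|K| * (s ^+ 2 * W))).
    apply: (@le_trans _ _ (`|K| * (s ^+ 2 * (l ^+ 2 + `|m| ^+ 2)))).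
      by rewrite ler_wpM2r ?ler_norm// mulr_ge0 ?sqr_ge0// addr_ge0.
    by rewrite ler_wpM2l// ler_wpM2l// sqr_ge0.
  have -> : `|K| * (s ^+ 2 * W) = s * (s * `|K| * W) by ring.
  rewrite ler_pM2l// ler_pM2r//; clear -LS sK s0'; lra.
move=> h1 h2; exfalso; have := le_trans h2 h1; rewrite ler_pM2l//; clear -LS Wgt0; lra.
Qed.

(** Between two touching paraboloids [u] has a single first-order jet, so the sub- and the
    supersolution inequality hold for the same momentum. *)
Lemma touching_equation t x (l l' K K' r : R) (m m' : 'rV[R]_n) :
  0 < t < s0 -> `|x - y0| < rho -> 0 < r ->
  (forall t' x', `|t' - t| < r -> `|x' - x| < r ->
    u (t', x') <= u (t, x) + l * (t' - t) + dotv m (x' - x)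
      + K * ((t' - t) ^+ 2 + `|x' - x| ^+ 2)) ->
  (forall t' x', `|t' - t| < r -> `|x' - x| < r ->
    u (t, x) + l' * (t' - t) + dotv m' (x' - x)
      - K' * ((t' - t) ^+ 2 + `|x' - x| ^+ 2) <= u (t', x')) ->
  l = - H (t, x) m.
Proof.
move=> ts xr r0 up lo.
have [ll mm] : l' = l /\ m' = m.
  apply: (@jet_unique _ _ (K + K') r) => // dt d dtr dr.
  have := up (t + dt) (x + d); have := lo (t + dt) (x + d).
  rewrite !(addrC _ dt) !(addrC _ d) !addrK => /(_ dtr dr) h1 /(_ dtr dr) h2.
  by rewrite dotvDl dotvNl; clear -LS h1 h2; lra.
rewrite ll mm in lo.
have := ls_sub LS ts xr r0 up; have := ls_super LS ts xr r0 lo.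
by clear -LS; lra.
Qed.

Definition semiconcave_on (C sigma : R) := [/\ 1 <= C, 0 < sigma <= s0,
  (forall t x x', 0 < t <= sigma -> `|x - y0| <= rho / 4 -> `|x' - x| <= rho / 8 ->
    u (t, x') <= u (t, x) + C * `|x' - x|) &
  (forall t x, 0 < t <= sigma -> `|x - y0| <= rho / 4 -> exists (l : R) (m : 'rV[R]_n),
    forall t' x', `|t' - t| <= t / 2 -> t' <= s0 -> `|x' - x| <= rho / 8 ->
      u (t', x') <= u (t, x) + l * (t' - t) + dotv m (x' - x)
      + C / t ^+ 2 * ((t' - t) ^+ 2 + `|x' - x| ^+ 2))].

Section Supergradient.
Variables (C sigma : R).
Hypothesis SC : semiconcave_on C sigma.

(** A short move from [x] against [p] lowers [u] by about [th |p|^2], whereas the Lipschitz bound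
    allows at most [C th |p|]. *)
Lemma supergrad_bnd K r t x p : 0 <= K -> 0 < r -> 0 < t <= sigma -> `|x - y0| <= 3 / 16 * rho ->
  supergrad K r (t, x) p -> `|p| <= C.
Proof.
move=> K0 r0 ts xr px; have [C1 _ lip _] := SC.
have /andP[rho0 rho1] := ls_rho LS; have [t0 _] := andP ts.
have [->|pn0] := eqVneq p 0; first by rewrite normr0; clear -LS SC C1; lra.
have pn : 0 < `|p| by rewrite normr_gt0.
rewrite leNgt; apply/negP => Cp.
pose D := K / t ^+ 2 * `|p| ^+ 2.
have D0 : 0 <= D by rewrite mulr_ge0 ?sqr_ge0// divr_ge0 ?sqr_ge0.
pose G := `|p| * (`|p| - C); have G0 : 0 < G by rewrite mulr_gt0// subr_gt0.
pose th := Num.min (Num.min (r / `|p|) (rho / 16 / `|p|)) (G / (2 * (D + 1))).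
have D1 : 0 < 2 * (D + 1) by rewrite mulr_gt0// ltr_wpDl.
have th0 : 0 < th by rewrite !lt_min !divr_gt0.
have thr : th * `|p| <= r by rewrite -ler_pdivlMr// !ge_min lexx.
have thrho : th * `|p| <= rho / 16 by rewrite -ler_pdivlMr// !ge_min lexx orbT.
have thG : th * (2 * (D + 1)) <= G by rewrite -ler_pdivlMr// ge_min lexx orbT.
clearbody th.
pose x' := x - th *: p.
have xx' : x' - x = - (th *: p) by rewrite /x' addrAC subrr add0r.
have nx : `|x' - x| = th * `|p| by rewrite xx' normrN norm_scale_ge0// ltW.
have := px t x'; rewrite /= subrr normr0 mulr0 subr0 expr0n add0r /= divr_gt0// nx => /(_ isT thr).
have x'r : `|x' - y0| <= rho / 4.
  rewrite -(subrK x x') -addrA (le_trans (ler_normD _ _))// nx; clear -LS SC xr thrho; lra.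
have thrho8 : th * `|p| <= rho / 8 by apply: le_trans thrho _; clear -LS SC rho0; lra.
have := lip t x' x ts x'r; rewrite distrC nx => /(_ thrho8) h1.
rewrite xx' dotvNr dotvZr exprMn => h2.
have := sqr_norm_le_dotv p; rewrite -(ler_pM2l th0) => h3.
have : th * (`|p| ^+ 2) <= C * (th * `|p|) + th ^+ 2 * D by rewrite /D; clear -LS SC h1 h2 h3; lra.
have -> : C * (th * `|p|) + th ^+ 2 * D = th * (C * `|p| + th * D) by ring.
rewrite ler_pM2l// => h4; have : 0 < th * D + 2 * th by rewrite ltr_wpDl ?mulr_gt0// mulr_ge0// ltW.
by rewrite /G in thG G0; clear -LS SC h4 thG th0 G0; lra.
Qed.

Lemma hamiltonian_lip M z z' p p' : box z -> box z' -> `|p| <= M -> `|p'| <= M ->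
  `|H z' p' - H z p| <= c ^+ 2 * (1 + M + M ^+ 2) * (dist1 z z' + `|p' - p|).
Proof.
move=> zB zB' pM p'M; have c0 := ls_c0 LS; have c1 := ls_c LS.
have M0 : 0 <= M := le_trans (normr_ge0 _) pM.
have D0 : 0 <= dist1 z z' by rewrite addr_ge0.
have c2 : c <= c ^+ 2 by rewrite -[leLHS]expr1 ler_weXn2l.
have -> : H z' p' - H z p = 2^-1 * (aform A z' p' p' - aform A z p' p') + (V z' - V z)
    + 2^-1 * aform A z (p' - p) (p' + p).
  by rewrite !hamiltonianE !aformE (aformC LS p p' zB); ring.
have h1 : `|aform A z' p' p' - aform A z p' p'| <= c ^+ 2 * dist1 z z' * M ^+ 2.
  apply: le_trans (aform_lip LS _ _ zB zB') _; rewrite -mulrA -expr2.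
  by apply: ler_wpM2l; [rewrite mulr_ge0 ?sqr_ge0|exact: sqr_le_mono].
have h2 := ls_Vlip LS zB zB'.
have h3 : `|aform A z (p' - p) (p' + p)| <= c ^+ 2 * `|p' - p| * (2 * M).
  have pp : `|p' + p| <= 2 * M by rewrite (le_trans (ler_normD _ _))//; clear -LS pM p'M; lra.
  apply: le_trans (ls_dot LS _ _) _; apply: ler_pM => //; first by rewrite mulr_ge0// ltW.
  by rewrite expr2 -mulrA; apply: ler_wpM2l; [exact: ltW|exact: ls_bnd LS _ _ zB].
apply: le_trans (ler_normD _ _) _; apply: le_trans (lerD (ler_normD _ _) (lexx _)) _.
rewrite !normrM !(@ger0_norm _ 2^-1)//.
have e1 : c * dist1 z z' <= c ^+ 2 * dist1 z z' by rewrite ler_wpM2r.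
have c20 := sqr_ge0 c; have M20 := sqr_ge0 M.
have e2 : 0 <= c ^+ 2 * M * dist1 z z' by rewrite mulr_ge0// mulr_ge0.
have e3 : 0 <= c ^+ 2 * (1 + M ^+ 2) * `|p' - p|.
  by rewrite mulr_ge0// mulr_ge0// addr_ge0.
have e4 : 0 <= c ^+ 2 * dist1 z z' * M ^+ 2 by rewrite mulr_ge0// mulr_ge0.
by clear -LS h1 h2 h3 e1 e2 e3 e4; lra.
Qed.

(** The factor 8 is 4, for replacing [t1 >= t / 2] by [t] in the constant, times 2, from
    [(a + b)^2 <= 2 (a^2 + b^2)]. The halved radius leaves room for the displacement of the
    centre. *)
Lemma supergrad_limit K r M t x p : 0 <= K -> 0 < r <= 1 -> 0 < t -> box (t, x) -> `|p| <= M ->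
  (forall de, 0 < de -> exists t1 x1 p1, [/\ `|t1 - t| < de, `|x1 - x| < de, box (t1, x1),
     `|p1| <= M /\ `|p1 - p| < de & supergrad K r (t1, x1) p1]) ->
  supergrad (8 * K) (r / 2) (t, x) p.
Proof.
move=> K0 /andP[r0 r1] t0 zB pM app t' x' /=.
set tau := t' - t; set xi := x' - x => taut xir.
have c0 := ls_c0 LS; have c1 := ls_c LS; have M0 : 0 <= M := le_trans (normr_ge0 _) pM.
have t1 : t <= 1.
  have [/andP[_ ts] _] : 0 <= t <= s0 /\ _ := zB.
  by apply: le_trans ts _; have /andP[] := ls_s0 LS.
apply/ler_addgt0Pl => e e0; have e20 : 0 < e / 2 by rewrite divr_gt0.
have [d d0 ud] := within_continuous_dist (ls_cont LS) zB e20.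
pose CH := c ^+ 2 * (1 + M + M ^+ 2).
have CH0 : 0 <= CH by rewrite mulr_ge0 ?sqr_ge0// !addr_ge0 ?sqr_ge0.
pose W := 3 * CH + c ^+ 2 * (1 + M ^+ 2) + c + c * M + 16 * K / t ^+ 2 + 1.
have Kt0 : 0 <= K / t ^+ 2 by rewrite divr_ge0 ?sqr_ge0.
have cM0 : 0 <= c * M by rewrite mulr_ge0// ltW.
have B0 : 0 <= c ^+ 2 * (1 + M ^+ 2) by rewrite mulr_ge0 ?sqr_ge0// addr_ge0 ?sqr_ge0.
have W0 : 0 < W by rewrite /W; clear -LS CH0 Kt0 cM0 B0 c0; lra.
pose de := Num.min (Num.min (Num.min d ((t / 2 - `|tau|) / 2)) (r / 2)) (e / 2 / W).
have de0 : 0 < de by rewrite !lt_min d0 !divr_gt0// subr_gt0.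
have ded : de <= d by rewrite !ge_min lexx.
have det : de <= (t / 2 - `|tau|) / 2 by rewrite !ge_min lexx orbT.
have der : de <= r / 2 by rewrite !ge_min lexx !orbT.
have deW : de * W <= e / 2 by rewrite -ler_pdivlMr// !ge_min lexx !orbT.
clearbody de.
have [t1' [x1 [p1 [t1t x1x z1B [p1M p1p] sg]]]] := app de de0.
have tau0 := normr_ge0 tau.
have [t1l t1u] : t - de < t1' /\ t1' < t + de.
  by move: t1t; rewrite ltr_norml => /andP[h1 h2]; split; clear -LS h1 h2; lra.
have t1g : t / 2 <= t1' by clear -LS t1l det tau0 t0; lra.
have tt : t' - t1' = tau - (t1' - t) by rewrite /tau; ring.
have xx : x' - x1 = xi - (x1 - x) by rewrite /xi opprB addrA subrK.
have taut1 : `|t' - t1'| < t1' / 2.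
  by rewrite tt (le_lt_trans (ler_normB _ _))//; clear -LS t1t t1l det de0; lra.
have xir1 : `|x' - x1| <= r.
  by rewrite xx (le_trans (ler_normB _ _))//; clear -LS x1x xir der; lra.
have := sg t' x' taut1 xir1.
have := ud _ z1B (lt_le_trans t1t ded) (lt_le_trans x1x ded).
have hl := hamiltonian_lip zB z1B pM p1M.
have hb := hamiltonian_bnd LS p1 z1B.
rewrite ltr_norml => /andP[_ u1] /= u2.
have D2 : dist1 (t, x) (t1', x1) + `|p1 - p| <= 3 * de by rewrite /dist1 /=; clear -LS t1t x1x p1p; lra.
have p1M2 : c ^+ 2 * (1 + `|p1| ^+ 2) <= c ^+ 2 * (1 + M ^+ 2).
  by rewrite ler_wpM2l ?sqr_ge0// lerD2l; exact: sqr_le_mono.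
have tau1 : `|tau| <= 1 by clear -LS taut t1; lra.
have xi1 : `|xi| <= 1 by clear -LS xir r1; lra.
have HE : - (H (t1', x1) p1 * (t' - t1')) <= - (H (t, x) p * tau)
    + 3 * CH * de + c ^+ 2 * (1 + M ^+ 2) * de.
  have -> : - (H (t1', x1) p1 * (t' - t1')) = - (H (t, x) p * tau)
      - (H (t1', x1) p1 - H (t, x) p) * tau + H (t1', x1) p1 * (t1' - t) by rewrite tt; ring.
  have : `|(H (t1', x1) p1 - H (t, x) p) * tau| <= 3 * CH * de.
    rewrite normrM (le_trans (ler_piMr _ tau1))// (le_trans hl)// -/CH.
    have := ler_wpM2l CH0 D2; clear -LS; lra.
  have : `|H (t1', x1) p1 * (t1' - t)| <= c ^+ 2 * (1 + M ^+ 2) * de.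
    by rewrite normrM ler_pM//; [exact: le_trans p1M2|exact: ltW].
  by rewrite !ler_norml => /andP[_ e1] /andP[e2 _]; clear -LS e1 e2; lra.
have DE : dotv p1 (x' - x1) <= dotv p xi + c * de + c * M * de.
  have -> : dotv p1 (x' - x1) = dotv p xi + dotv (p1 - p) xi + dotv p1 (x - x1).
    by rewrite xx opprB dotvDr [dotv (p1 - p) _]dotvDl dotvNl (addrC (dotv p xi)) subrK.
  have : dotv (p1 - p) xi <= c * de.
    apply: le_trans (ls_dot_le LS _ _) _; rewrite (le_trans (ler_piMr _ xi1))//.
      by rewrite mulr_ge0// ltW.
    by apply: ler_wpM2l; exact: ltW.
  have : dotv p1 (x - x1) <= c * M * de.
    apply: le_trans (ls_dot_le LS _ _) _; apply: ler_pM => //; first by rewrite mulr_ge0// ltW.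
      by apply: ler_wpM2l => //; exact: ltW.
    by rewrite distrC; exact: ltW.
  by clear -LS; lra.
have de1 : de <= 1 by clear -LS der r1 r0; lra.
have de2 : de ^+ 2 <= de by rewrite expr2 ler_piMl// ltW.
have KE : K / t1' ^+ 2 * ((t' - t1') ^+ 2 + `|x' - x1| ^+ 2) <=
    8 * K / t ^+ 2 * (tau ^+ 2 + `|xi| ^+ 2) + 16 * K / t ^+ 2 * de.
  have k1 : K / t1' ^+ 2 <= 4 * (K / t ^+ 2).
    have -> : 4 * (K / t ^+ 2) = K / (t / 2) ^+ 2 by field; rewrite gt_eqF.
    have t20 : 0 < t / 2 by rewrite divr_gt0.
    rewrite ler_wpM2l// lef_pV2 ?posrE ?exprn_gt0//; first by apply: sqr_le_mono => //; exact: ltW.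
    exact: lt_le_trans t1g.
  have k2 : (t' - t1') ^+ 2 <= 2 * (tau ^+ 2 + de ^+ 2).
    rewrite tt; apply: le_trans (sqrD_le _ _) _; rewrite sqrrN ler_wpM2l// lerD2l.
    by rewrite -(real_normK (num_real (t1' - t))); apply: sqr_le_mono => //; exact: ltW.
  have k3 : `|x' - x1| ^+ 2 <= 2 * (`|xi| ^+ 2 + de ^+ 2).
    apply: (@le_trans _ _ ((`|xi| + de) ^+ 2)); last exact: sqrD_le.
    apply: sqr_le_mono => //; rewrite xx (le_trans (ler_normB _ _))// lerD2l; exact: ltW.
  have k4 := ler_pM (divr_ge0 K0 (sqr_ge0 t1')) (addr_ge0 (sqr_ge0 _) (sqr_ge0 _)) k1 (lerD k2 k3).
  apply: le_trans k4 _.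
  have -> : 8 * K / t ^+ 2 = 8 * (K / t ^+ 2) by rewrite mulrA.
  have -> : 16 * K / t ^+ 2 = 16 * (K / t ^+ 2) by rewrite mulrA.
  have := ler_wpM2l Kt0 de2; clear -LS; lra.
by rewrite /W in deW; clear -LS u1 u2 HE DE KE deW de0; lra.
Qed.

(** A semiconcave solution satisfies the equation at each point where a paraboloid touches it from
    below, and such points are dense: take a minimum point of [u] plus a steep paraboloid centred at
    [(t, x)]. *)
Lemma touching_point t x (e : R) : 0 < t <= sigma / 2 -> `|x - y0| <= rho / 8 -> 0 < e ->
  exists t1 x1 p1, [/\ `|t1 - t| < e, `|x1 - x| < e, box (t1, x1), `|p1| <= C &
    supergrad C (rho / 8) (t1, x1) p1].
Proof.
move=> /andP[t0 tsg] xr e0; have [C1 /andP[sg0 sgs] _ sc] := SC.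
have c0 := ls_c0 LS; have c1 := ls_c LS; have /andP[rho0 rho1] := ls_rho LS.
pose de := Num.min (Num.min e (t / 8)) (rho / 16).
have de0 : 0 < de by rewrite !lt_min e0 !divr_gt0.
have dee : de <= e by rewrite !ge_min lexx.
have det : de <= t / 8 by rewrite !ge_min lexx orbT.
have der : de <= rho / 16 by rewrite !ge_min lexx !orbT.
clearbody de.
have de20 : 0 < de ^+ 2 by rewrite exprn_gt0.
(* At distance [de] the paraboloid exceeds the oscillation [2 c] of [u], which keeps the minimum
   point closer than that to the centre. *)
pose k := (2 * c + 1) / de ^+ 2.
have kde : k * de ^+ 2 = 2 * c + 1 by rewrite divfK// gt_eqF.
have k0 : 0 < k by rewrite divr_gt0//; clear -LS SC c0; lra.
clearbody k.
pose Kc := `[3 * t / 4, 5 * t / 4] `*` [set y | `|y - x| <= rho / 8].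
have Kcbox z : Kc z -> box z.
  case: z => t' x' [/= + x'x]; rewrite in_itv /= => /andP[ta tb].
  split => /=; first by apply/andP; split; clear -LS SC ta tb t0 tsg sgs sg0; lra.
  rewrite -(subrK x x') -addrA (le_trans (ler_normD _ _))//; clear -LS SC x'x xr rho0; lra.
have cK : compact Kc by apply: compact_setX; [exact: segment_compact|exact: compact_norm_ball].
have K0 : Kc (t, x).
  split => /=; last by rewrite subrr normr0; clear -LS SC rho0; lra.
  by rewrite in_itv /=; apply/andP; split; clear -LS SC t0; lra.
pose g (z : R * 'rV[R]_n) := k * ((z.1 - t) ^+ 2 + dotv (z.2 - x) (z.2 - x)).
have cg : continuous g.
  have ct : continuous (fun z : R * 'rV[R]_n => z.1 - t : R).
    by move=> z; apply: cvgB; [exact: cvg_fst|exact: cvg_cst].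
  have cx : continuous (fun z : R * 'rV[R]_n => z.2 - x).
    by move=> z; apply: cvgB; [exact: cvg_snd|exact: cvg_cst].
  move=> z; apply: cvgM; first exact: cvg_cst.
  apply: cvgD; last by apply: cvg_dotv; exact: cx.
  by rewrite expr2; apply: cvgM; exact: ct.
have cu : {within Kc, continuous u} by apply: continuous_subspaceW (ls_cont LS) => z /Kcbox.
have [[t1 x1] Kt1 minw] := compact_EVT_min (ex_intro _ _ K0) cK
  (within_continuousD cu (continuous_subspaceT cg)).
rewrite inE in Kt1; have z1B := Kcbox _ Kt1; have zB := Kcbox _ K0.
have min' t' x' : Kc (t', x') -> u (t1, x1) + g (t1, x1) <= u (t', x') + g (t', x').
  by move=> Kz; apply: minw; rewrite inE.
clear minw.
have D0 := dotvv_ge0 (x1 - x).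
have g1 : (t1 - t) ^+ 2 + dotv (x1 - x) (x1 - x) < de ^+ 2.
  rewrite -(ltr_pM2l k0) kde.
  have := min' _ _ K0; rewrite /g /= !subrr dotv0l expr0n /= addr0 mulr0 addr0.
  have := ls_u LS z1B; have := ls_u LS zB; rewrite !ler_norml => /andP[_ u1] /andP[u2 _].
  by clear -LS SC u1 u2; lra.
have t1t : `|t1 - t| < de.
  rewrite ltNge; apply/negP => h; have := sqr_le_mono (ltW de0) h.
  by rewrite real_normK ?num_real//; clear -LS SC g1 D0; lra.
have x1x : `|x1 - x| < de.
  rewrite ltNge; apply/negP => h; have := sqr_le_mono (ltW de0) h.
  by have := sqr_norm_le_dotv (x1 - x); have := sqr_ge0 (t1 - t); clear -LS SC g1; lra.
have [t1l t1u] : t - de < t1 /\ t1 < t + de.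
  by move: t1t; rewrite ltr_norml => /andP[h1 h2]; split; clear -LS SC h1 h2; lra.
have t1s : 0 < t1 <= sigma by apply/andP; split; clear -LS SC t1l t1u det t0 tsg sg0; lra.
have x1r : `|x1 - y0| <= 3 / 16 * rho.
  rewrite -(subrK x x1) -addrA (le_trans (ler_normD _ _))//; clear -LS SC x1x xr der; lra.
have x1r4 : `|x1 - y0| <= rho / 4 by clear -LS SC x1r rho0; lra.
have [l [m P]] := sc t1 x1 t1s x1r4.
have lH : l = - H (t1, x1) m.
  apply: (@touching_equation t1 x1 l (- (2 * k * (t1 - t))) (C / t1 ^+ 2) (k * c) (Num.min (t / 8) (rho / 16))
     m (- ((2 * k) *: (x1 - x)))).
  - by apply/andP; split; clear -LS SC t1l t1u det t0 tsg sgs sg0; lra.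
  - by clear -LS SC x1r rho0; lra.
  - by rewrite lt_min !divr_gt0.
  - move=> t' x'; rewrite !lt_min => /andP[tt _] /andP[_ xx]; apply: P.
    + by clear -LS SC tt t1l det t0; lra.
    + by move: tt; rewrite ltr_norml => /andP[_ h]; clear -LS SC h t1u det t0 tsg sgs sg0; lra.
    + by clear -LS SC xx rho0; lra.
  move=> t' x'; rewrite !lt_min => /andP[tt _] /andP[_ xx].
  have : Kc (t', x').
    split => /=.
      rewrite in_itv /=; move: tt; rewrite ltr_norml => /andP[h1 h2].
      by apply/andP; split; clear -LS SC h1 h2 t1l t1u det t0; lra.
    by rewrite -(subrK x1 x') -addrA (le_trans (ler_normD _ _))//; clear -LS SC xx x1x der; lra.
  move=> /min'; rewrite /g /=.
  have -> : t' - t = (t1 - t) + (t' - t1) by ring.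
  have -> : x' - x = (x1 - x) + (x' - x1) by apply/rowP => i; rewrite !mxE; ring.
  have := ler_wpM2l (ltW k0) (ls_dotvv LS (x' - x1)).
  set d := x' - x1; set y := x1 - x; set dt := t' - t1; set tau := t1 - t.
  clearbody d y dt tau; clear min'.
  have kk : k * dt ^+ 2 <= k * c * dt ^+ 2.
    by rewrite ler_wpM2r ?sqr_ge0// ler_peMr// ltW.
  rewrite dotvDl !dotvDr (dotvC d y) dotvNl dotvZl; clear -LS SC kk; lra.
have sg1 : supergrad C (rho / 8) (t1, x1) m.
  move=> t' x' /= tt xx; rewrite -mulNr -lH; apply: P => //; first exact: ltW.
  by move: tt; rewrite ltr_norml => /andP[_ h]; clear -LS SC h t1u det t0 tsg sgs sg0; lra.
exists t1, x1, m; split=> //; [exact: lt_le_trans dee|exact: lt_le_trans dee|].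
have CK : 0 <= C by clear -LS SC C1; lra.
have r80 : 0 < rho / 8 by rewrite divr_gt0.
by apply: (supergrad_bnd CK r80 t1s x1r sg1).
Qed.

Lemma inv_succ_lt (de : R) : 0 < de -> (Num.truncn de^-1).+1%:R^-1 < de.
Proof.
by move=> de0; rewrite invf_plt ?posrE ?ltr0n//; exact: truncnS_gt.
Qed.

Lemma supergrad_nonempty t x : 0 < t <= sigma / 2 -> `|x - y0| <= rho / 8 ->
  exists2 p, `|p| <= C & supergrad (8 * C) (rho / 16) (t, x) p.
Proof.
move=> ts xr; have [C1 /andP[sg0 sgs] _ _] := SC; have /andP[rho0 rho1] := ls_rho LS.
have [t1 {}P] := choice (fun i : nat => touching_point ts xr
  (ltac:(by rewrite invr_gt0 ltr0n) : 0 < i.+1%:R^-1)).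
have [x1 {}P] := choice P; have [p1 {}P] := choice P.
have pC i : `|p1 i| <= C by have [] := P i.
have [p [pM cl]] := bounded_cluster_point pC.
exists p => //; have /andP[t0 tsg] := ts.
have -> : rho / 16 = rho / 8 / 2 by field.
apply: (@supergrad_limit C (rho / 8) C t x p) => //.
- by clear -LS SC C1; lra.
- by apply/andP; split; clear -LS SC rho0 rho1; lra.
- by split => /=; [apply/andP; split|]; clear -LS SC sg0 sgs t0 tsg xr rho0; lra.
move=> de de0; have [i ik pi] := cl de (Num.truncn de^-1) de0.
have ide : i.+1%:R^-1 < de.
  apply: le_lt_trans (inv_succ_lt de0); rewrite lef_pV2 ?posrE ?ltr0n// ler_nat ltnS//.
have [h1 h2 h3 h4 h5] := P i.
by exists (t1 i), (x1 i), (p1 i); split => //; exact: lt_trans ide.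
Qed.

(** Upper semicontinuity by compactness: the momenta of a sequence of counterexamples cluster at one
    that [supergrad_limit] puts into the limiting set. *)
Lemma supergrad_usc K r M t x (e : R) : 0 <= K -> 0 < r <= 1 -> 0 < t -> box (t, x) -> 0 < e ->
  exists2 de, 0 < de & forall t1 x1 p1, `|t1 - t| < de -> `|x1 - x| < de -> box (t1, x1) ->
    `|p1| <= M -> supergrad K r (t1, x1) p1 ->
    exists p, [/\ `|p| <= M, `|p1 - p| < e & supergrad (8 * K) (r / 2) (t, x) p].
Proof.
move=> K0 r01 t0 zB e0; apply: contrapT => no.
have P (i : nat) : exists t1 x1 p1, [/\ `|t1 - t| < i.+1%:R^-1, `|x1 - x| < i.+1%:R^-1, box (t1, x1),
    `|p1| <= M /\ supergrad K r (t1, x1) p1 &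
    forall p, `|p| <= M -> supergrad (8 * K) (r / 2) (t, x) p -> e <= `|p1 - p|].
  apply: contrapT => no'; apply: no; exists i.+1%:R^-1; first by rewrite invr_gt0 ltr0n.
  move=> t1 x1 p1 h1 h2 h3 h4 h5; apply: contrapT => no; apply: no'.
  exists t1, x1, p1; split => // p pM ps; rewrite leNgt; apply/negP => h; apply: no.
  by exists p.
have [t1 {}P] := choice P; have [x1 {}P] := choice P; have [p1 {}P] := choice P.
have pC i : `|p1 i| <= M by have [_ _ _ []] := P i.
have [p [pM cl]] := bounded_cluster_point pC.
have ps : supergrad (8 * K) (r / 2) (t, x) p.
  apply: (@supergrad_limit K r M t x p) => // de de0.
  have [i ik pi] := cl de (Num.truncn de^-1) de0.
  have ide : i.+1%:R^-1 < de.
    apply: le_lt_trans (inv_succ_lt de0); rewrite lef_pV2 ?posrE ?ltr0n// ler_nat ltnS//.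
  have [h1 h2 h3 [h4 h5] _] := P i.
  by exists (t1 i), (x1 i), (p1 i); split => //; exact: lt_trans ide.
have [i _ pi] := cl e 0%N e0; have [_ _ _ _ h] := P i.
by have := h p pM ps; rewrite leNgt pi.
Qed.

End Supergradient.

End Semiconcavity.

(** * Euler polygons of a bounded field and their limits *)

Section Euler.
Context {R : realType} {n : nat}.
Variables (G : R * 'rV[R]_n -> 'rV[R]_n) (Cv : R) (x0 : 'rV[R]_n).
Hypothesis GC : forall z, `|G z| <= Cv.
Implicit Types (h s t : R) (k : nat) (e : 'rV[R]_n).

Fixpoint euler h k : 'rV[R]_n :=
  if k is k'.+1 then euler h k' + h *: G (k'%:R * h, euler h k') else x0.

Lemma euler_lip h k j : 0 <= h -> `|euler h (k + j) - euler h k| <= Cv * (j%:R * h).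
Proof.
move=> h0; elim: j => [|j IH]; first by rewrite addn0 subrr normr0 mul0r mulr0.
rewrite addnS /= addrAC (le_trans (ler_normD _ _))// -natr1 mulrDl mul1r mulrDr.
by rewrite lerD// norm_scale_ge0// mulrC ler_wpM2r.
Qed.

Lemma euler_local h k j b e : 0 <= h ->
  (forall i, (k <= i < k + j)%N -> dotv e (G (i%:R * h, euler h i)) <= b) ->
  dotv e (euler h (k + j) - euler h k) <= j%:R * h * b.
Proof.
move=> h0; elim: j => [|j IH] P; first by rewrite addn0 subrr dotv0r !mul0r.
rewrite addnS /= addrAC dotvDr dotvZr -natr1 mulrDl mul1r mulrDl lerD//.
  by apply: IH => i /andP[ki ij]; apply: P; rewrite ki addnS ltnS ltnW.
by rewrite ler_wpM2l// P// leq_addr addnS ltnS leqnn.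
Qed.

Lemma ultra_compact_cvg (T : topologicalType) (U : set_system nat) (K : set T) (f : nat -> T) :
  UltraFilter U -> compact K -> (forall i, K (f i)) -> exists l : T, f @ U --> l.
Proof.
move=> UU cK fK; have [l [_ cl]] := cK (f @ U) _ (filterS (fun i _ => fK i) filterT).
exists l => B lB; have [//|h] := in_ultra_setVsetC (f @^-1` B) UU.
by have [y [+ By]] := cl (~` B) B h lB; move/(_ By).
Qed.

(** The field is an arbitrary bounded selection, so its values do not pass to the limit. The last
    clause remembers them through half-spaces: an upper bound of [<e, G>] near [(t, g t)] is
    inherited by the increments of [g]. One ultrafilter finer than [\oo] gives the limits at all
    times at once, without a diagonal extraction. *)
Lemma euler_limit : exists g : R -> 'rV[R]_n, [/\ g 0 = x0,
  (forall s t, 0 <= s -> 0 <= t -> `|g t - g s| <= Cv * `|t - s|) &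
  forall t r, 0 <= t -> 0 < r -> exists2 d, 0 < d & forall e b,
    (forall t' x', 0 <= t' -> `|t' - t| <= r -> `|x' - g t| <= r -> dotv e (G (t', x')) <= b) ->
    forall s1 s2, 0 <= s1 <= s2 -> `|s1 - t| < d -> `|s2 - t| < d ->
    dotv e (g s2 - g s1) <= (s2 - s1) * b].
Proof.
have Cv0 : 0 <= Cv := le_trans (normr_ge0 _) (GC (0, x0)).
have [U [UU oU]] := @ultraFilterLemma nat \oo _.
pose h (N : nat) : R := N.+1%:R^-1.
have h0 N : 0 < h N by rewrite invr_gt0 ltr0n.
pose k N t := Num.truncn (t / h N).
have kl N t : 0 <= t -> (k N t)%:R * h N <= t < (k N t)%:R * h N + h N.
  move=> t0; have /andP[] := truncn_itv (divr_ge0 t0 (ltW (h0 N))).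
  by rewrite -/(k N t) ler_pdivlMr// ltr_pdivrMr// -natr1 mulrDl mul1r => -> ->.
pose f N t := euler (h N) (k N t).
have kmono N s t : s <= t -> (k N s <= k N t)%N by move=> st; apply: le_truncn; rewrite ler_pM2r ?invr_gt0.
have flip1 N s t : 0 <= s <= t -> `|f N t - f N s| <= Cv * (t - s + h N).
  move=> /andP[s0' st]; rewrite /f -(subnKC (kmono N _ _ st)).
  apply: le_trans (euler_lip _ _ (ltW (h0 N))) _; rewrite ler_wpM2l// natrB ?kmono// mulrBl.
  have /andP[a1 a2] := kl N s s0'; have /andP[b1 b2] := kl N t (le_trans s0' st).
  by move: a1 a2 b1 b2; set X := _ * h N; set Y := _ * h N; clear -GC; lra.
have flip N s t : 0 <= s -> 0 <= t -> `|f N t - f N s| <= Cv * (`|t - s| + h N).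
  move=> s0' t0; have [st|/ltW ts] := lerP s t.
    by rewrite flip1// s0'.
  by rewrite distrC flip1// t0.
have h1 N : h N <= 1 by rewrite invf_le1 ?ltr0n// ler1n.
have g_ex t : exists l : 'rV[R]_n, 0 <= t -> f ^~ t @ U --> l.
  have [t0|tlt] := lerP 0 t; last first.
    by exists 0.
  have fK N : [set y | `|y - x0| <= Cv * (t + 1)] (f N t).
    have fN0 : f N 0 = x0 by rewrite /f /k mul0r truncn0.
    rewrite /= -fN0 (le_trans (flip N _ _ _ _))// subr0 ger0_norm//.
    by rewrite ler_wpM2l// lerD2l.
  have [l fl] := ultra_compact_cvg UU (@compact_norm_ball _ _ x0 (Cv * (t + 1))) fK.
  by exists l.
have [g gP] := choice g_ex.
have near3 t1 t2 t3 w m : 0 <= t1 -> 0 <= t2 -> 0 <= t3 -> 0 < w -> exists2 N, (m <= N)%N &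
    [/\ `|f N t1 - g t1| < w, `|f N t2 - g t2| < w & `|f N t3 - g t3| < w].
  move=> t10 t20 t30 w0; have nb t : 0 <= t -> U [set N | `|f N t - g t| < w].
    move=> t0; have h2 : U (f ^~ t @^-1` ball (g t) w) := gP t t0 _ (nbhsx_ballx _ _ w0).
    by apply: filterS h2 => N; rewrite -ball_normE /= distrC.
  have FU : ProperFilter U by exact: ultra_proper.
  have := @filterI _ U FU _ _ (nb _ t10) (@filterI _ U FU _ _ (nb _ t20)
    (@filterI _ U FU _ _ (nb _ t30) (oU _ (nbhs_infty_ge m)))).
  by move=> /(@filter_ex _ _ FU)[N [a [b [c d]]]]; exists N.
exists g; split.
- apply/eqP; rewrite -subr_eq0 -normr_le0; apply/ler_addgt0Pl => w w0; rewrite addr0.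
  have [N _ [a _ _]] := near3 0 0 0 w 0%N (lexx _) (lexx _) (lexx _) w0.
  by apply: ltW; rewrite distrC; move: a; rewrite /f /k mul0r truncn0.
- move=> s t s0' t0; apply/ler_addgt0Pl => w w0.
  have W0 : 0 < 2 + Cv by rewrite ltr_wpDr.
  have w1 : 0 < w / (2 + Cv) by rewrite divr_gt0.
  have [N mN [a b _]] := near3 s t 0 _ (Num.truncn (w / (2 + Cv))^-1) s0' t0 (lexx _) w1.
  have hw : h N <= w / (2 + Cv).
    apply: ltW; apply: le_lt_trans (inv_succ_lt w1); rewrite lef_pV2 ?posrE ?ltr0n// ler_nat ltnS//.
  have wE : w / (2 + Cv) * (2 + Cv) = w by rewrite divfK// gt_eqF.
  have -> : g t - g s = (f N t - f N s) + (f N s - g s) - (f N t - g t).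
    by apply/rowP => i; rewrite !mxE; ring.
  rewrite (le_trans (ler_normB _ _))// (le_trans (lerD (ler_normD _ _) (lexx _)))//.
  have := flip N s t s0' t0; have := ler_wpM2l Cv0 hw; move: a b wE.
  set A := w / _; set X := `|t - s|; clear -GC; lra.
- move=> t r t0 r0; pose d := Num.min (r / 4) (r / (8 * (Cv + 1))).
  have C10 : 0 < 8 * (Cv + 1) by rewrite mulr_gt0// ltr_wpDl.
  have d0 : 0 < d by rewrite lt_min !divr_gt0.
  have dr : d <= r / 4 by rewrite ge_min lexx.
  have dC : d * (8 * (Cv + 1)) <= r by rewrite -ler_pdivlMr// ge_min lexx orbT.
  clearbody d; exists d => // e b P s1 s2 /andP[s10 s12] s1t s2t.
  have s20 := le_trans s10 s12.
  apply/ler_addgt0Pl => w w0.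
  pose W := 2 * (\sum_(i < n) `|e ord0 i|) + `|b|.
  have S0 : 0 <= \sum_(i < n) `|e ord0 i| by apply: sumr_ge0.
  have W0 : 0 < W + 1 by rewrite ltr_wpDl// /W addr_ge0// mulr_ge0.
  pose w1 := Num.min (w / (W + 1)) d.
  have w10 : 0 < w1 by rewrite lt_min d0 divr_gt0.
  have w1W : w1 * (W + 1) <= w by rewrite -ler_pdivlMr// ge_min lexx.
  have w1d : w1 <= d by rewrite ge_min lexx orbT.
  clearbody w1.
  have [N mN [a1 a2 a3]] := near3 s1 s2 t w1 (Num.truncn w1^-1) s10 s20 t0 w10.
  have hw : h N <= w1.
    apply: ltW; apply: le_lt_trans (inv_succ_lt w10); rewrite lef_pV2 ?posrE ?ltr0n// ler_nat ltnS//.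
  have de v w' : `|v| < w' -> dotv e v <= w' * \sum_(i < n) `|e ord0 i|.
    move=> vw; rewrite mulr_sumr; apply: ler_sum => i _; apply: le_trans (ler_norm _) _.
    by rewrite normrM mulrC ler_wpM2r//; apply: le_trans (norm_coord _ _) (ltW vw).
  have /andP[k11 k12] := kl N _ s10; have /andP[k21 k22] := kl N _ s20.
  have loc : dotv e (f N s2 - f N s1) <= ((k N s2 - k N s1)%N)%:R * h N * b.
    rewrite /f -(subnKC (kmono N _ _ s12)) addKn; apply: euler_local; first exact: ltW.
    move=> i; rewrite subnKC ?kmono// => /andP[i1 i2].
    have ih0 : 0 <= i%:R * h N by rewrite mulr_ge0// ltW.
    have ihs1 : (k N s1)%:R * h N <= i%:R * h N by rewrite ler_pM2r// ler_nat.
    have ihs2 : i%:R * h N + h N <= (k N s2)%:R * h N.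
      by rewrite -{2}(mul1r (h N)) -mulrDl natr1 ler_pM2r// ler_nat.
    have iht : `|i%:R * h N - t| <= 2 * d.
      move: s1t s2t; rewrite !ltr_norml ler_norml => /andP[c1 c2] /andP[c3 c4].
      move: k11 k12 k21 k22 ihs1 ihs2 hw; set X := _ * h N; set Y := _ * h N; set Z := _ * h N.
      by move: (h0 N) c1 c2 c3 c4 w1d; clear -GC; move=> *; apply/andP; split; lra.
    have ki : k N (i%:R * h N) = i by rewrite /k mulfK ?gt_eqF// natrK.
    apply: P => //; first by apply: le_trans iht _; move: dr d0; clear -GC; lra.
    have := flip N t (i%:R * h N) t0 ih0; rewrite {1}/f ki => fl.
    rewrite -(subrK (f N t) (euler _ _)) -addrA (le_trans (ler_normD _ _))//.
    have : Cv * (`|i%:R * h N - t| + h N) <= Cv * (3 * d).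
      by rewrite ler_wpM2l//; move: iht hw w1d; set X := `|_|; clear -GC; lra.
    by move: fl a3 w1d dC; set X := `|i%:R * h N - t|; move: dr d0; clear -GC; lra.
  have -> : g s2 - g s1 = (f N s2 - f N s1) + (f N s1 - g s1) + - (f N s2 - g s2).
    by apply/rowP => i; rewrite !mxE; ring.
  rewrite dotvDr dotvDr.
  have e1 := de _ _ a1; have e2 : dotv e (- (f N s2 - g s2)) <= w1 * \sum_(i < n) `|e ord0 i|.
    by apply: de; rewrite normrN.
  have e3 : (k N s2 - k N s1)%:R * h N * b <= (s2 - s1) * b + w1 * `|b|.
    rewrite natrB ?kmono// -lerBlDl -mulrBl; apply: le_trans (ler_norm _) _.
    rewrite normrM ler_wpM2r// mulrBl ler_norml; move: k11 k12 k21 k22 hw.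
    by set X := _ * h N; set Y := _ * h N; clear -GC; move=> *; apply/andP; split; lra.
  by move: loc e1 e2 e3 w1W w10; rewrite /W; clear -GC; set X := _ * h N * b; lra.
Qed.

End Euler.

Lemma derivable_dist {R : realType} {V W : normedModType R} (f : V -> W) (a v : V) (e : R) :
  derivable f a v -> 0 < e -> exists2 d, 0 < d & forall h : R, h != 0 -> `|h| < d ->
    `|h^-1 *: (f (h *: v + a) - f a) - 'D_v f a| < e.
Proof.
move=> df e0; 
have : \forall h \near 0^', `|'D_v f a - h^-1 *: ((f \o shift a) (h *: v) - f a)| < e.
  exact: (@cvgr_dist_lt _ _ _ _ _ _ _ df).
move=> /nbhs_ballP[d /= d0 dP]; exists d => // h hn hd; rewrite distrC; apply: dP => //.
by rewrite -ball_normE /= sub0r normrN.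
Qed.

(** * Construction of the generalized characteristic *)

Section Characteristic.
Context {R : realType} {n : nat}.
Variables (A : R * 'rV[R]_n -> 'M[R]_n) (V u : R * 'rV[R]_n -> R).
Variables (y0 : 'rV[R]_n) (s0 rho c C sigma : R).
Implicit Types (z : R * 'rV[R]_n) (p q x y d e : 'rV[R]_n) (t r dt : R).

Local Notation H := (hamiltonian A V).
Local Notation box := (box y0 s0 rho).
Local Notation supergrad := (supergrad A V u).

Hypothesis LS : local_solution A V u y0 s0 rho c.
Hypothesis SC : semiconcave_on u y0 s0 rho C sigma.

Definition speed : R := c * C.

(** [ch_incl] is the differential inclusion in terms of support functions: in each direction [e] the
    increment is bounded by the value at some supergradient, which may depend on [e]. The parameters
    [64 C] and [rho / 32] come from [C] and [rho / 8] by two passages to the limit, each costing a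
    factor 8 and half of the radius. *)
Record characteristic (sig : R) (gam : R -> 'rV[R]_n) : Prop := Characteristic {
  ch_sig : 0 < sig <= sigma;
  ch_speed : speed * sig <= rho / 16;
  ch_0 : gam 0 = y0;
  ch_lip : forall s t, 0 <= s -> 0 <= t -> `|gam t - gam s| <= speed * `|t - s|;
  ch_ne : forall t, 0 < t <= sig ->
    exists2 p, `|p| <= C & supergrad (64 * C) (rho / 32) (t, gam t) p;
  ch_incl : forall t eps, 0 < t <= sig -> 0 < eps -> exists2 eta, 0 < eta &
    forall s1 s2 e, 0 <= s1 <= s2 -> `|s1 - t| < eta -> `|s2 - t| < eta ->
    exists p, [/\ `|p| <= C, supergrad (64 * C) (rho / 32) (t, gam t) p &
      dotv e (gam s2 - gam s1) <= (s2 - s1) * (dotv e (mxact (A (t, gam t)) p) + eps * `|e|)] }.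

Lemma supergradW K K' r r' z : 0 < z.1 -> K <= K' -> r' <= r ->
  supergrad K r z `<=` supergrad K' r' z.
Proof.
move=> z0 KK rr p h t' x' tt xx; apply: le_trans (h t' x' tt (le_trans xx rr)) _.
by rewrite lerD2l ler_wpM2r ?addr_ge0 ?sqr_ge0// ler_wpM2r// invr_ge0 sqr_ge0.
Qed.

Lemma characteristic_exists : exists sig gam, characteristic sig gam.
Proof.
have [C1 /andP[sg0 sgs] _ _] := SC; have /andP[rho0 rho1] := ls_rho LS.
have c0 := ls_c0 LS; have c1 := ls_c LS.
have C0 : 0 < C by clear -LS SC C1; lra.
have S0 : 0 < speed by rewrite mulr_gt0.
pose good z := (0 < z.1 <= sigma / 2) && (`|z.2 - y0| <= rho / 8).
have sel_ex z : exists p, good z -> `|p| <= C /\ supergrad (8 * C) (rho / 16) z p.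
  case: z => t x; rewrite /good /=; have [/andP[h1 h2]|_] := boolP (_ && _); last by exists 0.
  by have [p h3 h4] := supergrad_nonempty LS SC h1 h2; exists p.
have [sel selP] := choice sel_ex.
have goodbox z : good z -> box z.
  move=> /andP[/andP[h1 h2] h3]; split; first by apply/andP; split; clear -LS SC h1 h2 sgs sg0; lra.
  by clear -LS SC h3 rho0; lra.
(* The default 0 makes the field bounded everywhere. It also applies at time 0, where the first
   Euler step stands still; the inclusion is claimed at positive times, around which the field is a
   true selection. *)
pose G z := if good z then mxact (A z) (sel z) else 0.
have GC z : `|G z| <= speed.
  rewrite /G; case: ifPn => [gz|_]; last by rewrite normr0 ltW.
  apply: le_trans (ls_bnd LS _ (goodbox _ gz)) _; rewrite ler_wpM2l ?(ltW c0)//.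
  by have [] := selP _ gz.
have [gam [gam0 glip gloc]] := euler_limit y0 GC.
pose sig := Num.min (sigma / 4) (rho / 16 / speed).
have sig0 : 0 < sig by rewrite lt_min !divr_gt0.
have sig4 : sig <= sigma / 4 by rewrite ge_min lexx.
have sigS : speed * sig <= rho / 16 by rewrite mulrC -ler_pdivlMr// ge_min lexx orbT.
clearbody sig.
have gy t : 0 <= t <= sig -> `|gam t - y0| <= rho / 16.
  move=> /andP[t0 ts]; rewrite -gam0; apply: le_trans (glip _ _ (lexx _) t0) _.
  by rewrite subr0 ger0_norm// (le_trans _ sigS)// ler_wpM2l// ltW.
have gn0 t : 0 < t <= sig -> exists2 p, `|p| <= C & supergrad (64 * C) (rho / 32) (t, gam t) p.
  move=> /andP[t0 ts].
  have h1 : 0 < t <= sigma / 2 by rewrite t0; clear -LS SC ts sig4 sg0; lra.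
  have h2 : `|gam t - y0| <= rho / 8.
    by have := gy t; rewrite ts ltW// => /(_ isT); clear -LS SC rho0; lra.
  have [p h3 h4] := supergrad_nonempty LS SC h1 h2; exists p => //.
  by apply: supergradW h4 => //; clear -LS SC C0 rho0; lra.
exists sig, gam; split => //.
  by rewrite sig0; clear -LS SC sig4 sg0 ; lra.
move=> t eps /andP[t0 ts] eps0.
have tn0 := ltW t0; have gt := gy t; rewrite ts tn0 in gt.
have zB : box (t, gam t).
  split => /=; first by apply/andP; split; clear -LS SC t0 ts sig4 sg0 sgs; lra.
  by have := gt isT; clear -LS SC rho0; lra.
have e10 : 0 < eps / (4 * c ^+ 2) by rewrite divr_gt0// mulr_gt0// exprn_gt0.
have K8 : 0 <= 8 * C by clear -LS SC C0; lra.
have r16 : 0 < rho / 16 <= 1 by apply/andP; split; clear -LS SC rho0 rho1; lra.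
have [de de0 usc] := supergrad_usc LS C K8 r16 t0 zB e10.
pose D := 8 * c * C.
have c20 : 0 < c ^+ 2 by rewrite exprn_gt0.
have D0 : 0 < D by rewrite mulr_gt0// mulr_gt0.
pose r := Num.min (Num.min (de / 2) (t / 2)) (Num.min (rho / 32) (eps / (c * D))).
have r0 : 0 < r by rewrite !lt_min !divr_gt0// mulr_gt0.
have rde : r <= de / 2 by rewrite !ge_min lexx.
have rt : r <= t / 2 by rewrite !ge_min lexx orbT.
have rrho : r <= rho / 32 by rewrite !ge_min lexx !orbT.
have rD : r * (c * D) <= eps by rewrite -ler_pdivlMr ?mulr_gt0// !ge_min lexx !orbT.
clearbody r.
have [eta eta0 loc] := gloc t r tn0 r0.
exists eta => // s1 s2 e s12 s1t s2t; have /andP[s10 s1s2] := s12.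
set Q := dotv e _; apply: contrapT => no.
have noP p : `|p| <= C -> supergrad (64 * C) (rho / 32) (t, gam t) p ->
    (s2 - s1) * (dotv e (mxact (A (t, gam t)) p) + eps * `|e|) < Q.
  by move=> h1 h2; rewrite ltNge; apply/negP => h; apply: no; exists p.
have [p0 p0C p0S] : exists2 p, `|p| <= C & supergrad (64 * C) (rho / 32) (t, gam t) p.
  by apply: gn0; rewrite t0.
have [s1E|s1n] := eqVneq s1 s2.
  by have := noP _ p0C p0S; rewrite /Q s1E !subrr dotv0r mul0r ltxx.
have s210 : 0 < s2 - s1 by rewrite subr_gt0 lt_neqAle s1n.
(* If no [p] works, then at [(t, gam t)] the values in direction [e] stay below the mean velocity by
   more than [eps |e|]. Upper semicontinuity keeps half of this margin for [G] nearby, and the local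
   bound of the Euler limit then forces [e = 0]. *)
pose b := Q / (s2 - s1) - eps / 2 * `|e|.
have Gb t' x' : 0 <= t' -> `|t' - t| <= r -> `|x' - gam t| <= r -> dotv e (G (t', x')) <= b.
  move=> t'0 tt xx.
  have gz : good (t', x').
    rewrite /good /=; move: (tt); rewrite ler_norml => /andP[h1 h2]; apply/andP; split.
      apply/andP; split; clear -LS SC h1 h2 rt t0 ts sig4 sg0; lra.
    rewrite -(subrK (gam t) x') -addrA (le_trans (ler_normD _ _))//.
    by have := gt isT; clear -LS SC xx rrho rho0; lra.
  have [p1C p1S] := selP _ gz.
  have z'B := goodbox _ gz.
  have t'de : `|t' - t| < de by clear -LS SC tt rde r0; lra.
  have x'de : `|x' - gam t| < de by clear -LS SC xx rde r0; lra.
  have [p [pC p1p pS]] := usc t' x' _ t'de x'de z'B p1C p1S.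
  have pS' : supergrad (64 * C) (rho / 32) (t, gam t) p.
    by apply: supergradW pS => //; clear -LS SC C0 rho0; lra.
  have := noP p pC pS'; rewrite /G gz mulrC -ltr_pdivlMr// => h1.
  have h2 : dotv e (mxact (A (t', x')) (sel (t', x'))) - dotv e (mxact (A (t, gam t)) p) <= eps / 2 * `|e|.
    rewrite -dotvNr -dotvDr; apply: le_trans (ls_dot_le LS _ _) _.
    have -> : eps / 2 * `|e| = c * `|e| * (eps / 2 / c) by field; rewrite gt_eqF.
    rewrite ler_wpM2l ?mulr_ge0 ?(ltW c0)//.
    set p1 := sel _.
    have -> : mxact (A (t', x')) p1 - mxact (A (t, gam t)) p =
      (mxact (A (t', x')) p1 - mxact (A (t, gam t)) p1) + mxact (A (t, gam t)) (p1 - p).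
      by rewrite mxactB addrA subrK.
    rewrite (le_trans (ler_normD _ _))//.
    have l1 := ls_lip LS p1 zB z'B; have l2 := ls_bnd LS (p1 - p) zB.
    have l3 : c * dist1 (t, gam t) (t', x') * `|p1| <= eps / (4 * c).
      have -> : eps / (4 * c) = c * (eps / (4 * c ^+ 2)) by field; rewrite gt_eqF.
      rewrite -mulrA ler_wpM2l ?(ltW c0)// ler_pdivlMr ?mulr_gt0//.
      apply: le_trans rD; have -> : r * (c * D) = 2 * r * C * (4 * c ^+ 2) by rewrite /D; ring.
      have c40 : 0 <= 4 * c ^+ 2 by rewrite mulr_ge0 ?sqr_ge0.
      have dr : dist1 (t, gam t) (t', x') <= 2 * r by rewrite /dist1 /=; clear -LS SC tt xx; lra.
      have d0 : 0 <= dist1 (t, gam t) (t', x') by rewrite addr_ge0.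
      by apply: ler_wpM2r => //; apply: ler_pM.
    have l4 : c * `|p1 - p| <= eps / (4 * c).
      have -> : eps / (4 * c) = c * (eps / (4 * c ^+ 2)) by field; rewrite gt_eqF.
      by rewrite ler_wpM2l ?(ltW c0)//; exact: ltW.
    have -> : eps / 2 / c = eps / (4 * c) + eps / (4 * c) by field; rewrite gt_eqF.
    by apply: lerD; [exact: le_trans l1 l3|exact: le_trans l2 l4].
  by rewrite /b; clear -LS SC h1 h2; lra.
have := loc e b Gb s1 s2 s12 s1t s2t; rewrite -/Q /b mulrBr mulrC divfK ?gt_eqF// => h.
have e0 : `|e| = 0.
  apply/eqP; rewrite eq_le normr_ge0 andbT -(ler_pM2l s210) mulr0 -(ler_pM2l eps0) mulr0.
  by clear -LS SC h; lra.
have := noP _ p0C p0S; move/eqP: e0; rewrite normr_eq0 /Q => /eqP ->.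
by rewrite !dotv0l normr0 mulr0 addr0 mulr0 ltxx.
Qed.

Section AlongCharacteristic.
Variables (sig : R) (gam : R -> 'rV[R]_n).
Hypothesis CH : characteristic sig gam.

Local Notation S t := (supergrad (64 * C) (rho / 32) (t, gam t)).

Lemma speed_gt0 : 0 < speed.
Proof. by rewrite mulr_gt0 ?(ls_c0 LS)//; have [C1 _ _ _] := SC; apply: lt_le_trans C1. Qed.

Lemma ch_ball t : 0 <= t <= sig -> `|gam t - y0| <= rho / 16.
Proof.
move=> /andP[t0 ts]; rewrite -(ch_0 CH); apply: le_trans (ch_lip CH (lexx _) t0) _.
rewrite subr0 ger0_norm// (le_trans _ (ch_speed CH))// ler_wpM2l//; exact: ltW speed_gt0.
Qed.

Lemma ch_box t : 0 <= t <= sig -> box (t, gam t).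
Proof.
move=> ts; have := ch_ball ts; have [_ /andP[sg0 sgs] _ _] := SC.
have /andP[sig0 sigs] := ch_sig CH; have /andP[rho0 rho1] := ls_rho LS.
move: ts => /andP[t0 ts] tr; split => /=; last by clear -LS SC CH tr rho0; lra.
by apply/andP; split; clear -LS SC CH t0 ts sigs sgs; lra.
Qed.

Lemma supergrad_slice K r t x p y : 0 < t -> supergrad K r (t, x) p -> `|y - x| <= r ->
  u (t, y) <= u (t, x) + dotv p (y - x) + K / t ^+ 2 * `|y - x| ^+ 2.
Proof.
move=> t0 pS yr; have := pS t y; rewrite /= subrr normr0 divr_gt0// => /(_ isT yr).
by rewrite mulr0 subr0 expr0n add0r.
Qed.

Lemma ch_velocity t y : 0 < t < sig -> derivable gam t 1 -> `|y - gam t| <= rho / 32 ->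
  u (t, y) <= u (t, gam t) + dotv (ainv A (t, gam t) (derive1 gam t)) (y - gam t)
    + 64 * C / t ^+ 2 * `|y - gam t| ^+ 2.
Proof.
move=> /andP[t0 ts] dg yr; have zB : box (t, gam t) by apply: ch_box; rewrite !ltW.
have c0 := ls_c0 LS; set x := gam t; set z := (t, x); set v := derive1 gam t.
pose d := y - x; pose e := - ainv A z d.
have eA q : dotv e (mxact (A z) q) = - dotv q d.
  by rewrite /e dotvNl dotvC dotv_mxactC ?(ls_sym LS zB)// (ainvK LS _ zB).
apply/ler_addgt0Pl => w w0.
pose B := 1 + (1 + c) * `|e|.
have B0 : 0 < B by rewrite ltr_pwDl// mulr_ge0// addr_ge0// ltW.
have eps0 : 0 < w / B by rewrite divr_gt0.
have [d1 d10 D] := derivable_dist dg eps0.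
have t0s : 0 < t <= sig by rewrite t0 ltW.
have [eta eta0 INC] := ch_incl CH t0s eps0.
pose h := Num.min d1 eta / 2.
have m0 : 0 < Num.min d1 eta by rewrite lt_min d10.
have h0 : 0 < h by rewrite divr_gt0.
have hm : h < Num.min d1 eta by rewrite gtr_pMr// invf_lt1// ltr1n.
have hn : h != 0 by rewrite gt_eqF.
move: hm; rewrite lt_min => /andP[hd1 heta].
have := D h hn; rewrite ger0_norm ?(ltW h0)// => /(_ hd1).
rewrite -derive1E -/v [h%:A]mulr1 (addrC h) => Dh.
have [p [pC pS]] := INC t (t + h) e ltac:(by rewrite (ltW t0) lerDl ltW)
  ltac:(by rewrite subrr normr0) ltac:(by rewrite addrAC subrr add0r ger0_norm ?(ltW h0)).
rewrite (addrC t h) addrK -/z mulrC -ler_pdivrMr// mulrC -dotvZr eA (addrC h t).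
set g := h^-1 *: _ => gp; have := supergrad_slice t0 pS yr; rewrite -/x -/d.
have gv : dotv e v <= dotv e g + c * `|e| * (w / B).
  rewrite -lerBlDl -dotvNr -dotvDr; apply: le_trans (ls_dot_le LS _ _) _.
  rewrite ler_wpM2l//; first by rewrite mulr_ge0// ltW.
  by rewrite distrC; exact: ltW.
have : dotv e v = - dotv (ainv A z v) d by rewrite -eA (ainvK LS _ zB).
have : w / B * (1 + (1 + c) * `|e|) = w by rewrite -/B divfK// gt_eqF.
move: gv gp; rewrite -/x -/z; move: eps0; clear -LS SC CH.
generalize (w / B) (dotv e g) (dotv e v) `|e| (dotv (ainv A z v) d) (dotv p d) (u z) (u (t, y)).
by move=> Y X a b a' b' u1 u2; lra.
Qed.

(** In the direction [(0, p - p')], the upper bound with slope [p'] limits the forward difference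
    quotient from above and the one with slope [p] limits the backward quotient from below. They
    share the limit [L], so [<p, d> <= L <= <p', d>] for [d = p - p']. *)
Lemma supergrad_unique K r t x p p' : 0 < t -> 0 < r ->
  derivable (u : R * 'rV[R]_n -> R^o) (t, x) (0, p - p') ->
  supergrad K r (t, x) p -> supergrad K r (t, x) p' -> p = p'.
Proof.
move=> t0 r0; set d := p - p' => du pS p'S.
set L := 'D_(0, d) (u : _ -> R^o) (t, x).
suff dL : dotv p d - dotv p' d <= 0.
  have : `|d| ^+ 2 <= 0 by apply: le_trans (sqr_norm_le_dotv _) _; rewrite dotvDl dotvNl.
  rewrite le_eqVlt ltNge sqr_ge0 orbF sqrf_eq0 normr_eq0 /d subr_eq0 => /eqP //.
apply/ler_addgt0Pl => w w0; rewrite addr0.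
have w40 : 0 < w / 4 by rewrite divr_gt0.
have [d1 d10 D] := derivable_dist du w40.
pose K1 := `|K / t ^+ 2| * `|d| ^+ 2.
have K10 : 0 <= K1 by rewrite mulr_ge0 ?sqr_ge0.
have K11 : 0 < 4 * (K1 + 1) by rewrite mulr_gt0// ltr_wpDl.
have d20 : 0 < 2 * (`|d| + 1) by rewrite mulr_gt0// ltr_wpDl.
pose h := Num.min (Num.min (d1 / 2) (r / (2 * (`|d| + 1)))) (w / (4 * (K1 + 1))).
have h0 : 0 < h by rewrite !lt_min !divr_gt0.
have hd1 : h <= d1 / 2 by rewrite !ge_min lexx.
have hr : h * (2 * (`|d| + 1)) <= r by rewrite -ler_pdivlMr// !ge_min lexx orbT.
have hK : h * (4 * (K1 + 1)) <= w by rewrite -ler_pdivlMr// !ge_min lexx orbT.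
clearbody h.
have slice q k : `|k| = h -> supergrad K r (t, x) q ->
    u (t, x + k *: d) <= u (t, x) + k * dotv q d + h ^+ 2 * K1.
  move=> kh qS; have xx : x + k *: d - x = k *: d by rewrite addrAC subrr add0r.
  have hd0 : 0 <= h * `|d| by rewrite mulr_ge0// ltW.
  have := supergrad_slice t0 qS (y := x + k *: d); rewrite xx normrZ kh dotvZr => sl.
  apply: le_trans (sl _) _; first by clear -LS SC CH hr h0 hd0; lra.
  rewrite lerD2l exprMn mulrCA ler_wpM2l ?sqr_ge0// /K1 ler_wpM2r ?sqr_ge0//; exact: ler_norm.
have hn : h != 0 by rewrite gt_eqF.
have hlt : h < d1 by clear -LS SC CH hd1 d10; lra.
have h1 := D h hn ltac:(by rewrite ger0_norm// ltW).
have h2 := D (- h) ltac:(by rewrite oppr_eq0) ltac:(by rewrite normrN ger0_norm// ltW).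
have zE k : k *: ((0, d) : R * 'rV[R]_n) + (t, x) = (t, x + k *: d).
  by congr (_, _); rewrite /= ?scaler0 ?add0r// addrC.
rewrite -/L !zE in h1 h2.
have s1 := slice p' h (gtr0_norm h0) p'S.
have s2 := slice p (- h) ltac:(by rewrite normrN gtr0_norm) pS.
move: h1 h2 s1 s2; rewrite !ltr_norml => /andP[h1 _] /andP[_ h2].
rewrite -(ltrD2r L) subrK -(ltr_pM2l h0) in h1.
rewrite ltrBlDr -(ltr_pM2l h0) in h2.
move: h1 h2; rewrite invrN scaleNr mulrN [h^-1 *: _]/(h^-1 * _) [h^-1 *: _]/(h^-1 * _) !mulVKf//.
move=> h1 h2 s1 s2; rewrite -(ler_pM2l h0).
have := ler_wpM2l (ltW h0) hK; move: h1 h2 s1 s2 h0; clear -LS SC CH.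
generalize (u (t, x + h *: d)) (u (t, x + - h *: d)) (u (t, x)) (dotv p d) (dotv p' d) L K1.
by move=> u1 u2 u3 a b L' K2; rewrite !expr2 => h1 h2 s1 s2 h0; nra.
Qed.

End AlongCharacteristic.

End Characteristic.

(** * The Lagrangian near a characteristic, in the metric of its final point *)

Lemma lagrangian_near_error {R : realType} (c W M Pi L1 r h k w de D d0 b e : R) :
  1 <= c -> 0 <= W -> 0 <= M -> 0 <= Pi -> L1 = 1 + W + M ->
  0 <= r <= 1 -> 0 <= h <= 1 -> 0 <= k <= M -> 0 <= w <= r * k ->
  0 <= de <= c * Pi * (w + 2 * L1 * h) -> 0 <= d0 <= L1 * (r + 2 * h) ->
  0 <= e -> 0 <= b -> b <= c ^+ 3 * k ^+ 2 ->
  e <= b + 2 * c ^+ 3 * k * de + c ^+ 3 * de ^+ 2 ->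
  0 <= D -> 2 * c ^+ 4 * Pi + 2 * c ^+ 5 * Pi ^+ 2 +
    4 * c ^+ 4 * Pi * L1 * M + 8 * c ^+ 5 * Pi ^+ 2 * L1 ^+ 2 <= D ->
  2^-1 * (1 + 2 * (c ^+ 3 * d0)) * e <=
    2^-1 * b + (D + c ^+ 3 * L1 * (c ^+ 3 + 2 * c ^+ 3 * M ^+ 2 + 3 * D)) * (r * k ^+ 2 + h).
Proof.
move=> c1 W0 M0 Pi0 L1E /andP[r0 r1] /andP[h0 h1] /andP[k0 kM] /andP[w0 wr] /andP[de0 deU]
  /andP[d00 d0U] e0 b0 bk eU D0 DU.
have c0 : 0 <= c by lra.
have L10 : 1 <= L1 by rewrite L1E; lra.
have cP0 : 0 <= c * Pi by rewrite mulr_ge0.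
have de1 : de <= c * Pi * (r * k + 2 * L1 * h).
  by apply: le_trans deU _; rewrite ler_wpM2l// lerD2r.
have k1 : k * de <= c * Pi * (r * k ^+ 2 + 2 * L1 * M * h).
  apply: (@le_trans _ _ (k * (c * Pi * (r * k + 2 * L1 * h)))); first by rewrite ler_wpM2l.
  have -> : k * (c * Pi * (r * k + 2 * L1 * h)) = c * Pi * (r * k ^+ 2 + 2 * L1 * k * h) by ring.
  by rewrite ler_wpM2l// lerD2l ler_wpM2r// ler_wpM2l// mulr_ge0//; lra.
have rk0 : 0 <= r * k by rewrite mulr_ge0.
have k20 : 0 <= r * k ^+ 2 by rewrite mulr_ge0// sqr_ge0.
have L1h : 0 <= L1 * h by rewrite mulr_ge0//; lra.
have de2 : de ^+ 2 <= c ^+ 2 * Pi ^+ 2 * (2 * (r * k ^+ 2) + 8 * L1 ^+ 2 * h).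
  apply: le_trans (sqr_le_mono de0 de1) _; rewrite [X in X <= _]exprMn [X in X * _]exprMn.
  apply: ler_wpM2l; first by rewrite mulr_ge0 ?sqr_ge0.
  apply: le_trans (sqrD_le _ _) _.
  have a1 : (r * k) ^+ 2 <= r * k ^+ 2 by rewrite exprMn ler_wpM2r ?sqr_ge0// expr2 ler_piMr.
  have a2 : (2 * L1 * h) ^+ 2 <= 4 * L1 ^+ 2 * h.
    have -> : (2 * L1 * h) ^+ 2 = 4 * L1 ^+ 2 * (h * h) by ring.
    by apply: ler_wpM2l; [rewrite mulr_ge0 ?sqr_ge0|rewrite ler_piMr].
  by clear -a1 a2; lra.
set X := r * k ^+ 2 + h.
have X0 : 0 <= X by rewrite addr_ge0.
have eD : e <= b + D * X.
  apply: le_trans eU _; rewrite -addrA lerD2l.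
  have b1 := ler_wpM2l (exprn_ge0 3 c0) k1.
  have b2 := ler_wpM2l (exprn_ge0 3 c0) de2.
  apply: (@le_trans _ _ ((2 * c ^+ 4 * Pi + 2 * c ^+ 5 * Pi ^+ 2 +
    4 * c ^+ 4 * Pi * L1 * M + 8 * c ^+ 5 * Pi ^+ 2 * L1 ^+ 2) * X)); last by rewrite ler_wpM2r.
  have p1 : 0 <= c ^+ 4 * Pi * h by rewrite mulr_ge0// mulr_ge0// exprn_ge0.
  have p2 : 0 <= c ^+ 5 * Pi ^+ 2 * h by rewrite mulr_ge0// mulr_ge0 ?sqr_ge0// exprn_ge0.
  have p3 : 0 <= c ^+ 4 * Pi * L1 * M * (r * k ^+ 2).
    by rewrite mulr_ge0// mulr_ge0// mulr_ge0 ?mulr_ge0 ?exprn_ge0//; lra.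
  have p4 : 0 <= c ^+ 5 * Pi ^+ 2 * L1 ^+ 2 * (r * k ^+ 2).
    by rewrite mulr_ge0// mulr_ge0 ?sqr_ge0// mulr_ge0 ?sqr_ge0// exprn_ge0.
  by rewrite /X; clear -b1 b2 p1 p2 p3 p4; lra.
have hk : h * k ^+ 2 <= M ^+ 2 * h by rewrite mulrC ler_wpM2r// sqr_le_mono.
have DX0 : 0 <= D * X by rewrite mulr_ge0.
have c30 : 0 <= c ^+ 3 by rewrite exprn_ge0.
have f1 : d0 * e <= L1 * ((c ^+ 3 + 2 * c ^+ 3 * M ^+ 2 + 3 * D) * X).
  apply: (@le_trans _ _ (L1 * (r + 2 * h) * (b + D * X))); first by rewrite ler_pM.
  rewrite -mulrA ler_wpM2l//; first by lra.
  have g1 : (r + 2 * h) * b <= c ^+ 3 * (r * k ^+ 2 + 2 * (M ^+ 2 * h)).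
    apply: (@le_trans _ _ ((r + 2 * h) * (c ^+ 3 * k ^+ 2))); first by rewrite ler_wpM2l//; lra.
    have -> : (r + 2 * h) * (c ^+ 3 * k ^+ 2) = c ^+ 3 * (r * k ^+ 2 + 2 * (h * k ^+ 2)) by ring.
    by rewrite ler_wpM2l//; lra.
  have g2 : (r + 2 * h) * (D * X) <= 3 * (D * X) by rewrite ler_wpM2r//; lra.
  have g3 : 0 <= c ^+ 3 * h by rewrite mulr_ge0.
  have g4 : 0 <= c ^+ 3 * M ^+ 2 * (r * k ^+ 2) by rewrite mulr_ge0// mulr_ge0// sqr_ge0.
  by rewrite /X in g2 *; clear -g1 g2 g3 g4; lra.
have := ler_wpM2l c30 f1; clear -eD DX0; lra.
Qed.

Section Propagation.
Context {R : realType} {n : nat}.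
Variables (A : R * 'rV[R]_n -> 'M[R]_n) (V u : R * 'rV[R]_n -> R).
Variables (y0 : 'rV[R]_n) (s0 rho c C sigma : R).
Implicit Types (z : R * 'rV[R]_n) (p q x y d e k w v : 'rV[R]_n) (s t r h a M : R).

Local Notation H := (hamiltonian A V).
Local Notation box := (box y0 s0 rho).
Local Notation supergrad := (supergrad A V u).

Hypothesis LS : local_solution A V u y0 s0 rho c.
Hypothesis SC : semiconcave_on u y0 s0 rho C sigma.

(** The metric is frozen at [z0], from which [z] and [z'] are only [O(r + h)] away. The freezing
    error is therefore [r |k|^2 + h] and not [|k|^2], small enough for a bounded constant in the
    paraboloid to absorb. The vector [h1] is fixed before the displacement [w], so that its term can
    be moved into the slope of the paraboloid. *)
Lemma lagrangian_near (W M : R) : 0 <= W -> 0 <= M -> exists2 D, 0 <= D &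
  forall z v, box z -> `|v| <= W -> exists h1 : 'rV[R]_n, forall z0 z' k w q r h,
    box z0 -> box z' -> `|k| <= M -> 0 <= r <= 1 -> 0 <= h <= 1 -> `|w| <= r * `|k| ->
    `|z'.1 - z.1| <= h -> `|z'.2 - z.2 - w| <= (1 + W + M) * h -> dist1 z0 z <= (1 + W) * r ->
    D * (r + h) <= 1 ->
    dotv q (v + k) - H z' q <= lagr A V z (ainv A z v) + dotv (ainv A z v) k - dotv h1 w
      + 2^-1 * bform A z0 k k + D * (r * `|k| ^+ 2 + h).
Proof.
move=> W0 M0; have c0 := ls_c0 LS; have c1 := ls_c LS.
pose Pi := c ^+ 2 * W; have Pi0 : 0 <= Pi by rewrite mulr_ge0// sqr_ge0.
pose L1 := 1 + W + M; have L10 : 1 <= L1 by rewrite /L1; clear -LS SC W0 M0; lra.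
pose P2 := 1 + Pi ^+ 2; have P20 : 1 <= P2 by rewrite lerDl sqr_ge0.
pose D1 := 2 * c ^+ 4 * Pi + 2 * c ^+ 5 * Pi ^+ 2 +
    4 * c ^+ 4 * Pi * L1 * M + 8 * c ^+ 5 * Pi ^+ 2 * L1 ^+ 2.
have L1p : 0 <= L1 by apply: le_trans L10.
have D10 : 0 <= D1.
  by rewrite !addr_ge0// ?mulr_ge0 ?exprn_ge0// ?(ltW c0).
pose D2 := D1 + c ^+ 3 * L1 * (c ^+ 3 + 2 * c ^+ 3 * M ^+ 2 + 3 * D1).
have c30 : 0 <= c ^+ 3 by rewrite exprn_ge0// ltW.
have c3M : 0 <= 2 * c ^+ 3 * M ^+ 2 by rewrite mulr_ge0 ?sqr_ge0// mulr_ge0.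
have D20 : 0 <= D2.
  rewrite /D2 addr_ge0//; apply: mulr_ge0; first by rewrite mulr_ge0.
  by clear -LS SC c30 c3M D10; lra.
pose D3 := c * P2 * (1 + c * L1 + 8 * L1 ^+ 2 + 2).
have cP2 : 0 <= c * P2 by rewrite mulr_ge0 ?(ltW c0)// (le_trans ler01).
have D30 : 0 <= D3 by rewrite /D3 mulr_ge0// !addr_ge0// mulr_ge0 ?sqr_ge0// ltW.
pose D4 := 4 * c ^+ 3 * L1.
have D40 : 0 <= D4 by rewrite /D4; apply: mulr_ge0 => //; apply: mulr_ge0.
exists (D2 + D3 + D4); first exact: addr_ge0 (addr_ge0 D20 D30) D40.
move=> z v zB vW; set p := ainv A z v.
have pPi : `|p| <= Pi.
  by apply: le_trans (ainv_bnd LS _ zB) _; rewrite ler_wpM2l ?sqr_ge0.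
have pP2 : 1 + `|p| ^+ 2 <= P2 by rewrite lerD2l sqr_le_mono.
have [h0 [h1 [h0b h1b hz]]] := ls_C11 LS p zB.
exists h1 => z0 z' k w q r h z0B z'B kM r01 h01 wk t'h x'h zz0 Drh.
have /andP[r0 r1] := r01; have /andP[hh0 hh1] := h01.
have Ap : mxact (A z) p = v by rewrite /p (ainvK LS _ zB).
have x'w : `|z'.2 - z.2| <= `|w| + L1 * h.
  by rewrite -(subrK w (z'.2 - z.2)) (le_trans (ler_normD _ _))// addrC lerD2l.
have dz : dist1 z z' <= `|w| + 2 * L1 * h.
  rewrite /dist1; have : h <= L1 * h by rewrite ler_peMl.
  by clear -LS SC t'h x'w; lra.
have dz0 : dist1 z0 z' <= L1 * (r + 2 * h).
  have : dist1 z0 z' <= dist1 z0 z + dist1 z z'.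
    rewrite /dist1; have := ler_normD (z'.1 - z.1) (z.1 - z0.1); have := ler_normD (z'.2 - z.2) (z.2 - z0.2).
    by rewrite !addrA !subrK; clear -LS SC; lra.
  have : `|w| <= M * r by apply: le_trans wk _; rewrite mulrC ler_wpM2r.
  by rewrite /L1 in dz *; clear -LS SC dz zz0; lra.
have d0z : 0 <= dist1 z0 z' by rewrite addr_ge0.
have dzz : 0 <= dist1 z z' by rewrite addr_ge0.
have d12 : c ^+ 3 * dist1 z0 z' <= 2^-1.
  have : c ^+ 3 * dist1 z0 z' <= c ^+ 3 * (L1 * (r + 2 * h)) by rewrite ler_wpM2l.
  have : D4 * (r + h) <= 1.
    apply: le_trans Drh; apply: ler_wpM2r; first exact: addr_ge0.
    by rewrite lerDr; exact: addr_ge0.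
  have : 0 <= c ^+ 3 * L1 * r by rewrite mulr_ge0// mulr_ge0.
  by rewrite /D4; clear -LS SC; lra.
pose de := mxact (A z') p - mxact (A z) p.
have deb : `|de| <= c * Pi * (`|w| + 2 * L1 * h).
  apply: le_trans (ls_lip LS _ zB z'B) _.
  rewrite -mulrA [dist1 _ _ * _]mulrC mulrA; apply: ler_pM => //; first by rewrite mulr_ge0// ltW.
  by rewrite ler_wpM2l// ltW.
have := fenchel_sharp LS q zB z'B z0B d12 (erefl (k - de)).
rewrite Ap => F; apply: le_trans F _.
have Hb : - (H z' p - H z p) <= - dotv h1 w + D3 * (r * `|k| ^+ 2 + h).
  have := hz z' z'B; rewrite ler_norml => /andP[e1 _].
  have e2 : - (h0 * (z'.1 - z.1)) <= c * P2 * h.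
    apply: le_trans (ler_norm _) _; rewrite normrN normrM; apply: ler_pM => //.
    by apply: le_trans h0b _; rewrite ler_wpM2l// ltW.
  have e3 : - dotv h1 (z'.2 - z.2) <= - dotv h1 w + c * (c * P2) * (L1 * h).
    rewrite -lerBlDl opprK addrC -dotvNr -dotvDr.
    apply: le_trans (ls_dot_le LS _ _) _.
    have -> : `|w - (z'.2 - z.2)| = `|z'.2 - z.2 - w| by rewrite distrC.
    apply: ler_pM => //; first by rewrite mulr_ge0// ltW.
    apply: ler_wpM2l; first exact: ltW.
    by apply: le_trans h1b _; rewrite ler_wpM2l// ltW.
  have e4 : c * (1 + `|p| ^+ 2) * dist1 z z' ^+ 2 <= c * P2 * (2 * (r * `|k| ^+ 2) + 8 * L1 ^+ 2 * h).
    apply: ler_pM => //; rewrite ?sqr_ge0//.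
    - by rewrite mulr_ge0 ?(ltW c0)// addr_ge0 ?sqr_ge0.
    - by rewrite ler_wpM2l// ltW.
    apply: le_trans (sqr_le_mono dzz dz) _; apply: le_trans (sqrD_le _ _) _.
    have a1 : `|w| ^+ 2 <= r * `|k| ^+ 2.
      apply: le_trans (sqr_le_mono (normr_ge0 _) wk) _.
      by rewrite exprMn ler_wpM2r ?sqr_ge0// expr2 ler_piMr.
    have a2 : (2 * L1 * h) ^+ 2 <= 4 * L1 ^+ 2 * h.
      have -> : (2 * L1 * h) ^+ 2 = 4 * L1 ^+ 2 * (h * h) by ring.
      by apply: ler_wpM2l; [rewrite mulr_ge0 ?sqr_ge0|rewrite ler_piMr].
    by clear -LS SC a1 a2; lra.
  have : 0 <= c * P2 * (1 + c * L1 + 8 * L1 ^+ 2) * (r * `|k| ^+ 2).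
    rewrite mulr_ge0//; last by rewrite mulr_ge0// sqr_ge0.
    by rewrite mulr_ge0// !addr_ge0// mulr_ge0 ?sqr_ge0// ltW.
  have : 0 <= c * P2 * h by rewrite mulr_ge0.
  by rewrite /D3; clear -LS SC e1 e2 e3 e4; lra.
have eb : bform A z0 (k - de) (k - de) <= bform A z0 k k + 2 * c ^+ 3 * `|k| * `|de| + c ^+ 3 * `|de| ^+ 2.
  have -> d : bform A z0 (k - d) (k - d) = bform A z0 k k - 2 * bform A z0 k d + bform A z0 d d.
    by rewrite !bformE (bformC LS d k z0B); ring.
  have := bform_le LS de de z0B; rewrite -mulrA -expr2 => b1.
  have := bform_le LS (- k) de z0B; rewrite bformNl normrN => b2.
  by clear -LS SC b1 b2; lra.
have Eb : 2^-1 * (1 + 2 * (c ^+ 3 * dist1 z0 z')) * bform A z0 (k - de) (k - de) <=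
    2^-1 * bform A z0 k k + D2 * (r * `|k| ^+ 2 + h).
  apply: (@lagrangian_near_error R c W M Pi L1 r h `|k| `|w| `|de| D1 (dist1 z0 z')) => //.
  - by rewrite normr_ge0.
  - by rewrite normr_ge0.
  - by rewrite normr_ge0.
  - by rewrite d0z.
  - by apply: (bform_ge0 LS).
  - by apply: (bform_ge0 LS).
  - by have := bform_le LS k k z0B; rewrite -mulrA -expr2.
have D4X : 0 <= D4 * (r * `|k| ^+ 2 + h) by rewrite mulr_ge0// addr_ge0// mulr_ge0 ?sqr_ge0.
by clear -LS SC Hb Eb D4X; lra.
Qed.

End Propagation.

(** Hopf-Lax formula for the quadratic form [b]: inf-convolution adds the denominators [r] and [h],
    and [r / (r + h)] locates the optimal intermediate point. There the coefficient [K0] shrinks to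
    [K0 (r / (r + h))^2], and this gain pays for the error [D]. *)
Lemma paraboloid_convolution {R : realType} (r h b D c3 k2 K0 : R) : 0 <= r -> 0 < h -> 0 <= D -> 0 <= c3 ->
  D * c3 <= K0 -> 0 <= b -> k2 <= c3 * b ->
  ((2 * r)^-1 + K0) * ((r / (r + h)) ^+ 2 * b) +
    h * (2^-1 * ((r + h)^-2 * b) + D * (r * ((r + h)^-2 * k2)))
  <= ((2 * (r + h))^-1 + K0) * b.
Proof.
move=> r0 h0 D0 c30 DK b0 kb; have rh : 0 < r + h by rewrite ltr_wpDl.
set i := (r + h)^-1; have i0 : 0 < i by rewrite invr_gt0.
have irh : (r + h) * i = 1 by rewrite divff// gt_eqF.
have K00 : 0 <= K0 by apply: le_trans DK; rewrite mulr_ge0.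
have -> : (2 * (r + h))^-1 = 2^-1 * i by rewrite invfM.
have -> : (r + h)^-2 = i ^+ 2 by rewrite exprVn.
have rr : (2 * r)^-1 * ((r * i) ^+ 2 * b) = 2^-1 * r * i ^+ 2 * b.
  (* At the vertex the convention [0^-1 = 0] is harmless: the factor [r ^+ 2] vanishes too. *)
  have [->|rn] := eqVneq r 0; first by rewrite !(mulr0, mul0r) expr0n /= mul0r mulr0.
  by field.
have E : ((2 * r)^-1 + K0) * ((r * i) ^+ 2 * b) = 2^-1 * r * i ^+ 2 * b + K0 * r ^+ 2 * i ^+ 2 * b.
  by rewrite mulrDl rr; ring.
rewrite E.
have kK : D * k2 <= K0 * b.
  apply: (@le_trans _ _ (D * (c3 * b))); first by rewrite ler_wpM2l.
  by rewrite mulrA ler_wpM2r.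
have h1 : D * k2 * (h * r * i ^+ 2) <= K0 * b * (h * r * i ^+ 2).
  by rewrite ler_wpM2r// mulr_ge0 ?sqr_ge0// mulr_ge0// ltW.
have e1 : 2^-1 * r * i ^+ 2 * b + h * (2^-1 * (i ^+ 2 * b)) = 2^-1 * i * b.
  have -> : 2^-1 * r * i ^+ 2 * b + h * (2^-1 * (i ^+ 2 * b)) = 2^-1 * i * b * ((r + h) * i) by ring.
  by rewrite irh mulr1.
have e2 : K0 * b * ((r ^+ 2 + h * r) * i ^+ 2) <= K0 * b.
  rewrite ler_piMr ?mulr_ge0//.
  have -> : (r ^+ 2 + h * r) * i ^+ 2 = r * i * ((r + h) * i) by ring.
  rewrite irh mulr1 ler_pdivrMr// mul1r lerDl; exact: ltW.
by clear -h1 e1 e2; lra.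
Qed.

(** * One backward step of the lower paraboloid *)

Section LowerJet.
Context {R : realType} {n : nat}.
Variables (A : R * 'rV[R]_n -> 'M[R]_n) (V u : R * 'rV[R]_n -> R).
Variables (y0 : 'rV[R]_n) (s0 rho c C sigma : R).
Implicit Types (z : R * 'rV[R]_n) (p q x y d e k w v : 'rV[R]_n) (s t r h a M : R).

Local Notation H := (hamiltonian A V).
Local Notation box := (box y0 s0 rho).
Local Notation supergrad := (supergrad A V u).

Hypothesis LS : local_solution A V u y0 s0 rho c.
Hypothesis SC : semiconcave_on u y0 s0 rho C sigma.
Variables (sig : R) (gam : R -> 'rV[R]_n).
Hypothesis CH : characteristic A V u y0 rho c C sigma sig gam.

Local Notation S s := (supergrad (64 * C) (rho / 32) (s, gam s)).
Local Notation W := (speed c C).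

(* A lower bound for [u(s, .)] near [gam s] by a paraboloid whose opening is
   the fundamental solution [B/(2(t-s))], up to the constant [K0], and whose
   vertex lies [a] below the graph of [u]. *)
Definition lower_paraboloid t M K0 s a p := forall w, `|w| <= M * (t - s) ->
  u (s, gam s) - a + dotv p w - ((2 * (t - s))^-1 + K0) * bform A (t, gam t) w w
    <= u (s, gam s + w).

(** Test with the displacement of length [t - s] along [p]. It raises [u] by at least [(t - s) |p|]
    minus the depth [a <= t - s] and a curvature term of order [t - s], while the Lipschitz bound
    allows [C (t - s)]. *)
Lemma lower_paraboloid_momentum t M K0 s a p : 0 < s < t -> t <= sig -> 1 <= M ->
  a <= t - s -> 0 <= K0 -> K0 * (t - s) <= 1 -> t - s <= rho / 8 ->
  lower_paraboloid t M K0 s a p -> `|p| <= C + 1 + 2 * c ^+ 3.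
Proof.
move=> /andP[s0' st] ts M1 ar K00 Kr rr P; have [C1 _ lip _] := SC.
have c0 := ls_c0 LS; have /andP[sig0 sigs] := ch_sig CH; have /andP[rho0 _] := ls_rho LS.
have c30 : 0 <= c ^+ 3 by rewrite exprn_ge0// ltW.
have r0 : 0 < t - s by rewrite subr_gt0.
have t0 : 0 < t by apply: lt_trans st.
have tB : box (t, gam t) by apply: (ch_box LS SC CH); rewrite (ltW t0).
set r := t - s in ar Kr rr r0 *.
have [->|pn0] := eqVneq p 0; first by rewrite normr0; clear -LS SC CH C1 c30; lra.
have pn : 0 < `|p| by rewrite normr_gt0.
pose w := (r / `|p|) *: p.
have wr : `|w| = r by rewrite /w norm_scale_ge0 ?divr_ge0 ?(ltW r0)// divfK// gt_eqF.
have := P w; rewrite -/r wr ler_peMl ?(ltW r0)// => /(_ isT).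
have ss : 0 < s <= sigma by rewrite s0' /=; clear -LS SC CH st ts sigs; lra.
have gs : `|gam s - y0| <= rho / 4.
  have := ch_ball LS SC CH (t := s); rewrite (ltW s0') /= => /(_ (le_trans (ltW st) ts)).
  by clear -LS SC CH rho0; lra.
have := lip s (gam s) (gam s + w) ss gs; rewrite addrAC subrr add0r wr => /(_ rr).
have bw : bform A (t, gam t) w w <= c ^+ 3 * r ^+ 2.
  by have := bform_le LS w w tB; rewrite wr -mulrA -expr2.
have b1 : ((2 * r)^-1 + K0) * bform A (t, gam t) w w <= r * (2 * c ^+ 3).
  apply: (@le_trans _ _ (((2 * r)^-1 + K0) * (c ^+ 3 * r ^+ 2))).
    by rewrite ler_wpM2l// addr_ge0// invr_ge0 mulr_ge0// ltW.
  have -> : ((2 * r)^-1 + K0) * (c ^+ 3 * r ^+ 2) = r * (c ^+ 3 * (2^-1 + K0 * r)) by field; rewrite gt_eqF.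
  rewrite ler_wpM2l ?(ltW r0)// mulrC ler_wpM2r//; clear -LS SC CH Kr; lra.
have dw : r * `|p| <= dotv p w.
  rewrite /w dotvZr mulrAC ler_pdivlMr// -mulrA ler_wpM2l ?(ltW r0)// -expr2.
  exact: sqr_norm_le_dotv.
move=> u1 u2; rewrite -(ler_pM2l r0); have := le_trans u2 u1; move: b1 dw ar; clear -LS SC CH.
generalize (u (s, gam s)) (dotv p w) ((((2 * r)^-1 + K0) * bform A (t, gam t) w w)) `|p| (c ^+ 3).
by move=> u2 a1 a2 a3 a4; lra.
Qed.

(** Let [v] be the mean velocity of [gam] on [[s - h, s]] and [pi = A^-1 v]. The quadratic form
    added to the depth is the Fenchel gap [h (H(p') + L(v) - <p', v>)], which vanishes exactly when
    [gam] moves with the velocity [A p']. *)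
Definition step_constant M D := forall t s h K0 a p p',
  0 < h < s / 2 -> s <= t -> t <= sig -> M * t <= rho / 32 -> D * t <= 1 ->
  W * h <= rho / 32 -> D * c ^+ 3 <= K0 ->
  S s p' -> lower_paraboloid t M K0 s a p ->
  exists p1, lower_paraboloid t M K0 (s - h)
    (a + h / 2 * aform A (s, gam s)
           (p' - ainv A (s, gam s) (h^-1 *: (gam s - gam (s - h))))
           (p' - ainv A (s, gam s) (h^-1 *: (gam s - gam (s - h))))
       + (D + 64 * C * (1 + W ^+ 2) / s ^+ 2) * h ^+ 2) p1.

(** Read from later to earlier times, [segment_bound] is a lower bound: it relates [u] at
    [gam (s - h) + w1] to an intermediate point at time [s], where the old paraboloid applies. The
    supergradient [p'] compares the values of [u] along [gam] at the two times, and
    [paraboloid_convolution] adds up the quadratic terms. *)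
Lemma lower_paraboloid_step M : 1 <= M -> exists2 D, 0 <= D & step_constant M D.
Proof.
move=> M1; have M0 : 0 <= M by apply: le_trans M1.
have W0 := ltW (speed_gt0 LS SC).
have [D D0 LN] := lagrangian_near LS W0 M0.
exists D => // t s h K0 a p p' /andP[h0 hs] st tsig Mt Dt Wh DK pS P.
have c0 := ls_c0 LS; have [C1 /andP[sg0 sgs] _ _] := SC.
have /andP[sig0 sigs] := ch_sig CH; have /andP[rho0 rho1] := ls_rho LS.
have /andP[s00 s01] := ls_s0 LS.
have hn := ltW h0; have hn0 : h != 0 by rewrite gt_eqF.
have s0' : 0 < s by clear -LS SC CH h0 hs; lra.
have t1 : t <= 1 by clear -LS SC CH tsig sigs sgs s01; lra.
have t0 : 0 < t by clear -LS SC CH s0' st; lra.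
have sh0 : 0 < s - h by clear -LS SC CH hs h0; lra.
have c30 : 0 <= c ^+ 3 by rewrite exprn_ge0// ltW.
pose r := t - s; have r0 : 0 <= r by rewrite subr_ge0.
have tB : box (t, gam t) by apply: (ch_box LS SC CH); rewrite (ltW t0).
have sB : box (s, gam s) by apply: (ch_box LS SC CH); rewrite (ltW s0') (le_trans st).
set z := (s, gam s); set v := h^-1 *: (gam s - gam (s - h)); set pi := ainv A z v.
have hv : h *: v = gam s - gam (s - h) by rewrite /v scalerA divff// scale1r.
have vW : `|v| <= W.
  rewrite /v norm_scale_ge0 ?invr_ge0// mulrC ler_pdivrMr//.
  have := ch_lip CH (ltW sh0) (ltW s0'); have -> : s - (s - h) = h by ring.
  by rewrite ger0_norm.
have [h1 {}LN] := LN z v sB vW.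
(* The new slope is the mean of the old one and of [pi] with weights [r] and [h], corrected by the
   first-order dependence [h1] of the Hamiltonian on the position. *)
exists ((r / (r + h)) *: p + (h / (r + h)) *: pi + (h * (r / (r + h))) *: h1) => w1.
have -> : t - (s - h) = r + h by rewrite /r; ring.
have rh0 : 0 < r + h by rewrite ltr_wpDl.
have rht : r + h <= t by rewrite /r; clear -LS SC CH hs h0; lra.
set i := (r + h)^-1; have i0 : 0 < i by rewrite invr_gt0.
(* Relative to [gam], the velocity [k] takes the displacement [w1] at time [s - h] to [w] at time
   [s] and would reach 0 at time [t]: the optimal path is the straight line into the vertex. *)
move=> w1M; pose k := - (i *: w1); pose w := (r * i) *: w1.
have kE : `|k| = i * `|w1| by rewrite normrN norm_scale_ge0// ltW.
have wE : `|w| = r * `|k| by rewrite /w norm_scale_ge0 ?mulr_ge0 ?(ltW i0)// kE mulrA.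
have kM : `|k| <= M by rewrite kE mulrC ler_pdivrMr.
have w1r : `|w1| <= rho / 32 by rewrite (le_trans w1M)// (le_trans _ Mt)// ler_wpM2l.
have wM : `|w| <= M * r by rewrite wE mulrC ler_wpM2r.
have wr : `|w| <= rho / 32.
  by rewrite (le_trans wM)// (le_trans _ Mt)// ler_wpM2l// /r; clear -LS SC CH s0'; lra.
have gs : `|gam s - y0| <= rho / 16 by apply: (ch_ball LS SC CH); rewrite (ltW s0') (le_trans st).
have gsh : `|gam (s - h) - y0| <= rho / 16.
  by apply: (ch_ball LS SC CH); rewrite (ltW sh0); clear -LS SC CH st tsig h0; lra.
set x1 := gam (s - h) + w1; set x2 := gam s + w.
have x1r : `|x1 - y0| < rho.
  by rewrite /x1 addrAC (le_lt_trans (ler_normD _ _))//; clear -LS SC CH gsh w1r rho0; lra.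
have x2r : `|x2 - y0| < rho.
  by rewrite /x2 addrAC (le_lt_trans (ler_normD _ _))//; clear -LS SC CH gs wr rho0; lra.
have irh : (r + h) * i = 1 by rewrite divff// gt_eqF.
have x12 : x2 - x1 = (s - (s - h)) *: (v + k).
  have -> : s - (s - h) = h by ring.
  rewrite scalerDr hv /x2 /x1 /w /k scalerN scalerA.
  have -> : r * i = 1 - h * i by rewrite -irh; ring.
  by apply/rowP => j; rewrite !mxE; ring.
pose Lam := lagr A V z pi + dotv pi k - dotv h1 w + 2^-1 * bform A (t, gam t) k k
  + D * (r * `|k| ^+ 2 + h).
have seg : u (s, x2) <= u (s - h, x1) + (s - (s - h)) * Lam.
  apply: (segment_bound LS (r0 := h) _ _ _ x1r x2r h0 x12).
  - exact: ltW.
  - by clear -LS SC CH h0; lra.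
  - by clear -LS SC CH st tsig sigs sgs; lra.
  move=> t' x' q /andP[t'1 t'2] x'r x'x; apply: LN => //.
  - by split => //=; apply/andP; split; clear -LS SC CH t'1 t'2 sh0 st tsig sigs sgs; lra.
  - by rewrite r0; clear -LS SC CH rht t1 hn; lra.
  - by rewrite hn; clear -LS SC CH rht t1 r0; lra.
  - by rewrite wE.
  - by rewrite /= ler0_norm; clear -LS SC CH t'1 t'2; lra.
  - have -> : x' - gam s - w = (x' - (x1 + (t' - (s - h)) *: (v + k))) - (s - t') *: (v + k).
      have x2E : gam s + w = x1 + (s - (s - h)) *: (v + k) by rewrite -x12 [x1 + _]addrC subrK.
      have -> : x' - gam s - w = x' - (gam s + w) by rewrite opprD addrA.
      rewrite x2E; generalize (v + k) x1 => vk y1; apply/rowP => j; rewrite !mxE; ring.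
    have s't : 0 <= s - t' by rewrite subr_ge0.
    rewrite (le_trans (ler_normB _ _))// norm_scale_ge0//.
    have : (s - t') * `|v + k| <= h * (W + M).
      apply: ler_pM => //; first by clear -LS SC CH t'1; lra.
      by rewrite (le_trans (ler_normD _ _))// lerD.
    by clear -LS SC CH x'x; lra.
  - rewrite /dist1 /=; have := ch_lip CH (ltW t0) (ltW s0').
    have -> : `|s - t| = r by rewrite distrC ger0_norm.
    by clear -LS SC CH; lra.
  - by apply: le_trans Dt; rewrite ler_wpM2l.
have sub : u (s - h, gam (s - h)) <= u z + H z p' * h - dotv p' (h *: v)
    + 64 * C / s ^+ 2 * (h ^+ 2 * (1 + W ^+ 2)).
  have e1 : (s - h) - s = - h by ring.
  have e2 : gam (s - h) - gam s = - (h *: v) by rewrite hv opprB.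
  have hvW : `|h *: v| <= W * h by rewrite norm_scale_ge0// mulrC ler_wpM2r.
  have := pS (s - h) (gam (s - h)); rewrite /= e1 e2 !normrN ger0_norm// => sp.
  apply: le_trans (sp hs (le_trans hvW Wh)) _.
  rewrite dotvNr mulrN opprK sqrrN lerD2l ler_wpM2l//.
    by rewrite divr_ge0 ?sqr_ge0// mulr_ge0//; clear -LS SC CH C1; lra.
  rewrite mulrDr mulr1 lerD2l -exprMn (mulrC h).
  by apply: sqr_le_mono.
have conv := paraboloid_convolution r0 h0 D0 c30 DK (bform_ge0 LS w1 tB) (bform_ell LS w1 tB).
have := P w wM; rewrite -/z -/x2 -/r.
have bw : bform A (t, gam t) w w = (r * i) ^+ 2 * bform A (t, gam t) w1 w1.
  by rewrite /w !bformE; ring.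
have bk : bform A (t, gam t) k k = (r + h)^-2 * bform A (t, gam t) w1 w1.
  by rewrite /k !bformE -exprVn -/i; ring.
have k2 : `|k| ^+ 2 = (r + h)^-2 * `|w1| ^+ 2 by rewrite kE exprMn -exprVn.
have Ap : mxact (A z) pi = v by rewrite /pi (ainvK LS _ sB).
have ham : H z p' * h - dotv p' (h *: v) + h * lagr A V z pi
    = h / 2 * aform A z (p' - pi) (p' - pi).
  rewrite hamiltonianE /lagr !aformE (aformC LS pi p' sB) dotvZr -Ap.
  rewrite (dotvC p' (mxact _ _)) -/(aform A z pi p') (aformC LS pi p' sB).
  by field.
have lin : dotv ((r / (r + h)) *: p + (h / (r + h)) *: pi + (h * (r / (r + h))) *: h1) w1
    = dotv p w - h * dotv pi k + h * dotv h1 w.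
  by rewrite !dotvDl !dotvZl /w /k dotvNr !dotvZr -/i; ring.
rewrite lin bw => Pw.
have sE : s - (s - h) = h by ring.
rewrite sE in seg; rewrite -/i -k2 -bk in conv.
move: seg sub conv Pw ham; rewrite -/x1 -/z /Lam; clear -LS SC CH.
set b1 := bform A _ w1 w1; set bk' := bform A _ k k; set a' := aform _ _ _ _.
set l := lagr _ _ _ _; set K1 := 64 * C / s ^+ 2.
have -> : 64 * C * (1 + W ^+ 2) / s ^+ 2 = K1 * (1 + W ^+ 2) by rewrite /K1; ring.
rewrite -[X in _ -> _ -> _ -> _ -> _ -> _ <= X]/(u (s - h, x1)).
rewrite -[X in _ -> _ -> _ -> _ -> _ -> X - _ + _ - _ <= _]/(u (s - h, gam (s - h))).
generalize (u (s, x2)) (u (s - h, x1)) (u z) (u (s - h, gam (s - h))) (H z p') (dotv p' (h *: v))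
  (dotv p w) (dotv pi k) (dotv h1 w) (((2 * r)^-1 + K0) * ((r * i) ^+ 2 * b1)) (((2 * (r + h))^-1 + K0) * b1)
  `|k| bk' a' l.
by move=> u1 u2 u3 u4 H1 d1 d2 d3 d4 Q1 Q2 k' b2 a'' l'; lra.
Qed.

End LowerJet.

(** Let [m] be the supremum of the lengths of valid initial intervals. The limit clause gives [P m],
    and the step clause excludes [m < b]. *)
Lemma real_induction {R : realType} (b : R) (P : R -> Prop) : P 0 ->
  (forall r, 0 <= r < b -> P r -> exists2 d, 0 < d & forall h, 0 < h < d -> P (r + h)) ->
  (forall r, 0 < r <= b -> (forall r', 0 <= r' < r -> P r') -> P r) ->
  forall r, 0 <= r <= b -> P r.
Proof.
move=> P0 step lim r /andP[r0 rb]; have b0 := le_trans r0 rb.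
pose E := [set x | 0 <= x <= b /\ forall r', 0 <= r' <= x -> P r'].
have E0 : E 0.
  split; first by rewrite lexx.
  by move=> r' r'0; have <- : 0 = r' by apply/eqP; rewrite eq_le.
have En : E !=set0 by exists 0.
have Eb : has_sup E by split => //; exists b => x [/andP[]].
pose m := sup E; have m0 : 0 <= m by apply: (sup_upper_bound Eb).
have mb : m <= b by apply: ge_sup => // x [/andP[]].
have lt r' : 0 <= r' < m -> P r'.
  move=> /andP[r'0 r'm]; have [x [_ Px] xr] := sup_gt En r'm.
  by apply: Px; rewrite r'0 ltW.
have mP : P m.
  have [<-//|mn] := eqVneq 0 m; apply: lim => //.
  by rewrite lt_neqAle mn m0.
have mE r' : 0 <= r' <= m -> P r'.
  by move=> /andP[r'0]; rewrite le_eqVlt => /orP[/eqP->//|r'm]; apply: lt; rewrite r'0.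
have [bm|mb'] := lerP b m; first by apply: mE; rewrite r0 (le_trans rb).
have [d d0 dP] := step m ltac:(by rewrite m0) mP.
pose h := Num.min d (b - m) / 2.
have M0 : 0 < Num.min d (b - m) by rewrite lt_min d0 subr_gt0.
have h0 : 0 < h by rewrite divr_gt0.
have : h < Num.min d (b - m) by rewrite gtr_pMr// invf_lt1// ltr1n.
rewrite lt_min => /andP[hd hb].
have : m + h <= m.
  apply: (sup_upper_bound Eb); split; first by apply/andP; split; clear -m0 h0 hb; lra.
  move=> r' /andP[r'0 r'h]; have [r'm|mr'] := lerP r' m; first by apply: mE; rewrite r'0.
  have -> : r' = m + (r' - m) by ring.
  by apply: dP; apply/andP; split; clear -mr' r'h hd; lra.
by rewrite gerDl leNgt h0.
Qed.

(** * Gronwall argument: propagation of the paraboloid down to time 0 *)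

Section Propagation.
Context {R : realType} {n : nat}.
Variables (A : R * 'rV[R]_n -> 'M[R]_n) (V u : R * 'rV[R]_n -> R).
Variables (y0 : 'rV[R]_n) (s0 rho c C sigma : R).
Implicit Types (z : R * 'rV[R]_n) (p q x y d e k w v : 'rV[R]_n) (s t r h a M : R).

Local Notation H := (hamiltonian A V).
Local Notation box := (box y0 s0 rho).
Local Notation supergrad := (supergrad A V u).

Hypothesis LS : local_solution A V u y0 s0 rho c.
Hypothesis SC : semiconcave_on u y0 s0 rho C sigma.
Variables (sig : R) (gam : R -> 'rV[R]_n).
Hypothesis CH : characteristic A V u y0 rho c C sigma sig gam.

Local Notation S s := (supergrad (64 * C) (rho / 32) (s, gam s)).
Local Notation W := (speed c C).
Local Notation lower_paraboloid := (lower_paraboloid A u gam).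

Lemma lower_paraboloidW t M K0 s a a' p : a <= a' ->
  lower_paraboloid t M K0 s a p -> lower_paraboloid t M K0 s a' p.
Proof.
move=> aa P w wM; apply: le_trans (P w wM); rewrite lerD2r lerD2r lerD2l lerN2 //.
Qed.

Lemma lower_paraboloid_start t M K0 p : lower_paraboloid t M K0 t 0 p.
Proof.
move=> w; rewrite subrr mulr0 normr_le0 => /eqP ->.
by rewrite subr0 /bform !dotv0r !addr0 mulr0 subr0.
Qed.

(** Displacements are rescaled by [(t - s') / (t - s) = 1 + mu]. This takes the admissible
    displacements at [s] to those at [s'] and turns the singular term of opening [1 / (2 (t - s'))]
    into the one at [s], up to a factor [1 + mu] that tends to 1. *)
Lemma lower_paraboloid_limit t M K0 s a P : 0 < t <= sig -> 0 <= s < t -> 0 <= M ->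
  M * t <= rho / 32 -> 0 <= K0 -> 0 <= P ->
  (forall de, 0 < de -> exists s' a' p', [/\ 0 <= s' < t, `|s' - s| < de, a' <= a + de, `|p'| <= P &
    lower_paraboloid t M K0 s' a' p']) ->
  exists2 p, `|p| <= P & lower_paraboloid t M K0 s a p.
Proof.
move=> /andP[t0 tsig] /andP[s0' st] M0 Mt K00 P0 app.
have c0 := ls_c0 LS; have /andP[rho0 rho1] := ls_rho LS; have /andP[s00 s01] := ls_s0 LS.
have [C1 /andP[sg0 sgs] _ _] := SC; have /andP[sig0 sigs] := ch_sig CH.
have t1 : t <= 1 by clear -LS SC CH tsig sigs sgs s01; lra.
have seq i : exists s' p', [/\ 0 <= s' < t, `|s' - s| < i.+1%:R^-1, `|p'| <= P &
    lower_paraboloid t M K0 s' (a + i.+1%:R^-1) p'].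
  have [s' [a' [p' [h1 h2 h3 h4 h5]]]] := app i.+1%:R^-1 ltac:(by rewrite invr_gt0 ltr0n).
  by exists s', p'; split => //; exact: lower_paraboloidW h5.
have [f {}seq] := choice seq; have [g {}seq] := choice seq.
have gP i : `|g i| <= P by have [] := seq i.
have [p [pP cl]] := bounded_cluster_point gP.
exists p => // w wM.
have W0 : 0 <= W := ltW (speed_gt0 LS SC).
have r0 : 0 < t - s by rewrite subr_gt0.
have wr : `|w| <= rho / 32.
  by rewrite (le_trans wM)// (le_trans _ Mt)// ler_wpM2l//; clear -LS SC CH s0'; lra.
have tB : box (t, gam t) by apply: (ch_box LS SC CH); rewrite (ltW t0).
have gB s' w' : 0 <= s' < t -> `|w'| <= rho / 32 -> box (s', gam s' + w').
  move=> /andP[s'0 s't] w'r; split => /=.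
    by apply/andP; split; clear -LS SC CH s'0 s't tsig sigs sgs; lra.
  have := ch_ball LS SC CH (t := s'); rewrite s'0 (le_trans (ltW s't))// => /(_ isT).
  by rewrite addrAC => h; rewrite (le_trans (ler_normD _ _))//; clear -LS SC CH h w'r rho0; lra.
have sst : 0 <= s < t by rewrite s0'.
set b := bform A (t, gam t) w w; have b0 : 0 <= b by exact: (bform_ge0 LS _ tB).
apply/ler_addgt0Pl => e e0.
have e40 : 0 < e / 4 by rewrite divr_gt0.
have n0r : `|0 : 'rV[R]_n| <= rho / 32 by rewrite normr0 divr_ge0// ltW.
have [d1 d10 u1] := within_continuous_dist (ls_cont LS) (gB s w sst wr) e40.
have [d2 d20 u2] := within_continuous_dist (ls_cont LS) (gB s 0 sst n0r) e40.
pose E := (b / (2 * (t - s)) + 3 * K0 * b) / (t - s).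
have E0 : 0 <= E.
  have h1 : 0 <= b / (2 * (t - s)) by apply: divr_ge0 => //; rewrite mulr_ge0// ltW.
  have h2 : 0 <= 3 * K0 * b by rewrite mulr_ge0// mulr_ge0.
  exact: divr_ge0 (addr_ge0 h1 h2) (ltW r0).
pose B := E + c * M + c * P * M + 1.
have cM0 : 0 <= c * M by rewrite mulr_ge0// ltW.
have cPM : 0 <= c * P * M by rewrite mulr_ge0// mulr_ge0// ltW.
have B0 : 0 < B by rewrite /B; clear -LS SC CH E0 cM0 cPM; lra.
pose de := Num.min (Num.min (Num.min (d1 / (1 + W + M)) (d2 / (1 + W))) (t - s)) (e / 4 / B).
have W10 : 0 < 1 + W by clear -LS SC CH W0; lra.
have W20 : 0 < 1 + W + M by clear -LS SC CH W0 M0; lra.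
have de0 : 0 < de.
  by rewrite !lt_min r0 !andbT; apply/andP; split; [apply/andP; split|]; apply: divr_gt0.
have ded1 : de * (1 + W + M) <= d1 by rewrite -ler_pdivlMr// !ge_min lexx.
have ded2 : de * (1 + W) <= d2 by rewrite -ler_pdivlMr// !ge_min lexx orbT.
have der : de <= t - s by rewrite !ge_min lexx !orbT.
have deB : de * B <= e / 4 by rewrite -ler_pdivlMr// !ge_min lexx !orbT.
clearbody de.
have [i ik pi] := cl de (Num.truncn de^-1) de0.
have ide : i.+1%:R^-1 < de.
  by apply: le_lt_trans (inv_succ_lt de0); rewrite lef_pV2 ?posrE ?ltr0n// ler_nat ltnS.
have [s't fs _ L] := seq i.
set s' := f i in s't fs L; set p' := g i in L pi.
have {}fs : `|s' - s| < de by exact: lt_trans ide.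
have {}L : lower_paraboloid t M K0 s' (a + de) p' by apply: lower_paraboloidW L; rewrite lerD2l ltW.
pose mu := (s - s') / (t - s).
have muE : `|mu| * (t - s) = `|s' - s|.
  by rewrite /mu normrM normfV (gtr0_norm r0) divfK ?gt_eqF// distrC.
have mu1 : `|mu| <= 1 by rewrite -(ler_pM2r r0) mul1r muE (le_trans (ltW fs)).
have mur : (1 + mu) * (t - s) = t - s' by rewrite mulrDl divfK ?gt_eqF//; ring.
have mu0 : 0 <= 1 + mu by rewrite -(ler_pM2r r0) mul0r mur subr_ge0; have /andP[_ /ltW] := s't.
pose w' := (1 + mu) *: w.
have w'M : `|w'| <= M * (t - s') by rewrite /w' norm_scale_ge0// -mur mulrCA ler_wpM2l.
have w'w : `|w' - w| <= M * de.
  have -> : w' - w = mu *: w by rewrite /w' scalerDl scale1r addrAC subrr add0r.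
  rewrite normrZ; apply: (@le_trans _ _ (`|mu| * (M * (t - s)))); first by rewrite ler_wpM2l.
  by rewrite mulrCA muE ler_wpM2l// ltW.
have w'1 : `|w'| <= M.
  by rewrite (le_trans w'M)// ler_piMr//; have /andP[] := s't; clear -LS SC CH t1; lra.
have w'r : `|w'| <= rho / 32.
  rewrite (le_trans w'M)// (le_trans _ Mt)// ler_wpM2l//.
  by have /andP[] := s't; clear -LS SC CH; lra.
have s'0 : 0 <= s' by have /andP[] := s't.
have gg : `|gam s' - gam s| <= W * de.
  by apply: le_trans (ch_lip CH s0' s'0) _; rewrite ler_wpM2l// ltW.
have Wde : 0 <= W * de by rewrite mulr_ge0// ltW.
have Mde : 0 <= M * de by rewrite mulr_ge0// ltW.
have := u1 (s', gam s' + w') (gB _ _ s't w'r).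
rewrite /= => /(_ ltac:(clear -LS SC CH fs ded1 Wde Mde; lra)).
have -> : gam s' + w' - (gam s + w) = (gam s' - gam s) + (w' - w).
  by apply/rowP => j; rewrite !mxE; ring.
have dd1 : `|gam s' - gam s + (w' - w)| < d1.
  by rewrite (le_lt_trans (ler_normD _ _))//; clear -LS SC CH gg w'w ded1 de0; lra.
move=> /(_ dd1); rewrite ltr_norml => /andP[_ v1].
have := u2 (s', gam s' + 0) (gB _ _ s't n0r).
rewrite /= => /(_ ltac:(clear -LS SC CH fs ded2 Wde; lra)).
have dd2 : `|gam s' + 0 - (gam s + 0)| < d2.
  by rewrite !addr0; clear -LS SC CH gg ded2 de0; lra.
move=> /(_ dd2); rewrite ltr_norml !addr0 => /andP[v2 _].
have := L w' w'M.
have -> : bform A (t, gam t) w' w' = (1 + mu) ^+ 2 * b by rewrite /w' !bformE /b; ring.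
have q1 : ((2 * (t - s'))^-1 + K0) * ((1 + mu) ^+ 2 * b) <= ((2 * (t - s))^-1 + K0) * b + E * de.
  have e1 : (2 * (t - s'))^-1 * ((1 + mu) ^+ 2 * b) = (2 * (t - s))^-1 * ((1 + mu) * b).
    rewrite -mur; have /andP[_ ] := s't; rewrite -subr_gt0 -mur pmulr_lgt0// => m1.
    by field; rewrite !gt_eqF.
  have Emu : E * `|s' - s| <= E * de by rewrite ler_wpM2l// ltW.
  rewrite -muE in Emu.
  have e2 : E * (`|mu| * (t - s)) = (2 * (t - s))^-1 * b * `|mu| + 3 * K0 * b * `|mu|.
    by rewrite /E; field; rewrite gt_eqF.
  have m1 := ler_norm mu.
  have i0 : 0 <= (2 * (t - s))^-1 * b by rewrite mulr_ge0// invr_ge0 mulr_ge0// ltW.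
  have k0 : 0 <= K0 * b by rewrite mulr_ge0.
  have e3 : K0 * b * ((1 + mu) ^+ 2) <= K0 * b * (1 + 3 * `|mu|).
    rewrite ler_wpM2l//; have : mu ^+ 2 <= `|mu|.
      by rewrite -(real_normK (num_real mu)) expr2 ler_piMr.
    by clear -LS SC CH m1; lra.
  have e4 : (2 * (t - s))^-1 * b * mu <= (2 * (t - s))^-1 * b * `|mu| by rewrite ler_wpM2l.
  rewrite mulrDl e1; clear -LS SC CH e2 e3 e4 Emu; move: e2 e3 e4 Emu.
  by generalize (2 * (t - s))^-1 => ii; lra.
have q2 : dotv p w <= dotv p' w' + c * M * de + c * P * M * de.
  have -> : dotv p w = dotv p' w' + dotv (p - p') w' + dotv p (w - w').
    by rewrite !dotvDl !dotvDr dotvNl dotvNr; ring.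
  have : dotv (p - p') w' <= c * M * de.
    apply: le_trans (ls_dot_le LS _ _) _; rewrite distrC mulrAC.
    by apply: ler_pM => //; [rewrite mulr_ge0// ltW|rewrite ler_wpM2l// ltW|exact: ltW].
  have : dotv p (w - w') <= c * P * M * de.
    apply: le_trans (ls_dot_le LS _ _) _; rewrite distrC -[c * P * M * de]mulrA.
    by apply: ler_pM => //; [rewrite mulr_ge0// ltW|rewrite ler_wpM2l// ltW].
  by clear -LS SC CH; lra.
move: q1 q2 v1 v2 deB; rewrite /B; clear -LS SC CH e0.
rewrite -[X in _ -> _ -> X - _ < _ -> _]/(u (s', gam s' + w')).
rewrite -[X in _ -> _ -> _ - X < _ -> _]/(u (s, gam s + w)).
rewrite -[X in _ -> _ -> _ -> _ -> _ -> _ -> X - _ + _ - _ <= _]/(u (s, gam s)).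
rewrite -[X in _ -> _ -> _ -> _ -> _ -> _ -> _ <= _ + X]/(u (s, gam s + w)).
generalize (u (s', gam s')) (u (s', gam s' + w')) (u (s, gam s)) (u (s, gam s + w)).
generalize (((2 * (t - s'))^-1 + K0) * ((1 + mu) ^+ 2 * b)) (((2 * (t - s))^-1 + K0) * b).
by move=> ? ? ? ? ? ?; lra.
Qed.

(** The paraboloid below, with slope [p] and depth [a], and the one above, with slope [p'], are
    compared at the displacement [- A (p' - p) / Lc], where [Lc] adds up their curvatures; this
    bounds half the energy of [p' - p] by [a Lc]. The lower paraboloid contributes exactly
    [1 / (t - s)], and the remaining terms are bounded as long as [s >= de]. The condition on [M]
    makes the test displacement admissible. *)
Lemma lower_paraboloid_gap t M K0 s a p p' de P : 0 < de <= s -> s < t -> t <= sig ->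
  M * t <= rho / 32 -> 0 <= K0 -> `|p| <= P -> `|p'| <= C -> c * (C + P) <= M -> 0 <= a ->
  lower_paraboloid t M K0 s a p -> S s p' ->
  2^-1 * aform A (s, gam s) (p' - p) (p' - p) <=
    a * ((t - s)^-1 + (2 * K0 + 2 * c ^+ 3 * (64 * C / de ^+ 2) + c ^+ 3 * (1 + W)
       + (2 * K0 + 2 * c ^+ 3 * (64 * C / de ^+ 2)) * (c ^+ 3 * (1 + W)))).
Proof.
move=> /andP[de0 des] st tsig Mt K00 pP p'C CM a0 L pS.
have c0 := ls_c0 LS; have /andP[rho0 rho1] := ls_rho LS; have /andP[s00 s01] := ls_s0 LS.
have [C1 /andP[sg0 sgs] _ _] := SC; have /andP[sig0 sigs] := ch_sig CH.
have t1 : t <= 1 by clear -LS SC CH tsig sigs sgs s01; lra.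
have s0' : 0 < s by exact: lt_le_trans des.
have t0 : 0 < t by exact: lt_trans st.
have c30 : 0 <= c ^+ 3 by rewrite exprn_ge0// ltW.
have W0 : 0 <= W := ltW (speed_gt0 LS SC).
have tB : box (t, gam t) by apply: (ch_box LS SC CH); rewrite (ltW t0).
have sB : box (s, gam s) by apply: (ch_box LS SC CH); rewrite (ltW s0') (le_trans (ltW st)).
set r := t - s; have r0 : 0 < r by rewrite subr_gt0.
have r1 : r <= 1 by rewrite /r; clear -LS SC CH s0' t1; lra.
pose Kd := 64 * C / de ^+ 2.
have Kd0 : 0 <= Kd by rewrite divr_ge0 ?sqr_ge0// mulr_ge0//; clear -LS SC CH C1; lra.
have KsKd : 64 * C / s ^+ 2 <= Kd.
  rewrite /Kd ler_wpM2l//; first by rewrite mulr_ge0//; clear -LS SC CH C1; lra.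
  by rewrite lef_pV2 ?posrE ?exprn_gt0// sqr_le_mono// ltW.
set G := 2 * K0 + 2 * c ^+ 3 * (64 * C / de ^+ 2); rewrite -/Kd in G *.
have c3K : 0 <= c ^+ 3 * Kd by rewrite mulr_ge0.
have G0 : 0 <= G by rewrite /G; clear -LS SC CH c3K K00; lra.
set F := c ^+ 3 * (1 + W); have F0 : 0 <= F by rewrite mulr_ge0// addr_ge0.
set q := p' - p; pose Lc := r^-1 + G; have L0 : 0 < Lc by rewrite ltr_pwDl// invr_gt0.
pose th := Lc^-1; have th0 : 0 < th by rewrite invr_gt0.
have thL : th * Lc = 1 by rewrite mulVf// gt_eqF.
have thr : th <= r by rewrite -[leRHS]invrK lef_pV2 ?posrE ?invr_gt0// lerDl.
pose Aq := mxact (A (t, gam t)) q; pose w := - (th *: Aq).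
have wr : `|w| <= M * r.
  rewrite normrN norm_scale_ge0 ?(ltW th0)// mulrC; apply: ler_pM => //; first exact: ltW.
  apply: le_trans (ls_bnd LS _ tB) (le_trans _ CM); rewrite ler_wpM2l ?(ltW c0)//.
  by rewrite (le_trans (ler_normB _ _))// lerD.
have w32 : `|w| <= rho / 32.
  have M0 : 0 <= M.
    by apply: le_trans CM; rewrite mulr_ge0 ?(ltW c0)// addr_ge0 ?(le_trans _ pP)//; clear -LS SC CH C1; lra.
  by rewrite (le_trans wr)// (le_trans _ Mt)// ler_wpM2l// /r; clear -LS SC CH s0'; lra.
pose Q := aform A (t, gam t) q q; have Q0 : 0 <= Q by apply: (aform_ge0 LS).
have bAq x : bform A (t, gam t) Aq x = dotv q x.
  rewrite /bform -[in LHS](ainvK LS x tB) -dotv_mxactC ?(ls_sym LS tB)// (ainvK LS _ tB).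
  by rewrite dotv_mxactC ?(ls_sym LS tB)// (ainvK LS x tB).
have QE : dotv q Aq = Q by rewrite dotvC.
have bw : bform A (t, gam t) w w = th ^+ 2 * Q by rewrite !bformE bAq QE; ring.
have up := supergrad_slice s0' pS (y := gam s + w); rewrite addrAC subrr add0r in up.
have := le_trans (L w wr) (up w32).
have : 64 * C / s ^+ 2 * `|w| ^+ 2 <= Kd * (c ^+ 3 * (th ^+ 2 * Q)).
  rewrite -bw; apply: ler_pM => //; rewrite ?sqr_ge0//; last exact: (bform_ell LS).
  by rewrite divr_ge0 ?sqr_ge0// mulr_ge0//; clear -LS SC CH C1; lra.
have -> : (2 * (t - s))^-1 = 2^-1 * r^-1 by rewrite invfM.
rewrite bw => h1 h2.
have pw : dotv p' w = dotv p w - th * Q.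
  have -> : p' = p + q by rewrite /q addrC subrK.
  by rewrite dotvDl [dotv q w]dotvNr dotvZr QE.
rewrite pw in h2.
have h3 : th * Q <= a + 2^-1 * Lc * (th ^+ 2 * Q).
  move: h1 h2; rewrite /Lc /G; clear -LS SC CH.
  generalize (u (s, gam s)) (64 * C / s ^+ 2 * `|w| ^+ 2) (dotv p w) r^-1 (th ^+ 2 * Q) (th * Q).
  by move=> ? ? ? ? ? ?; lra.
have e1 : 2^-1 * Lc * (th ^+ 2 * Q) = 2^-1 * th * Q * (th * Lc) by ring.
rewrite e1 thL mulr1 in h3.
have QL : 2^-1 * Q <= a * Lc.
  have -> : 2^-1 * Q = 2^-1 * (th * Q) * Lc by rewrite -[LHS]mulr1 -thL; ring.
  by rewrite ler_wpM2r ?(ltW L0)//; clear -LS SC CH h3; lra.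
have qQ : `|q| ^+ 2 <= c * Q by apply: (aform_ell LS).
have azQ : aform A (s, gam s) q q <= Q * (1 + F * r).
  have := aform_lip LS q q tB sB; rewrite -mulrA -expr2 ler_norml => /andP[_].
  have dts : dist1 (t, gam t) (s, gam s) <= (1 + W) * r.
    rewrite /dist1 /=; have := ch_lip CH (ltW t0) (ltW s0').
    have -> : `|s - t| = r by rewrite distrC ger0_norm// ltW.
    by clear -LS SC CH; lra.
  have : c ^+ 2 * dist1 (t, gam t) (s, gam s) * `|q| ^+ 2 <= c ^+ 2 * ((1 + W) * r) * (c * Q).
    apply: ler_pM => //; rewrite ?sqr_ge0//; first by rewrite mulr_ge0 ?sqr_ge0// addr_ge0.
    by rewrite ler_wpM2l ?sqr_ge0.
  by rewrite -/Q /F; clear -LS SC CH; lra.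
have Fr : 0 <= F * r by rewrite mulr_ge0// ltW.
have h4 : 2^-1 * (Q * (1 + F * r)) <= a * (Lc * (1 + F * r)).
  by rewrite !mulrA ler_wpM2r// addr_ge0.
have h5 : a * (Lc * (1 + F * r)) <= a * (r^-1 + (G + F + G * F)).
  rewrite ler_wpM2l//; have -> : Lc * (1 + F * r) = r^-1 + G + F * (r * r^-1) + G * F * r by rewrite /Lc; ring.
  rewrite divff ?gt_eqF// mulr1; have : G * F * r <= G * F by rewrite ler_piMr// mulr_ge0.
  by clear -LS SC CH; lra.
by apply: le_trans (le_trans h4 h5); rewrite ler_wpM2l.
Qed.

(** The step costs the energy of [p' - pi], where [pi] is the mean momentum, but the hypothesis
    bounds that of [p' - p]. The inclusion tested in the direction [pi - p] makes
    [<A (p' - pi), pi - p>] almost nonnegative, so expanding the energy of [(p' - pi) + (pi - p)]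
    shows that [pi] is, up to [eps], no farther from [p'] than [p] is. *)
Lemma lower_paraboloid_descent M D K0 P t s a p g eps : step_constant A V u rho c C sig gam M D ->
  0 <= D -> 0 < s <= t -> t <= sig -> M * t <= rho / 32 -> D * t <= 1 -> D * c ^+ 3 <= K0 ->
  `|p| <= P -> lower_paraboloid t M K0 s a p ->
  (forall p', `|p'| <= C -> S s p' -> 2^-1 * aform A (s, gam s) (p' - p) (p' - p) <= g) ->
  0 < eps -> exists2 d, 0 < d & forall h, 0 < h < d ->
    exists p1, lower_paraboloid t M K0 (s - h) (a + h * (g + eps)) p1.
Proof.
move=> step D0 /andP[s0' st] tsig Mt Dt DK pP L gap eps0.
have c0 := ls_c0 LS; have /andP[rho0 rho1] := ls_rho LS.
have [C1 _ _ _] := SC; have W0 := speed_gt0 LS SC.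
have sB : box (s, gam s) by apply: (ch_box LS SC CH); rewrite (ltW s0') (le_trans st).
have P0 : 0 <= P := le_trans (normr_ge0 _) pP.
pose Pe := c ^+ 2 * W + P + 1.
have c2W : 0 <= c ^+ 2 * W by rewrite mulr_ge0 ?sqr_ge0// ltW.
have Pe0 : 0 < Pe by rewrite /Pe; clear -LS SC CH c2W P0; lra.
have e10 : 0 < eps / 2 / Pe by rewrite divr_gt0// divr_gt0.
have ss : 0 < s <= sig by rewrite s0' (le_trans st).
have [eta eta0 INC] := ch_incl CH ss e10.
pose DD := D + 64 * C * (1 + W ^+ 2) / s ^+ 2.
have DD0 : 0 <= DD.
  rewrite addr_ge0// divr_ge0 ?sqr_ge0// mulr_ge0//; first by clear -LS SC CH C1; lra.
  by rewrite addr_ge0 ?sqr_ge0.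
have DD1 : 0 < 2 * (DD + 1) by rewrite mulr_gt0// ltr_wpDl.
pose d := Num.min (Num.min eta (s / 2)) (Num.min (rho / 32 / W) (eps / (2 * (DD + 1)))).
exists d => [|h /andP[h0]].
  by rewrite !lt_min eta0 /=; apply/andP; split; [|apply/andP; split]; apply: divr_gt0 => //; exact: divr_gt0.
rewrite !lt_min => /andP[/andP[heta hs] /andP[hW hDD]].
have {}hW : W * h <= rho / 32 by rewrite mulrC -ler_pdivlMr// ltW.
have {}hDD : h * (2 * (DD + 1)) <= eps by rewrite -ler_pdivlMr// ltW.
have sh0 : 0 <= s - h by clear -LS SC CH hs h0; lra.
set v := h^-1 *: (gam s - gam (s - h)); pose pi := ainv A (s, gam s) v.
have vW : `|v| <= W.
  rewrite /v norm_scale_ge0 ?invr_ge0 ?(ltW h0)// mulrC ler_pdivrMr//.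
  have := ch_lip CH sh0 (ltW s0'); have -> : s - (s - h) = h by ring.
  by rewrite gtr0_norm.
have hv : h *: v = gam s - gam (s - h) by rewrite /v scalerA divff ?gt_eqF// scale1r.
have i1 : 0 <= s - h <= s by rewrite sh0 gerBl ltW.
have i2 : `|s - h - s| < eta by rewrite addrAC subrr add0r normrN gtr0_norm.
have i3 : `|s - s| < eta by rewrite subrr normr0.
have [p' [p'C pS inc]] := INC _ _ (pi - p) i1 i2 i3.
have Ap : mxact (A (s, gam s)) pi = v by rewrite /pi (ainvK LS _ sB).
rewrite -hv -Ap dotvZr in inc; have sE : s - (s - h) = h by ring.
rewrite sE ler_pM2l// in inc.
have pie : `|pi - p| <= Pe.
  rewrite (le_trans (ler_normB _ _))// /Pe.
  have : `|pi| <= c ^+ 2 * W.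
    by apply: le_trans (ainv_bnd LS _ sB) _; rewrite ler_wpM2l ?sqr_ge0.
  by clear -LS SC CH pP; lra.
have epie : eps / 2 / Pe * `|pi - p| <= eps / 2.
  rewrite -[leRHS](divfK (lt0r_neq0 Pe0)); rewrite ler_wpM2l//; exact: ltW.
have key : 2^-1 * aform A (s, gam s) (p' - pi) (p' - pi) <= g + eps / 2.
  have := gap p' p'C pS; have := aform_ge0 LS (pi - p) sB.
  have e1 : dotv (pi - p) (mxact (A (s, gam s)) pi) = aform A (s, gam s) pi pi - aform A (s, gam s) pi p.
    by rewrite dotvC dotvDr dotvNr.
  have e2 : dotv (pi - p) (mxact (A (s, gam s)) p') = aform A (s, gam s) p' pi - aform A (s, gam s) p' p.
    by rewrite dotvC dotvDr dotvNr.
  move: inc; rewrite e1 e2 !aformE (aformC LS p p' sB) (aformC LS pi p' sB) (aformC LS pi p sB).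
  by move: epie; clear -LS SC CH; lra.
have hM : 0 < h < s / 2 by rewrite h0.
have [p1 P1] := step t s h K0 a p p' hM st tsig Mt Dt hW DK pS L.
exists p1; apply: lower_paraboloidW P1; rewrite -/v -/pi -/DD.
have := ler_wpM2l (ltW h0) key; have := ler_wpM2l (ltW h0) hDD.
have hh := sqr_ge0 h.
by clear -LS SC CH hh; rewrite expr2 in hh *; lra.
Qed.

Lemma lower_paraboloid_at_0 : exists2 sig', 0 < sig' <= sig & forall t, 0 < t <= sig' ->
  (forall p p', S t p -> S t p' -> p = p') ->
  exists p K, 0 < K /\ forall w, `|w| <= t ->
    u (0, y0) + dotv p w - K * `|w| ^+ 2 <= u (0, y0 + w).
Proof.
have c0 := ls_c0 LS; have c1 := ls_c LS; have /andP[rho0 rho1] := ls_rho LS.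
have [C1 /andP[sg0 sgs] _ _] := SC; have W0 := speed_gt0 LS SC.
have /andP[s00 s01] := ls_s0 LS; have /andP[sig0 sigs] := ch_sig CH.
have c30 : 0 <= c ^+ 3 by rewrite exprn_ge0// ltW.
(* [P] is the bound of [lower_paraboloid_momentum]; [M] makes the test displacements of that lemma
   and of [lower_paraboloid_gap] admissible. *)
pose P := C + 1 + 2 * c ^+ 3; pose M := c * (C + P) + 1.
have P0 : 0 <= P by rewrite /P; clear -LS SC CH c30 C1; lra.
have M1 : 1 <= M by rewrite lerDr mulr_ge0 ?(ltW c0)//; clear -LS SC CH P0 C1; lra.
have [D D0 step] := lower_paraboloid_step LS SC CH M1.
pose K0 := D * c ^+ 3; have K00 : 0 <= K0 by rewrite mulr_ge0.
have M0 : 0 < M by apply: lt_le_trans M1.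
have MM : c * (C + P) <= M by rewrite lerDl.
clearbody M.
pose N := 1 + D + K0; have N0 : 0 < N by rewrite /N; clear -LS SC CH D0 K00; lra.
pose sig' := Num.min sig (Num.min (rho / 32 / M) N^-1).
have sig'0 : 0 < sig' by rewrite !lt_min sig0 invr_gt0 N0 andbT; apply: divr_gt0 => //; exact: divr_gt0.
have sig'M : M * sig' <= rho / 32 by rewrite mulrC -ler_pdivlMr// !ge_min lexx orbT.
have sig'N : sig' * N <= 1 by rewrite -ler_pdivlMr// div1r !ge_min lexx !orbT.
have sig's : sig' <= sig by rewrite ge_min lexx.
exists sig'; first by rewrite sig'0.
clearbody sig'; move=> t /andP[t0 tsig'] uniq.
have tsig : t <= sig by exact: le_trans sig's.
have ts : 0 < t <= sig by rewrite t0.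
have Mt : M * t <= rho / 32 by apply: le_trans sig'M; rewrite ler_pM2l.
have tN : t * N <= 1 by apply: le_trans sig'N; rewrite ler_wpM2r// ltW.
have Dt : D * t <= 1.
  by rewrite /N in tN; have : 0 <= t * K0 by [rewrite mulr_ge0// ltW]; clear -LS SC CH tN t0; lra.
have Kt : K0 * t <= 1.
  by rewrite /N in tN; have : 0 <= t * D by [rewrite mulr_ge0// ltW]; clear -LS SC CH tN t0; lra.
have t1 : t <= 1 by clear -LS SC CH tsig sigs sgs s01; lra.
have tr8 : t <= rho / 8.
  by apply: le_trans (_ : t <= rho / 32) _; [apply: le_trans Mt; rewrite ler_peMl// ltW|clear -LS SC CH rho0; lra].
have [p0 p0C p0S] := ch_ne CH ts.
(* For every [e], a vertex depth growing at most like [e r exp(2 E r)] persists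
   down to time [de]; then [e] and [de] are sent to zero. *)
have below de : 0 < de < t -> exists2 p, `|p| <= P & lower_paraboloid t M K0 de 0 p.
  move=> /andP[de0 det].
  pose G1 := 2 * K0 + 2 * c ^+ 3 * (64 * C / de ^+ 2).
  pose E := G1 + c ^+ 3 * (1 + W) + G1 * (c ^+ 3 * (1 + W)) + 1.
  have G10 : 0 <= G1.
    have k1 : 0 <= 64 * C / de ^+ 2 by apply: divr_ge0; rewrite ?sqr_ge0// mulr_ge0//; clear -LS SC CH C1; lra.
    have k2 : 0 <= c ^+ 3 * (64 * C / de ^+ 2) by rewrite mulr_ge0.
    by rewrite /G1; clear -LS SC CH k2 K00; lra.
  have F0 : 0 <= c ^+ 3 * (1 + W) by rewrite mulr_ge0// addr_ge0// ltW.
  have GF0 : 0 <= G1 * (c ^+ 3 * (1 + W)) by rewrite mulr_ge0.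
  have E0 : 0 < E by rewrite /E; clear -LS SC CH G10 F0 GF0; lra.
  have gap s a p p' : de <= s < t -> `|p| <= P -> `|p'| <= C -> 0 <= a ->
      lower_paraboloid t M K0 s a p -> S s p' ->
      2^-1 * aform A (s, gam s) (p' - p) (p' - p) <= a * ((t - s)^-1 + E).
    move=> /andP[des st] pP p'C a0 L pS.
    have dd : 0 < de <= s by rewrite de0.
    have := lower_paraboloid_gap dd st tsig Mt K00 pP p'C MM a0 L pS.
    rewrite -/G1 => h; apply: le_trans h _; rewrite ler_wpM2l// lerD2l /E; clear -LS SC CH; lra.
  clearbody E; pose X := expR (2 * E); have X0 : 0 < X := expR_gt0 _.
  have X1 : 1 <= X by rewrite /X -expR0 ler_expR mulr_ge0// ltW.
  suff small (ee : R) : 0 < ee -> ee * X <= 1 -> exists2 p, `|p| <= P & lower_paraboloid t M K0 de (ee * X) p.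
    apply: (lower_paraboloid_limit ts _ (ltW M0) Mt K00 P0) => [|w w0]; first by rewrite ltW.
    pose ee := Num.min w 1 / X.
    have m0 : 0 < Num.min w 1 by rewrite lt_min w0 ltr01.
    have e0 : 0 < ee by rewrite divr_gt0.
    have eX : ee * X = Num.min w 1 by rewrite divfK// gt_eqF.
    have [||p pP L] := small ee => //; first by rewrite eX ge_min lexx orbT.
    exists de, (ee * X), p; split => //; first by rewrite (ltW de0).
    - by rewrite subrr normr0.
    - by rewrite add0r eX ge_min lexx.
  (* [g] solves [g' = g / r + 2 E g]. One [E g] comes from the gap bound, the other is the slack
     [eps] that [lower_paraboloid_descent] asks for. The initial slope [ee] is the free parameter of
     this family. *)
  move=> e0 eX; pose g (r : R) := ee * r * expR (2 * E * r).
  have g0 r : 0 <= r -> 0 <= g r by move=> r0; rewrite mulr_ge0 ?expR_ge0// mulr_ge0// ltW.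
  have gr r : 0 <= r <= t -> g r <= r * (ee * X).
    move=> /andP[r0 rt]; rewrite /g.
    have -> : ee * r * expR (2 * E * r) = r * (ee * expR (2 * E * r)) by ring.
    apply: ler_wpM2l => //; apply: ler_wpM2l; first exact: ltW.
    by rewrite ler_expR; apply: ler_piMr; [rewrite mulr_ge0// ltW|exact: le_trans t1].
  have gmono r r' : 0 <= r <= r' -> g r <= g r'.
    move=> /andP[r0 rr']; rewrite /g; apply: ler_pM => //; rewrite ?expR_ge0//.
    - by rewrite mulr_ge0// ltW.
    - by rewrite ler_wpM2l// ltW.
    - by rewrite ler_expR ler_wpM2l// mulr_ge0// ltW.
  have gstep r h : 0 <= r -> 0 < h -> 
     g r + h * (ee * expR (2 * E * r) + 2 * E * g r) <= g (r + h).
    move=> r0 h0; rewrite /g (mulrDr (2 * E)) expRD.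
    have x1 : 1 + 2 * E * h <= expR (2 * E * h) by exact: expR_ge1Dx.
    set Y := expR (2 * E * r); have Y0 : 0 < Y := expR_gt0 _.
    apply: (@le_trans _ _ (ee * (r + h) * (Y * (1 + 2 * E * h)))); last first.
      by rewrite ler_wpM2l ?mulr_ge0 ?(ltW e0) ?addr_ge0 ?(ltW h0)// ler_wpM2l// ltW.
    have : 0 <= ee * Y * E * (h * h) by rewrite !mulr_ge0// ltW.
    by clear -LS SC CH; lra.
  have main : forall r, 0 <= r <= t - de -> exists2 p, `|p| <= P & lower_paraboloid t M K0 (t - r) (g r) p.
    apply: real_induction => [|r /andP[r0 rb] [p pP L]|r /andP[r0 rb] IH].
    - exists p0; first by rewrite (le_trans p0C)// /P; clear -LS SC CH c30; lra.
      by rewrite subr0 /g mulr0 mul0r; exact: lower_paraboloid_start.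
    - have st : 0 < t - r <= t by apply/andP; split; clear -LS SC CH de0 rb r0; lra.
      have momentum h p1 : 0 < h -> r + h <= t - de -> lower_paraboloid t M K0 (t - (r + h)) (g (r + h)) p1 ->
          `|p1| <= P.
        move=> h0 hb L1; have rh : 0 <= r + h <= t by apply/andP; split; clear -LS SC CH h0 r0 hb de0; lra.
        have trh : t - (t - (r + h)) = r + h by ring.
        apply: (lower_paraboloid_momentum LS SC CH (t := t) (M := M) (K0 := K0) (s := t - (r + h)) (a := g (r + h))) => //.
        + by apply/andP; split; clear -LS SC CH h0 r0 hb de0; lra.
        + rewrite trh; apply: le_trans (gr _ rh) _; have /andP[rh0 _] := rh.
          by rewrite ler_piMr.
        + by rewrite trh; apply: le_trans Kt; rewrite ler_wpM2l//; have /andP[] := rh.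
        + by rewrite trh; have /andP[_ h1] := rh; exact: le_trans h1 _.
      have fin (d : R) : 0 < d -> (forall h, 0 < h < d -> exists p1, lower_paraboloid t M K0 (t - (r + h)) (g (r + h)) p1) ->
          exists2 d, 0 < d & forall h, 0 < h < d ->
            exists2 p, `|p| <= P & lower_paraboloid t M K0 (t - (r + h)) (g (r + h)) p.
        move=> d0 Q; exists (Num.min d (t - de - r)); first by rewrite lt_min d0 subr_gt0.
        move=> h /andP[h0]; rewrite lt_min => /andP[hd hb].
        have [p1 L1] := Q h ltac:(by rewrite h0); exists p1 => //.
        by apply: momentum L1 => //; clear -LS SC CH hb; lra.
      (* The bound by [g r / r] says nothing at [r = 0]. There uniqueness identifies [p'] with [p0],
         so the gap is 0 and the slack [ee] becomes the initial slope of [g]. *)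
      have [rE|rn] := eqVneq r 0.
        have gp p' : `|p'| <= C -> S (t - r) p' -> 2^-1 * aform A (t - r, gam (t - r)) (p' - p0) (p' - p0) <= 0.
          rewrite rE subr0 => _ pS; rewrite (uniq _ _ pS p0S) subrr /aform dotv0r mulr0 //.
        have L0 : lower_paraboloid t M K0 (t - r) 0 p0.
          by rewrite rE subr0; exact: lower_paraboloid_start.
        have p0P : `|p0| <= P by rewrite (le_trans p0C)// /P; clear -LS SC CH c30; lra.
        have [d d0 Q] := lower_paraboloid_descent step D0 st tsig Mt Dt (lexx _) p0P L0 gp e0.
        apply: (fin d d0) => h hd; have [p1 L1] := Q h hd; exists p1.
        have -> : t - (r + h) = t - r - h by ring.
        apply: lower_paraboloidW L1; have /andP[h0 _] := hd.
        have := gstep 0 h (lexx _) h0; rewrite rE !add0r /g !mulr0 !mul0r add0r expR0 mulr1.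
        by rewrite !mulr0 addr0.
      have rp : 0 < r by rewrite lt_neqAle eq_sym rn.
      have gp p' : `|p'| <= C -> S (t - r) p' ->
          2^-1 * aform A (t - r, gam (t - r)) (p' - p) (p' - p) <= g r * (r^-1 + E).
        move=> p'C pS; have := gap (t - r) (g r) p p'.
        have -> : t - (t - r) = r by ring.
        by apply => //; [apply/andP; split; clear -LS SC CH rb rp; lra|exact: g0].
      have Eg0 : 0 < E * g r by rewrite mulr_gt0// mulr_gt0 ?expR_gt0// mulr_gt0.
      have [d d0 Q] := lower_paraboloid_descent step D0 st tsig Mt Dt (lexx _) pP L gp Eg0.
      apply: (fin d d0) => h hd; have [p1 L1] := Q h hd; exists p1.
      have -> : t - (r + h) = t - r - h by ring.
      apply: lower_paraboloidW L1; have /andP[h0 _] := hd.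
      apply: le_trans (gstep r h r0 h0); rewrite lerD2l ler_wpM2l ?(ltW h0)//.
      have -> : g r * (r^-1 + E) + E * g r = g r / r + 2 * E * g r by ring.
      rewrite lerD2r /g; have -> : ee * r * expR (2 * E * r) / r = ee * expR (2 * E * r) * (r / r) by ring.
      by rewrite divff// mulr1.
    - have srt : 0 <= t - r < t by apply/andP; split; clear -LS SC CH rb r0 de0; lra.
      apply: (lower_paraboloid_limit ts srt (ltW M0) Mt K00 P0) => w w0.
      pose r' := r - Num.min (r / 2) (w / 2).
      have m0 : 0 < Num.min (r / 2) (w / 2) by rewrite lt_min !divr_gt0.
      have mr : Num.min (r / 2) (w / 2) <= r / 2 by rewrite ge_min lexx.
      have mw : Num.min (r / 2) (w / 2) <= w / 2 by rewrite ge_min lexx orbT.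
      have r'r : 0 <= r' < r by apply/andP; split; rewrite /r'; clear -LS SC CH m0 mr r0; lra.
      have [p pP L] := IH r' r'r; have /andP[r'0 r'lt] := r'r.
      exists (t - r'), (g r'), p; split => //.
      + by apply/andP; split; rewrite ?subr_ge0 ?gtrBl; clear -LS SC CH srt r'lt rb de0 r'0 m0 mr r0; rewrite /r'; lra.
      + have -> : t - r' - (t - r) = Num.min (r / 2) (w / 2) by rewrite /r'; ring.
        by rewrite gtr0_norm//; clear -LS SC CH mw w0; lra.
      + apply: le_trans (gmono r' r _) _; first by rewrite r'0 ltW.
        by rewrite lerDl ltW.
  have rb : 0 <= t - de <= t - de by rewrite lexx subr_ge0 ltW.
  have [p pP L] := main (t - de) rb; exists p => //.
  have tde : t - (t - de) = de by ring.
  rewrite tde in L; apply: lower_paraboloidW L; apply: le_trans (gr _ _) _.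
    by rewrite subr_ge0 (ltW det) gerBl ltW.
  rewrite ler_piMl//; last by clear -LS SC CH t1 de0; lra.
  by rewrite mulr_ge0// ltW.
have [p pP L] : exists2 p, `|p| <= P & lower_paraboloid t M K0 0 0 p.
  apply: (lower_paraboloid_limit ts _ (ltW M0) Mt K00 P0) => [|w w0]; first by rewrite lexx.
  pose de := Num.min (t / 2) (w / 2).
  have de0 : 0 < de by rewrite lt_min !divr_gt0.
  have det : de <= t / 2 by rewrite ge_min lexx.
  have dew : de <= w / 2 by rewrite ge_min lexx orbT.
  have dd : 0 < de < t by rewrite de0; clear -LS SC CH det t0; lra.
  have [p pP L] := below de dd; exists de, 0, p; split => //.
  - by rewrite (ltW de0); have /andP[] := dd.
  - by rewrite subr0 gtr0_norm//; clear -LS SC CH dew w0; lra.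
  - by rewrite add0r ltW.
have tB : box (t, gam t) by apply: (ch_box LS SC CH); rewrite (ltW t0).
pose K1 := ((2 * t)^-1 + K0) * c ^+ 3.
have K10 : 0 < K1 by rewrite mulr_gt0 ?exprn_gt0// ltr_pwDl// invr_gt0 mulr_gt0.
exists p, K1; split => // w wt.
have := L w; rewrite subr0 (ch_0 CH) => /(_ (le_trans wt _)); rewrite subr0.
have tM : t <= M * t by rewrite ler_peMl// ltW.
move=> /(_ tM); apply: le_trans; rewrite lerD2l lerN2 /K1 -mulrA ler_wpM2l//.
  by rewrite addr_ge0// invr_ge0 mulr_ge0// ltW.
by have := bform_le LS w w tB; rewrite -mulrA -expr2.
Qed.

End Propagation.

(** * Lipschitz functions are derivable almost everywhere *)

Section LipschitzDerivable.
Context {R : realType}.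
Implicit Types (f g : R -> R) (x y : R).

Local Notation mu := (@lebesgue_measure R).

Lemma stieltjes_ocitv (f : cumulative R R) x y : x <= y ->
  lebesgue_stieltjes_measure f `]x, y] = (f y - f x)%:E.
Proof.
move=> xy; rewrite /lebesgue_stieltjes_measure /measure_extension measurable_mu_extE/=.
  by rewrite wlength_itv_bnd.
exact: is_ocitv.
Qed.

(** Lebesgue measure is the Stieltjes measure of the identity, so by uniqueness it splits into
    [L^-1] times the measure of [f] plus the measure of [h]. A null set of the sum is null for each
    summand. *)
Lemma stieltjes_dominated (f h : cumulative R R) (L : R) : 0 < L ->
  (forall x, x = L^-1 * f x + h x) -> lebesgue_stieltjes_measure f `<< mu.
Proof.
move=> L0 fh; have Li : 0 <= L^-1 by rewrite invr_ge0 ltW.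
apply/null_content_dominatesP => X mX X0.
pose nu := measure_add (mscale (NngNum Li) (lebesgue_stieltjes_measure f))
  (lebesgue_stieltjes_measure h).
have nuE B : nu B = (L^-1%:E * lebesgue_stieltjes_measure f B + lebesgue_stieltjes_measure h B)%E.
  by rewrite /nu measure_addE.
have E : mu X = nu X.
  apply: (@lebesgue_stieltjes_measure_unique R idfun nu) => // _ [[x y] _ <-] /=.
  have [xy|yx] := leP x y; last by rewrite set_itv_ge ?measure0// bnd_simp -leNgt ltW.
  rewrite -[RHS]/(nu _) nuE !stieltjes_ocitv// -EFinM -EFinD; congr (_%:E).
  by rewrite /= [in LHS](fh x) [in LHS](fh y); ring.
have /eqP : nu X = 0%E by rewrite -E.
rewrite nuE.
rewrite padde_eq0 ?mule_ge0//= => /andP[/eqP + _].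
move=> /eqP; rewrite mule_eq0 => /orP[|/eqP//].
by rewrite eqe invr_eq0 gt_eqF.
Qed.

(** By domination [f] is, up to a constant, the integral of the Radon-Nikodym density of its
    Stieltjes measure, and Lebesgue differentiation applies in the form of [FTC1]. *)
Lemma cumulativeBounded_derivable (f : cumulativeBounded (0 : R) (1 : R)) (h : cumulative R R) (L a : R) :
  0 < L -> (forall x, x = L^-1 * f x + h x) ->
  {ae mu, forall x, a < x -> derivable f x 1}.
Proof.
move=> L0 fh.
have dom : lebesgue_stieltjes_measure f `<< mu := stieltjes_dominated L0 fh.
pose nu := charge_of_finite_measure (lebesgue_stieltjes_measure f).
have dom' : nu `<< mu := dom.
pose r := fine \o (Radon_Nikodym nu mu).
have rE : EFin \o r = (Radon_Nikodym nu mu).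
  by apply/funext => x; rewrite /r /= fineK// Radon_Nikodym_fin_num.
have ir : mu.-integrable setT (EFin \o r) by rewrite rE; exact: Radon_Nikodym_integrable.
have ir' y : mu.-integrable `]a, y] (EFin \o r) by exact: integrableS ir.
have := @FTC1 R r (BRight a) ir' (open_integrable_locally openT ir).
apply: filterS; first exact: (ae_filter_ringOfSetsType mu).
move=> x FT ax.
have [dF _] := FT ax.
have dfa : derivable (fun y => f y - f a : R) x 1.
  apply: near_eq_derivable dF; near=> y.
  have ay : a <= y by apply: ltW; near: y; exact: lt_nbhsr.
  have E : lebesgue_stieltjes_measure f `]a, y] = (\int[mu]_(x in `]a, y]) (EFin \o r) x)%E.
    by rewrite rE; exact: (Radon_Nikodym_integral dom' (measurable_itv `]a, y])).
  by rewrite stieltjes_ocitv// in E; rewrite /Rintegral -E.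
have -> : (f : R -> R) = (fun y => (f y - f a) + f a : R) by apply/funext => y; rewrite subrK.
exact: (derivableD dfa (@derivable_cst _ _ _ (f a) x 1)).
Unshelve. all: by end_near.
Qed.

(** Adding [(K + 1) x] makes [g] increasing. Clamped to [[0, b]] and divided by its total growth
    [T], the sum becomes a cumulative distribution function with Lipschitz constant [L], so the
    complement [x - f x / L] is nondecreasing too and the domination argument applies. *)
Lemma lipschitz_ae_derivable (g : R -> R) (K b : R) : 0 <= K -> 0 < b ->
  (forall x y, 0 <= x <= b -> 0 <= y <= b -> `|g y - g x| <= K * `|y - x|) ->
  {ae mu, forall x, 0 < x < b -> derivable g x 1}.
Proof.
move=> K0 b0 gK.
pose cl (x : R) : R := Num.min (Num.max 0 x) b.
have cl0 x : 0 <= cl x <= b by rewrite /cl le_min ge_min lexx orbT le_max lexx (ltW b0).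
have cl_mono x y : x <= y -> cl x <= cl y.
  by move=> xy; rewrite /cl le_min2// ge_max !le_max lexx xy orbT.
have cl_lip x y : x <= y -> cl y - cl x <= y - x.
  move=> xy; rewrite /cl; case: (leP 0 x) => x0; case: (leP 0 y) => y0;
  case: (leP x b) => xb; case: (leP y b) => yb; case: (leP 0 b) => h; clear -xy x0 y0 xb yb h b0; lra.
have clE x : 0 <= x <= b -> cl x = x.
  by move=> /andP[x0 xb]; rewrite /cl (max_idPr x0) (min_idPl xb).
pose T := g b - g 0 + (K + 1) * b.
have T0 : 0 < T.
  have := gK 0 b; rewrite !lexx (ltW b0) /= => /(_ isT isT).
  by rewrite subr0 (gtr0_norm b0) ler_norml /T => /andP[h _]; lra.
pose f (x : R) : R := T^-1 * (g (cl x) - g 0 + (K + 1) * cl x).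
pose L := T^-1 * (2 * K + 1).
have Ti : 0 < T^-1 by rewrite invr_gt0.
have L0 : 0 < L by rewrite mulr_gt0//; lra.
have f_nd : nondecreasing f.
  move=> x y xy; rewrite /f ler_pM2l//; have := gK (cl x) (cl y) (cl0 x) (cl0 y).
  rewrite (ger0_norm (_ : 0 <= cl y - cl x)) ?subr_ge0 ?cl_mono// ler_norml => /andP[h _].
  by have := cl_mono _ _ xy; clear -h; lra.
have f_lip x y : x <= y -> f y - f x <= L * (y - x).
  move=> xy; rewrite /f /L -mulrBr -mulrA ler_pM2l//; have := gK (cl x) (cl y) (cl0 x) (cl0 y).
  rewrite (ger0_norm (_ : 0 <= cl y - cl x)) ?subr_ge0 ?cl_mono// ler_norml => /andP[_ h].
  have K21 : 0 <= 2 * K + 1 by lra.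
  by have := ler_wpM2l K21 (cl_lip _ _ xy); clear -h; lra.
have lip_cont (j : R -> R) (J : R) : 0 < J ->
    (forall x y, x <= y -> `|j y - j x| <= J * (y - x)) -> right_continuous j.
  move=> J0 jJ; apply: right_continuousW => x; apply/cvgrPdist_lt => e e0.
  have eJ : 0 < e / J by rewrite divr_gt0.
  exists (e / J) => //= y yx.
  apply: (@le_lt_trans _ _ (J * `|x - y|)); last by rewrite mulrC -ltr_pdivlMr.
  have [xy|/ltW yx'] := leP x y; first by rewrite distrC (distrC x) (ger0_norm (_ : 0 <= y - x)) ?subr_ge0// jJ.
  by rewrite (ger0_norm (_ : 0 <= x - y)) ?subr_ge0// jJ.
have f_rc : right_continuous f.
  apply: (lip_cont _ L) => // x y xy.
  by rewrite ger0_norm ?subr_ge0 ?f_nd// f_lip.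
pose k (x : R) : R := x - L^-1 * f x.
have kd x y : x <= y -> 0 <= k y - k x <= 1 * (y - x).
  move=> xy; have fxy : 0 <= L^-1 * (f y - f x) <= y - x.
    rewrite mulr_ge0 ?invr_ge0 ?(ltW L0) ?subr_ge0 ?f_nd//=.
    by rewrite mulrC ler_pdivrMr// mulrC f_lip.
  by move: fxy; rewrite /k => /andP[h1 h2]; apply/andP; split; lra.
have k_nd : nondecreasing k by move=> x y xy; rewrite -subr_ge0; have /andP[] := kd _ _ xy.
have k_rc : right_continuous k.
  apply: (lip_cont _ 1) => // x y xy; have /andP[h1 h2] := kd _ _ xy.
  by rewrite ger0_norm.
have fNy : f x @[x --> -oo] --> (0 : R).
  apply: cvg_near_cst; near=> x.
  have x0 : x <= 0 by near: x; apply: nbhs_ninfty_le; exact: num_real.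
  by rewrite /f /cl (max_idPl x0) (min_idPl (ltW b0)) subrr add0r !mulr0.
have fy : f x @[x --> +oo] --> (1 : R).
  apply: cvg_near_cst; near=> x.
  have xb : b <= x by near: x; apply: nbhs_pinfty_ge; exact: num_real.
  by rewrite /f /cl (max_idPr (le_trans (ltW b0) xb)) (min_idPr xb) -/T mulVf// gt_eqF.
pose fC : cumulativeBounded (0 : R) (1 : R) := HB.pack f
  (isCumulative.Build R _ R f f_nd f_rc) (isCumulativeBounded.Build R 0 1 f fNy fy).
pose kC : cumulative R R := HB.pack k (isCumulative.Build R _ R k k_nd k_rc).
have fk x : x = L^-1 * fC x + kC x by rewrite /= /k addrC subrK.
have := @cumulativeBounded_derivable fC kC L 0 L0 fk.
apply: filterS; first exact: (ae_filter_ringOfSetsType mu).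
move=> x dfx /andP[x0 xb]; have {}dfx : derivable f x 1 := dfx x0.
have gE : {near x, (fun y => T * f y + (g 0 - (K + 1) * y) : R) =1 g}.
  near=> y; have yb : 0 <= y <= b.
    by apply/andP; split; apply: ltW; near: y; [exact: lt_nbhsr|exact: lt_nbhsl].
  by rewrite /f (clE _ yb) mulrA divff ?gt_eqF//; ring.
apply: near_eq_derivable gE _; apply: derivableD.
  exact: (derivableM (@derivable_cst _ _ _ T x 1) dfx).
apply: derivableB; first exact: derivable_cst.
exact: (derivableM (@derivable_cst _ _ _ (K + 1) x 1) (@derivable_id _ _ x 1)).
Unshelve. all: by end_near. Qed.

End LipschitzDerivable.

(** * Gradients, superdifferentials and the singular characteristic *)

Section Differentials.
Context {R : realType} {n : nat}.
Implicit Types (x y p q : 'rV[R]_n).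

Lemma lipschitz_row_ae_derivable (g : R -> 'rV[R]_n) (K b : R) : 0 <= K -> 0 < b ->
  (forall s t, 0 <= s -> 0 <= t -> `|g t - g s| <= K * `|t - s|) ->
  {ae @lebesgue_measure R, forall t, 0 < t < b -> derivable g t 1}.
Proof.
move=> K0 b0 gK.
have : {ae @lebesgue_measure R, forall t, forall i, 0 < t < b -> derivable (fun s => g s ord0 i : R) t 1}.
  apply: filter_forall => i; apply: (lipschitz_ae_derivable K0 b0) => s t /andP[s0 _] /andP[t0 _].
  by apply: le_trans (gK s t s0 t0); have := norm_coord (g t - g s) i; rewrite !mxE.
apply: filterS; first exact: (ae_filter_ringOfSetsType (@lebesgue_measure R)).
by move=> t P tb; apply/derivable_mxP => i j; rewrite (ord1 i); exact: P.
Qed.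

Lemma derive_quadratic {E : normedModType R} (f : E -> R) (p v : E) (a b : R) :
  (forall h, f (p + h *: v) = f p + h * a + h ^+ 2 * b) ->
  is_derive p v (f : E -> R^o) a.
Proof.
move=> fE.
have L : (fun h : R => h^-1 *: ((f \o shift p) (h *: v) - f p) : R^o) @ 0^' --> (a : R^o).
  have : (fun h : R => a + h * b : R^o) @ 0^' --> (a : R^o).
    rewrite -[X in _ --> X]addr0 -[X in _ + X](mul0r b).
    apply: cvgD; first exact: cvg_cst.
    by apply: cvgM; [exact: cvg_within_filter (@cvg_id _ _)|exact: cvg_cst].
  apply: cvg_trans; apply: near_eq_cvg; near=> h.
  have h0 : h != 0 by near: h; exact: nbhs_dnbhs_neq.
  have -> : (f \o shift p) (h *: v) = f (p + h *: v) by rewrite /= [p + _]addrC.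
  by rewrite fE -[RHS]/(h^-1 * _); field.
by apply: DeriveDef; [apply/cvg_ex; exists a|exact: cvg_lim].
Unshelve. all: by end_near. Qed.

Lemma grad_hamiltonian (A : R * 'rV[R]_n -> 'M[R]_n) (V : R * 'rV[R]_n -> R) z p :
  (A z)^T = A z -> grad (hamiltonian A V z) p = mxact (A z) p.
Proof.
move=> As; apply/rowP => i; rewrite mxE; set d := delta_mx _ _.
have E : is_derive p d (hamiltonian A V z : 'rV[R]_n -> R^o) (dotv (mxact (A z) p) d).
  apply: (@derive_quadratic _ _ _ _ _ (2^-1 * dotv (mxact (A z) d) d)) => h.
  rewrite /hamiltonian mxactD mxactZ !(dotvDl, dotvDr, dotvZl, dotvZr).
  have -> : dotv (mxact (A z) d) p = dotv (mxact (A z) p) d.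
    by rewrite dotvC -dotv_mxactC.
  by field.
rewrite derive_val /dotv (bigD1 i)//= big1 => [|j ji]; first by rewrite addr0 [d _ _]mxE !eqxx mulr1.
by rewrite [d _ _]mxE eqxx (negPf ji) mulr0.
Qed.

Lemma sub_co (S : set 'rV[R]_n) : S `<=` co S.
Proof. by move=> q Sq C _ SC; exact: SC. Qed.

Lemma norm_le_enorm x : `|x| <= enorm x.
Proof.
rewrite -(ler_pXn2r (n := 2))// ?nnegrE ?sqrtr_ge0// enorm_sqr; exact: sqr_norm_le_dotv.
Qed.

Lemma superdiff_quadratic (u : R * 'rV[R]_n -> R) t x p (K r : R) : 0 <= K -> 0 < r ->
  (forall y, `|y - x| <= r -> u (t, y) <= u (t, x) + dotv p (y - x) + K * `|y - x| ^+ 2) ->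
  superdiff_x u (t, x) p.
Proof.
move=> K0 r0 up; rewrite /superdiff_x /=; apply/lee_addgt0Pr => e e0; rewrite add0e.
have K1 : 0 < K + 1 by rewrite ltr_wpDl.
pose d := Num.min r (e / (K + 1)).
have d0 : 0 < d by rewrite lt_min r0 divr_gt0.
rewrite limf_esupE; apply: ge_ereal_inf.
exists (ereal_sup ((fun y => ((u (t, y) - u (t, x) - dotv p (y - x)) / enorm (y - x))%:E) @`
   (ball x d `\ x))).
  exists (ball x d `\ x) => //.
  by apply: filterS (nbhsx_ballx x d d0) => y yd yx; split => //; exact/eqP.
apply: ge_ereal_sup => _ [y [yd yx] <-]; rewrite lee_fin.
move: yd; rewrite -ball_normE /= distrC => yd.
have yx0 : 0 < `|y - x| by rewrite normr_gt0 subr_eq0; apply/eqP.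
have ey := norm_le_enorm (y - x).
have e0' : 0 < enorm (y - x) by exact: lt_le_trans ey.
rewrite ler_pdivrMr//.
have yr : `|y - x| <= r by apply: ltW; apply: lt_le_trans yd _; rewrite ge_min lexx.
have ye : `|y - x| * (K + 1) <= e.
  by rewrite -ler_pdivlMr//; apply: ltW; apply: lt_le_trans yd _; rewrite ge_min lexx orbT.
have h1 := up y yr.
have h2 : K * `|y - x| ^+ 2 <= e * enorm (y - x).
  rewrite expr2 mulrA; apply: ler_pM => //; first by rewrite mulr_ge0.
  by apply: le_trans ye; rewrite mulrDr mulr1 mulrC lerDl.
by lra.
Qed.

End Differentials.

Lemma singular_characteristic {R : realType} {n : nat} (Om : set 'rV[R]_n) (T : R)
    (A : R * 'rV[R]_n -> 'M[R]_n) (V u : R * 'rV[R]_n -> R) (y0 : 'rV[R]_n) (s0 rho c : R) :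
  local_solution A V u y0 s0 rho c -> s0 < T -> (forall x, `|x - y0| <= rho -> Om x) ->
  (forall p K r, 0 < K -> 0 < r ->
    ~ (forall w, `|w| <= r -> u (0, y0) + dotv p w - K * `|w| ^+ 2 <= u (0, y0 + w))) ->
  exists (sigma : R) (gamma : R -> 'rV[R]_n),
    [/\ 0 < sigma, gen_char_ico T Om (hamiltonian A V) u gamma sigma, gamma 0 = y0
      & forall t, 0 < t < sigma -> ~ differentiable (u : R * 'rV[R]_n -> R^o) (t, gamma t)].
Proof.
move=> LS s0T ballOm noprox; have [C [sigma SC]] := lipschitz_semiconcave LS.
have [sig [gam CH]] := characteristic_exists LS SC.
have [sig' /andP[sig'0 sig's] low] := lower_paraboloid_at_0 LS SC CH.
have /andP[rho0 rho1] := ls_rho LS; have c0 := ls_c0 LS.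
have [C1 /andP[sg0 sgs] _ _] := SC; have /andP[sig0 sigs] := ch_sig CH.
have C0 : 0 <= C by apply: le_trans C1.
have W0 := ltW (speed_gt0 LS SC).
exists sig', gam; split => //; last first.
- move=> t /andP[t0 ts] du; have tss : 0 < t <= sig' by rewrite t0 ltW.
  have uniq p p' : supergrad A V u (64 * C) (rho / 32) (t, gam t) p ->
      supergrad A V u (64 * C) (rho / 32) (t, gam t) p' -> p = p'.
    apply: supergrad_unique => //; first by rewrite divr_gt0.
    exact: diff_derivable.
  have [p [K [K0 P]]] := low t tss uniq.
  exact: (noprox p K t K0 t0 P).
- exact: ch_0 CH.
move=> t0 t1 t00 t01 t1s.
have inbox t : t \in `[t0, t1] -> 0 <= t < sig'.
  by rewrite in_itv /= => /andP[h1 h2]; rewrite (le_trans t00)//= (le_lt_trans h2).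
split.
- exists (speed c C); split; first exact: num_real.
  move=> M MW [s t] /= [/inbox/andP[sp _] /inbox/andP[tp _]].
  by rewrite distrC (distrC s) (le_trans (ch_lip CH sp tp))// ler_wpM2r// ltW.
- move=> t /inbox/andP[h1 h2]; split => /=.
    by rewrite in_itv /= h1 /=; lra.
  apply: ballOm; have := ch_ball LS SC CH (t := t).
  rewrite h1 (le_trans (ltW h2))// => /(_ isT) h; lra.
have := lipschitz_row_ae_derivable W0 sig'0 (ch_lip CH).
(* Time 0 is discarded as a null set: supergradients along [gam] are only available at positive
   times. *)
have : {ae @lebesgue_measure R, forall t, t != 0}.
  by exists [set 0]; split => //; [rewrite lebesgue_measure_set1|move=> t /= /negP; rewrite negbK => /eqP].
apply: filterS2; first exact: (ae_filter_ringOfSetsType (@lebesgue_measure R)).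
move=> t tn0 dg /inbox/andP[tp ts].
have t0p : 0 < t by rewrite lt_neqAle eq_sym tn0.
have {}dg : derivable gam t 1 by apply: dg; rewrite t0p.
(* The velocity lies in the image itself and not merely in its convex hull: [ch_velocity] shows that
   [A^-1 gam'] belongs to the superdifferential. *)
split => //; apply: sub_co.
have tsig : 0 < t < sig by rewrite t0p (lt_le_trans ts).
have zB := ch_box LS SC CH (t := t).
rewrite tp ltW in zB; last by have /andP[] := tsig.
have {}zB := zB isT.
exists (ainv A (t, gam t) (derive1 gam t)).
  apply: (@superdiff_quadratic _ _ _ _ _ _ (64 * C / t ^+ 2) (rho / 32)).
  - by rewrite divr_ge0 ?sqr_ge0// mulr_ge0.
  - by rewrite divr_gt0.
  - by move=> y; exact: (ch_velocity LS SC CH tsig dg).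
by rewrite grad_hamiltonian ?(ls_sym LS zB)// (ainvK LS _ zB).
Qed.

(** * First-order expansions of C^2 functions on the box *)

Section SmoothOnBox.
Context {R : realType} {n : nat}.
Variables (y0 : 'rV[R]_n) (s0 rho : R).
Implicit Types (z d : R * 'rV[R]_n) (g f : R * 'rV[R]_n -> R^o) (U D : set (R * 'rV[R]_n)).

Local Notation box := (box y0 s0 rho).

Lemma box_compact : compact box.
Proof.
have -> : box = `[0, s0] `*` [set x | `|x - y0| <= rho].
  by apply/seteqP; split => -[t x] [/= h1 h2]; split; rewrite //= in_itv in h1 *.
by apply: compact_setX; [exact: segment_compact|exact: compact_norm_ball].
Qed.

Lemma dist1_ge0 z z' : 0 <= dist1 z z'.
Proof. by rewrite addr_ge0. Qed.

Lemma box_segment z z' (s : R) : box z -> box z' -> 0 <= s <= 1 ->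
  box (z + s *: (z' - z)) /\ dist1 z (z + s *: (z' - z)) <= dist1 z z'.
Proof.
move: z z' => [t x] [t' x'] [/= /andP[t0 ts] xr] [/= /andP[t'0 t's] x'r] /andP[s0' s1].
split; last first.
  rewrite /dist1 /= addrAC subrr add0r addrAC subrr add0r norm_scale_ge0//.
  rewrite -[X in `|X|]/(s * (t' - t)) normrM ger0_norm// -mulrDr ler_piMl// addr_ge0//.
split => /=.
  by rewrite -[X in t + X]/(s * (t' - t)); apply/andP; split; nra.
have -> : x + s *: (x' - x) - y0 = (1 - s) *: (x - y0) + s *: (x' - y0).
  by apply/rowP => i; rewrite !mxE; ring.
rewrite (le_trans (ler_normD _ _))// !norm_scale_ge0 ?subr_ge0//; nra.
Qed.

Lemma continuous_box_bounded U f : {in U, continuous f} -> box `<=` U ->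
  exists2 M, 0 <= M & forall z, box z -> `|f z| <= M.
Proof.
move=> cf BU.
have cB : {within box, continuous f}.
  apply/subspace_continuousP => z zB; apply: cvg_within_filter; apply: cf.
  by rewrite inE; exact: BU.
have [M [Mr MP]] := compact_bounded (continuous_compact cB box_compact).
exists (`|M| + 1); first by rewrite addr_ge0.
move=> z zB; apply: MP; last by exists z.
by rewrite (le_lt_trans (ler_norm _))// ltrDl.
Qed.

Lemma is_derive_line g z d (s : R) : differentiable g (z + s *: d) ->
  is_derive s 1 (fun r : R => g (z + r *: d) : R^o) ('D_d g (z + s *: d)).
Proof.
move=> dg.
have E : (fun h : R => h^-1 *: (((fun r : R => g (z + r *: d)) \o shift s) (h *: 1) - g (z + s *: d)))
   = (fun h => h^-1 *: ((g \o shift (z + s *: d)) (h *: d) - g (z + s *: d))).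
  apply/funext => h; congr (_ *: (g _ - _)); rewrite /= [h *: 1]mulr1 scalerDl.
  by rewrite addrCA.
by split; [rewrite /derivable E; exact: diff_derivable|rewrite /derive E].
Qed.

Lemma derive_coordinates g z d : differentiable g z ->
  'D_d g z = d.1 * 'D_(1, 0) g z + \sum_(i < n) d.2 ord0 i * 'D_(0, delta_mx ord0 i) g z.
Proof.
move=> dg; rewrite !deriveE//.
have dE : d = d.1 *: (1, 0) + \sum_(i < n) d.2 ord0 i *: (0, delta_mx ord0 i).
  rewrite [LHS]surjective_pairing; apply/pair_eqP; apply/andP; split; apply/eqP => /=.
    rewrite [X in _ + X](_ : _ = 0) ?addr0 ?[_ *: 1]mulr1//.
    by rewrite (raddf_sum (@fst _ _)) /= big1 // => i _; exact: scaler0.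
  rewrite scaler0 add0r (raddf_sum (@snd _ _)) /=; exact: row_sum_delta.
by rewrite [in LHS]dE linearD linearZ linear_sum; congr (_ + _); apply: eq_bigr => i _; rewrite !deriveE// linearZ.
Qed.

Lemma mean_value_box U g z z' : {in U, forall x, differentiable g x} -> box `<=` U ->
  box z -> box z' ->
  exists y, [/\ box y, dist1 z y <= dist1 z z' & g z' - g z = 'D_(z' - z) g y].
Proof.
move=> dg BU zB z'B; set d := z' - z.
have dphi (s : R) : 0 <= s <= 1 -> is_derive s 1 (fun r : R => g (z + r *: d) : R^o) ('D_d g (z + s *: d)).
  move=> s01; apply: is_derive_line; apply: dg; rewrite inE; apply: BU.
  by have [] := box_segment zB z'B s01.
have [||s s01] := @MVT R (fun r : R => g (z + r *: d)) (fun s => 'D_d g (z + s *: d)) 0 1 ltr01.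
- by move=> s; rewrite in_itv /= => /andP[s0' s1]; apply: dphi; rewrite !ltW.
- apply: derivable_within_continuous => s; rewrite in_itv /= => s01.
  by have [] := dphi s s01.
move: s01; rewrite in_itv /= => /andP[s0' s1].
have zd : z + d = z' by rewrite addrC subrK.
rewrite scale1r scale0r addr0 subr0 mulr1 zd => E.
have s01 : 0 <= s <= 1 by rewrite !ltW.
by have [h1 h2] := box_segment zB z'B s01; exists (z + s *: d).
Qed.

(** The finitely many partial derivatives are bounded on the compact box, and the box is convex, so
    the mean value theorem applies along segments. *)
Lemma C1_box_lipschitz U g : Ck 1 U g -> box `<=` U ->
  exists2 L, 0 <= L & forall z z', box z -> box z' -> `|g z' - g z| <= L * dist1 z z'.
Proof.
move=> [dg cg] BU.
have [L0 L00 L0P] := continuous_box_bounded (cg (1, 0)) BU.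
have [L1 L1P] := choice (fun i : 'I_n => let: ex_intro2 M a b := continuous_box_bounded (cg (0, delta_mx ord0 i)) BU in
  ex_intro (fun M => 0 <= M /\ forall z, box z -> `|'D_(0, delta_mx ord0 i) g z| <= M) M (conj a b)).
have S0 : 0 <= \sum_(i < n) L1 i by apply: sumr_ge0 => i _; have [] := L1P i.
exists (L0 + \sum_(i < n) L1 i); first by rewrite addr_ge0.
move=> z z' zB z'B; have [y [yB _ ->]] := mean_value_box dg BU zB z'B.
rewrite derive_coordinates; last by apply: dg; rewrite inE; exact: BU.
have dt : `|(z' - z).1| <= dist1 z z' by rewrite lerDl.
have dx i : `|(z' - z).2 ord0 i| <= dist1 z z'.
  by apply: le_trans (norm_coord _ _) _; rewrite lerDr.
apply: le_trans (ler_normD _ _) _; rewrite [X in _ <= X]mulrDl; apply: lerD.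
  by rewrite normrM mulrC; apply: ler_pM => //; exact: L0P.
apply: le_trans (ler_norm_sum _ _ _) _; rewrite mulr_suml; apply: ler_sum => i _.
by rewrite normrM mulrC; apply: ler_pM => //; have [_] := L1P i; apply.
Qed.

(** The mean value theorem expresses the increment by the derivative at an intermediate point [y] no
    farther than [z']. The partial derivatives are C^1, hence Lipschitz on the box, so replacing [y]
    by [z] costs a second-order term. *)
Lemma C2_box_expansion D (f : R * 'rV[R]_n -> R) : Ck_on 2 D f -> box `<=` D ->
  exists2 L, 0 <= L & forall z, box z ->
    [/\ `|f z| <= L, forall z', box z' -> `|f z' - f z| <= L * dist1 z z' &
    exists (l0 : R) (l1 : 'rV[R]_n), [/\ `|l0| <= L, `|l1| <= L & forall z', box z' ->
      `|f z' - f z - l0 * (z'.1 - z.1) - dotv l1 (z'.2 - z.2)| <= L * dist1 z z' ^+ 2]].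
Proof.
move=> [U [g [oU DU [dg cg] gf]]] BD.
have BU : box `<=` U by move=> z /BD /DU.
have gfB z : box z -> g z = f z by move=> zB; apply: gf; rewrite inE; exact: BD.
have cont : {in U, continuous g} by move=> z zU; exact: differentiable_continuous (dg z zU).
have [M M0 MP] := continuous_box_bounded cont BU.
have [L0 L00 L0P] := C1_box_lipschitz (cg (1, 0)) BU.
have c0 v : {in U, continuous ('D_v g)}.
  by move=> z zU; have [dv _] := cg v; exact: differentiable_continuous (dv z zU).
have [N0 N00 N0P] := continuous_box_bounded (c0 (1, 0)) BU.
have [L3 L30 L3P] := C1_box_lipschitz (conj dg c0) BU.
have P i : exists M, 0 <= M /\ (forall z, box z -> `|'D_(0, delta_mx ord0 i) g z| <= M) /\
    forall z z', box z -> box z' ->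
      `|'D_(0, delta_mx ord0 i) g z' - 'D_(0, delta_mx ord0 i) g z| <= M * dist1 z z'.
  have [N N0' NP] := continuous_box_bounded (c0 (0, delta_mx ord0 i)) BU.
  have [L L0' LP] := C1_box_lipschitz (cg (0, delta_mx ord0 i)) BU.
  exists (N + L); split; first by rewrite addr_ge0.
  split=> [z zB|z z' zB z'B]; first by rewrite (le_trans (NP z zB))// lerDl.
  by rewrite (le_trans (LP z z' zB z'B))// ler_wpM2r ?dist1_ge0// lerDr.
have [L1 {}P] := choice P.
have L1p i : 0 <= L1 i by have [] := P i.
pose S := \sum_(i < n) L1 i; have S0 : 0 <= S by exact: sumr_ge0.
have L1S i : L1 i <= S by rewrite /S (bigD1 i)//= lerDl sumr_ge0.
exists (M + L0 + N0 + S + L3); first by rewrite !addr_ge0.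
move=> z zB; split.
- by rewrite -gfB// (le_trans (MP z zB))// -!addrA lerDl !addr_ge0.
- move=> z' z'B; rewrite -!gfB//; apply: le_trans (L3P z z' zB z'B) _.
  by rewrite ler_wpM2r ?dist1_ge0// lerDr !addr_ge0.
exists ('D_(1, 0) g z), (\row_i 'D_(0, delta_mx ord0 i) g z); split.
- rewrite (le_trans (N0P z zB))//; lra.
- apply: norm_row_le => [|i]; first by rewrite !addr_ge0.
  rewrite mxE; have [_ [h _]] := P i; rewrite (le_trans (h z zB))// (le_trans (L1S i))//; lra.
move=> z' z'B; rewrite -!gfB//.
have [y [yB zy ->]] := mean_value_box dg BU zB z'B.
rewrite derive_coordinates; last by apply: dg; rewrite inE; exact: BU.
have -> : dotv (\row_i 'D_(0, delta_mx ord0 i) g z) (z'.2 - z.2) =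
    \sum_(i < n) (z' - z).2 ord0 i * 'D_(0, delta_mx ord0 i) g z.
  by apply: eq_bigr => i _; rewrite mxE mulrC.
have -> : forall a b b' c d : R, a * b + c - b' * a - d = a * (b - b') + (c - d) by move=> *; ring.
rewrite -sumrB; under eq_bigr do rewrite -mulrBr.
have dt : `|(z' - z).1| <= dist1 z z' by rewrite lerDl.
have dx i : `|(z' - z).2 ord0 i| <= dist1 z z'.
  by apply: le_trans (norm_coord _ _) _; rewrite lerDr.
have d0 := dist1_ge0 z z'.
have a1 : `|(z' - z).1 * ('D_(1, 0) g y - 'D_(1, 0) g z)| <= dist1 z z' * (L0 * dist1 z z').
  rewrite normrM; apply: ler_pM => //; apply: le_trans (L0P z y zB yB) _.
  by rewrite ler_wpM2l.
have a2 : `|\sum_(i < n) (z' - z).2 ord0 i * ('D_(0, delta_mx ord0 i) g y - 'D_(0, delta_mx ord0 i) g z)|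
    <= dist1 z z' * (S * dist1 z z').
  apply: le_trans (ler_norm_sum _ _ _) _; rewrite /S mulr_suml mulr_sumr; apply: ler_sum => i _.
  rewrite normrM; apply: ler_pM => //; have [_ [_ h]] := P i; apply: le_trans (h z y zB yB) _.
  by rewrite ler_wpM2l.
have MN : 0 <= (M + N0 + L3) * dist1 z z' ^+ 2 by rewrite mulr_ge0 ?sqr_ge0// !addr_ge0.
by apply: le_trans (ler_normD _ _) _; lra.
Qed.

End SmoothOnBox.

(** * Viscosity inequalities for quadratic test functions *)

Section QuadraticTests.
Context {R : realType} {n : nat}.
Implicit Types (x p : 'rV[R]_n) (z v : R * 'rV[R]_n) (t tau K : R).

(** Named so as to be registered as linear maps, from which the differentiability of the quadratic
    test functions is assembled. *)
Definition time_coord (z : R * 'rV[R]_n) : R^o := z.1.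
Definition space_coord (i : 'I_n) (z : R * 'rV[R]_n) : R^o := z.2 ord0 i.

Lemma time_coord_linear : linear time_coord. Proof. by []. Qed.
Lemma space_coord_linear i : linear (space_coord i).
Proof. by move=> a z z'; rewrite /space_coord /= !mxE. Qed.

HB.instance Definition _ := GRing.isLinear.Build R _ _ _ time_coord time_coord_linear.
HB.instance Definition _ i := GRing.isLinear.Build R _ _ _ (space_coord i) (space_coord_linear i).

Lemma differentiable_time_coord z : differentiable time_coord z.
Proof. by apply: linear_differentiable => y; exact: cvg_fst. Qed.

Lemma differentiable_space_coord i z : differentiable (space_coord i) z.
Proof.
apply: linear_differentiable => y.
apply: (@cvg_comp _ _ _ snd (fun w : 'rV[R]_n => w ord0 i) _ _ _ cvg_snd).
exact: coord_continuous.
Qed.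

(** The square is Euclidean because the square of the sup norm in the jet inequalities is not
    smooth; it dominates the latter, which is what [quadratic_abs_le] exploits. *)
Definition quadratic t x tau p K z : R :=
  tau * (z.1 - t) + dotv p (z.2 - x) + K * ((z.1 - t) ^+ 2 + dotv (z.2 - x) (z.2 - x)).

Definition quadratic_slope t x tau p K v z : R :=
  tau * v.1 + dotv p v.2 + 2 * K * ((z.1 - t) * v.1 + dotv (z.2 - x) v.2).

Lemma is_derive_quadratic t x tau p K z v :
  is_derive z v (quadratic t x tau p K : R * 'rV[R]_n -> R^o) (quadratic_slope t x tau p K v z).
Proof.
apply: (@derive_quadratic _ _ _ _ _ _ (K * (v.1 ^+ 2 + dotv v.2 v.2))) => h.
rewrite /quadratic /quadratic_slope.
have -> : (z + h *: v).1 = z.1 + h * v.1 by [].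
have -> : (z + h *: v).2 - x = (z.2 - x) + h *: v.2 by rewrite /= addrAC.
move: (z.2 - x) => y; rewrite !(dotvDl, dotvDr, dotvZl, dotvZr) (dotvC v.2 y); ring.
Qed.

Lemma differentiable_quadratic t x tau p K z :
  differentiable (quadratic t x tau p K : R * 'rV[R]_n -> R^o) z.
Proof.
pose a0 : R * 'rV[R]_n -> R := fun z => time_coord z + - t.
pose a (i : 'I_n) : R * 'rV[R]_n -> R := fun z => space_coord i z + - x ord0 i.
have d0 : differentiable (a0 : R * 'rV[R]_n -> R^o) z.
  exact: (differentiableD (differentiable_time_coord z) (differentiable_cst (- t : R^o) z)).
have di i : differentiable (a i : R * 'rV[R]_n -> R^o) z.
  exact: (differentiableD (differentiable_space_coord i z) (differentiable_cst (- x ord0 i : R^o) z)).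
pose b := \sum_(i < n) (cst (p ord0 i) * a i : R * 'rV[R]_n -> R).
pose q := \sum_(i < n) (a i * a i : R * 'rV[R]_n -> R).
have db : differentiable (b : R * 'rV[R]_n -> R^o) z.
  by apply: differentiable_sum => i; exact: differentiableM (differentiable_cst _ _) (di i).
have dq : differentiable (q : R * 'rV[R]_n -> R^o) z.
  by apply: differentiable_sum => i; exact: differentiableM (di i) (di i).
have -> : (quadratic t x tau p K : R * 'rV[R]_n -> R^o) = (cst tau * a0 + b) + cst K * (a0 * a0 + q).
  apply/funext => y; rewrite /quadratic.
  have -> : dotv p (y.2 - x) = b y.
    by rewrite /b fct_sumE; apply: eq_bigr => i _; rewrite !mxE.
  have -> : dotv (y.2 - x) (y.2 - x) = q y.
    by rewrite /q fct_sumE; apply: eq_bigr => i _; rewrite !mxE.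
  by rewrite expr2.
exact: (differentiableD (differentiableD (differentiableM (differentiable_cst _ _) d0) db)
  (differentiableM (differentiable_cst _ _) (differentiableD (differentiableM d0 d0) dq))).
Qed.

Lemma Ck1_quadratic Q t x tau p K : Ck 1 Q (quadratic t x tau p K : R * 'rV[R]_n -> R^o).
Proof.
split=> [z _|v]; first exact: differentiable_quadratic.
have -> : 'D_v (quadratic t x tau p K : R * 'rV[R]_n -> R^o) = quadratic_slope t x tau p K v :> (_ -> R^o).
  by apply/funext => z; have E := is_derive_quadratic t x tau p K z v; rewrite derive_val.
move=> z _; rewrite /quadratic_slope; apply: cvgD; first exact: cvg_cst.
apply: cvgM; first exact: cvg_cst.
apply: cvgD; first by apply: cvgM; [apply: cvgB; [exact: cvg_fst|exact: cvg_cst]|exact: cvg_cst].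
by apply: cvg_dotv; [apply: cvgB; [exact: cvg_snd|exact: cvg_cst]|exact: cvg_cst].
Qed.

Lemma dt_quadratic t x tau p K : dt (quadratic t x tau p K) (t, x) = tau.
Proof.
rewrite /dt; have E := is_derive_quadratic t x tau p K (t, x) (1, 0).
rewrite derive_val /quadratic_slope /= !subrr !dotv0r; ring.
Qed.

Lemma grad_x_quadratic t x tau p K : grad_x (quadratic t x tau p K) (t, x) = p.
Proof.
apply/rowP => i; rewrite mxE /=.
have E : is_derive x (delta_mx ord0 i) ((fun y => quadratic t x tau p K (t, y)) : 'rV[R]_n -> R^o) (p ord0 i).
  apply: (@derive_quadratic _ _ _ _ _ _ (K * dotv (delta_mx ord0 i) (delta_mx ord0 i))) => h.
  have xx : x + h *: delta_mx ord0 i - x = h *: delta_mx ord0 i by rewrite addrAC subrr add0r.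
  rewrite /quadratic /= xx !subrr !(dotvZl, dotvZr) !dotv0r.
  have -> : dotv p (delta_mx ord0 i) = p ord0 i.
    rewrite /dotv (bigD1 i)//= big1 => [|j ji]; first by rewrite addr0 mxE !eqxx mulr1.
    by rewrite mxE eqxx (negPf ji) mulr0.
  ring.
by rewrite derive_val.
Qed.

Lemma nbhs_box z (r : R) (P : R * 'rV[R]_n -> Prop) : 0 < r ->
  (forall t' x', `|t' - z.1| < r -> `|x' - z.2| < r -> P (t', x')) -> \forall z' \near z, P z'.
Proof.
move=> r0 h; apply: filterS (nbhsx_ballx z r r0) => -[t' x'] [/= b1 b2]; apply: h.
- by move: b1; rewrite -ball_normE /= distrC.
- by move: b2; rewrite -ball_normE /= distrC.
Qed.

Lemma quadratic_abs_le t x tau p C K z : `|C| <= K ->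
  tau * (z.1 - t) + dotv p (z.2 - x) + C * ((z.1 - t) ^+ 2 + `|z.2 - x| ^+ 2)
    <= quadratic t x tau p K z.
Proof.
move=> CK; rewrite lerD2l; set a := (z.1 - t) ^+ 2; have a0 : 0 <= a by exact: sqr_ge0.
have b0 := sqr_ge0 `|z.2 - x|; have bd := sqr_norm_le_dotv (z.2 - x).
apply: (@le_trans _ _ (K * (a + `|z.2 - x| ^+ 2))).
  by rewrite ler_wpM2r ?addr_ge0// (le_trans (ler_norm _)).
by rewrite ler_wpM2l ?lerD2l// (le_trans (normr_ge0 _) CK).
Qed.

Lemma quadratic_center t x tau p K : quadratic t x tau p K (t, x) = 0.
Proof. by rewrite /quadratic /= !subrr !dotv0r; ring. Qed.

Lemma visc_subsol_jet Q H u t x tau p C (r : R) : visc_subsol Q H u -> Q (t, x) -> 0 < r ->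
  (forall t' x', `|t' - t| < r -> `|x' - x| < r ->
    u (t', x') <= u (t, x) + tau * (t' - t) + dotv p (x' - x)
                  + C * ((t' - t) ^+ 2 + `|x' - x| ^+ 2)) ->
  tau + H (t, x) p <= 0.
Proof.
move=> vs Qz r0 jet; have := vs _ (Ck1_quadratic Q t x tau p `|C|) (t, x) Qz.
rewrite dt_quadratic grad_x_quadratic; apply; apply: (nbhs_box r0) => t' x' tt xx.
rewrite quadratic_center subr0 lerBlDr; apply: le_trans (jet t' x' tt xx) _.
have := quadratic_abs_le t x tau p (t', x') (lexx `|C|); rewrite /=; lra.
Qed.

Lemma visc_supersol_jet Q H u t x tau p C (r : R) : visc_supersol Q H u -> Q (t, x) -> 0 < r ->
  (forall t' x', `|t' - t| < r -> `|x' - x| < r ->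
    u (t, x) + tau * (t' - t) + dotv p (x' - x)
      - C * ((t' - t) ^+ 2 + `|x' - x| ^+ 2) <= u (t', x')) ->
  0 <= tau + H (t, x) p.
Proof.
move=> vs Qz r0 jet; have := vs _ (Ck1_quadratic Q t x tau p (- `|C|)) (t, x) Qz.
rewrite dt_quadratic grad_x_quadratic; apply; apply: (nbhs_box r0) => t' x' tt xx.
rewrite quadratic_center subr0 lerBrDr; apply: le_trans (jet t' x' tt xx).
have := quadratic_abs_le t x (- tau) (- p) (t', x') (lexx `|C|).
by rewrite /quadratic /= dotvNl; lra.
Qed.

End QuadraticTests.

(** * From the hypotheses of the theorem to the problem on a box *)

Section LocalProblemExists.
Context {R : realType} {n : nat}.
Implicit Types (x p q : 'rV[R]_n) (z : R * 'rV[R]_n).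

Lemma norm_sum2_le {E : normedModType R} (f : 'I_n -> 'I_n -> E) (L : 'I_n -> 'I_n -> R) (Y : R) :
  (forall i j, `|f i j| <= L i j * Y) ->
  `|\sum_i \sum_j f i j| <= (\sum_i \sum_j L i j) * Y.
Proof.
move=> h; apply: le_trans (ler_norm_sum _ _ _) _; rewrite mulr_suml; apply: ler_sum => i _.
apply: le_trans (ler_norm_sum _ _ _) _; rewrite mulr_suml; exact: ler_sum.
Qed.

Lemma dotv_sum2l (f : 'I_n -> 'I_n -> 'rV[R]_n) q :
  dotv (\sum_i \sum_j f i j) q = \sum_i \sum_j dotv (f i j) q.
Proof.
have m : {morph (fun p => dotv p q) : p p' / p + p' >-> p + p'} by move=> p p'; exact: dotvDl.
rewrite (big_morph _ m (dotv0l q)); apply: eq_bigr => i _.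
by rewrite (big_morph _ m (dotv0l q)).
Qed.

Lemma matrix_box_bounds (D : set (R * 'rV[R]_n)) (A : R * 'rV[R]_n -> 'M[R]_n) (y0 : 'rV[R]_n) (s0 rho : R) :
  (forall i j, Ck_on 2 D (fun z => A z i j)) -> box y0 s0 rho `<=` D ->
  exists2 L, 0 <= L & forall z, box y0 s0 rho z -> forall p,
    [/\ `|mxact (A z) p| <= L * `|p|,
      forall z', box y0 s0 rho z' -> `|mxact (A z') p - mxact (A z) p| <= L * dist1 z z' * `|p| &
      exists (h0 : R) (h1 : 'rV[R]_n), [/\ `|h0| <= L * `|p| ^+ 2, `|h1| <= L * `|p| ^+ 2 &
        forall z', box y0 s0 rho z' ->
          `|dotv (mxact (A z') p) p - dotv (mxact (A z) p) p - h0 * (z'.1 - z.1) - dotv h1 (z'.2 - z.2)|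
          <= L * `|p| ^+ 2 * dist1 z z' ^+ 2]].
Proof.
move=> CA BD.
have ex i j : exists M : R, 0 <= M /\ forall z, box y0 s0 rho z ->
    [/\ `|A z i j| <= M, forall z', box y0 s0 rho z' -> `|A z' i j - A z i j| <= M * dist1 z z' &
    exists (l0 : R) (l1 : 'rV[R]_n), [/\ `|l0| <= M, `|l1| <= M & forall z', box y0 s0 rho z' ->
      `|A z' i j - A z i j - l0 * (z'.1 - z.1) - dotv l1 (z'.2 - z.2)| <= M * dist1 z z' ^+ 2]].
  by have [M M0 MP] := C2_box_expansion (CA i j) BD; exists M.
have [L1 L1P] := choice (fun ij : 'I_n * 'I_n => ex ij.1 ij.2).
pose L i j := L1 (i, j); have LP i j := L1P (i, j); rewrite /= in LP.
have L0 i j : 0 <= L i j by have [] := LP i j.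
pose S := \sum_i \sum_j L i j.
have row_le i : \sum_j L i j <= S.
  by rewrite /S [leRHS](bigD1 i)//= lerDl sumr_ge0// => k _; exact: sumr_ge0.
have S0 : 0 <= S by apply: sumr_ge0 => i _; exact: sumr_ge0.
exists S => // z zB p; split.
- apply: norm_row_le => [|i]; first by rewrite mulr_ge0.
  rewrite mxactE; apply: le_trans (ler_norm_sum _ _ _) _.
  apply: (@le_trans _ _ ((\sum_j L i j) * `|p|)); last by rewrite ler_wpM2r.
  rewrite mulr_suml; apply: ler_sum => j _; rewrite normrM; apply: ler_pM => //; last exact: norm_coord.
  by have [_ /(_ z zB)[]] := LP i j.
- move=> z' z'B; apply: norm_row_le => [|i]; first by rewrite mulr_ge0 ?mulr_ge0 ?dist1_ge0.
  rewrite !mxE -sumrB; apply: le_trans (ler_norm_sum _ _ _) _.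
  apply: (@le_trans _ _ ((\sum_j L i j) * (dist1 z z' * `|p|))); last first.
    by rewrite -mulrA ler_wpM2r ?mulr_ge0 ?dist1_ge0.
  rewrite mulr_suml; apply: ler_sum => j _; rewrite !mxE -mulrBr normrM mulrC mulrA.
  apply: ler_pM => //; last exact: norm_coord.
  by have [_ /(_ z zB)[_ h _]] := LP i j; exact: h.
have ex2 i j : exists l : R * 'rV[R]_n,
    [/\ `|l.1| <= L i j, `|l.2| <= L i j & forall z', box y0 s0 rho z' ->
      `|A z' i j - A z i j - l.1 * (z'.1 - z.1) - dotv l.2 (z'.2 - z.2)| <= L i j * dist1 z z' ^+ 2].
  by have [_ /(_ z zB)[_ _ [l0 [l1 h]]]] := LP i j; exists (l0, l1).
have [l1 l1P] := choice (fun ij : 'I_n * 'I_n => ex2 ij.1 ij.2).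
pose l i j := l1 (i, j); have lP i j := l1P (i, j); rewrite /= in lP.
have pp i j : `|p ord0 j * p ord0 i| <= `|p| ^+ 2.
  by rewrite normrM expr2; apply: ler_pM => //; exact: norm_coord.
exists (\sum_i \sum_j (l i j).1 * (p ord0 j * p ord0 i)),
  (\sum_i \sum_j (p ord0 j * p ord0 i) *: (l i j).2); split.
- apply: norm_sum2_le => i j; rewrite normrM; apply: ler_pM => //.
  by have [] := lP i j.
- apply: norm_sum2_le => i j; rewrite normrZ mulrC; apply: ler_pM => //.
  by have [] := lP i j.
move=> z' z'B; rewrite !dotv_mxact dotv_sum2l mulr_suml -!sumrB.
rewrite -[leRHS]mulrA.
under eq_bigr do rewrite mulr_suml -!sumrB.
apply: norm_sum2_le => i j; rewrite dotvZl.
have -> : A z' i j * p ord0 j * p ord0 i - A z i j * p ord0 j * p ord0 i -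
   (l i j).1 * (p ord0 j * p ord0 i) * (z'.1 - z.1) - p ord0 j * p ord0 i * dotv (l i j).2 (z'.2 - z.2)
  = (p ord0 j * p ord0 i) * (A z' i j - A z i j - (l i j).1 * (z'.1 - z.1) - dotv (l i j).2 (z'.2 - z.2)) by ring.
rewrite normrM mulrCA; apply: ler_pM => //.
by have [_ _ h] := lP i j; exact: h.
Qed.

Lemma local_solution_exists (Om : set 'rV[R]_n) (T c1 : R)
    (A : R * 'rV[R]_n -> 'M[R]_n) (V : R * 'rV[R]_n -> R)
    (u0 : 'rV[R]_n -> R) (u : R * 'rV[R]_n -> R) (y0 : 'rV[R]_n) :
  open Om -> 0 < T -> Ck_on 2 (`[0, T] `*` Om) V ->
  (forall z, (`[0, T] `*` Om) z -> (A z)^T = A z) ->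
  (forall i j, Ck_on 2 (`[0, T] `*` Om) (fun z => A z i j)) ->
  0 < c1 -> (forall z, (`[0, T] `*` Om) z -> form_lt c1%:M (A z)) ->
  locally_lipschitz Om u0 -> cont_visc_sol T Om (hamiltonian A V) u0 u -> Om y0 ->
  exists s0 rho c, [/\ local_solution A V u y0 s0 rho c, s0 < T & forall x, `|x - y0| <= rho -> Om x].
Proof.
move=> oOm T0 CV As CA c10 Ac lipu0 [cu vsub vsuper uu0] Oy0.
have [W Wy0 [M0 [_ lipW]]] := lipu0 y0 Oy0.
have /nbhs_ballP[r0 /= r00 r0P] : nbhs y0 (Om `&` W) by apply: filterI => //; exact: open_nbhs_nbhs.
pose rho := Num.min 1 (r0 / 2).
have rho0 : 0 < rho by rewrite lt_min ltr01 divr_gt0.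
have rho1 : rho <= 1 by rewrite ge_min lexx.
have rhor : rho < r0 by rewrite gt_min; apply/orP; right; rewrite ltr_pdivrMr//; lra.
have OW x : `|x - y0| <= rho -> Om x /\ W x.
  by move=> xr; apply: r0P; rewrite -ball_normE /= distrC; exact: le_lt_trans rhor.
pose s0 := Num.min 1 (T / 2).
have s00 : 0 < s0 by rewrite lt_min ltr01 divr_gt0.
have s01 : s0 <= 1 by rewrite ge_min lexx.
have s0T : s0 < T by rewrite gt_min; apply/orP; right; rewrite ltr_pdivrMr//; lra.
clearbody rho s0.
have BD : box y0 s0 rho `<=` `[0, T] `*` Om.
  move=> [t x] [/= /andP[h1 h2] h3]; split; last by have [] := OW x h3.
  by rewrite /= in_itv /= h1; lra.
have BD' : box y0 s0 rho `<=` `[0, T[ `*` Om.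
  move=> [t x] [/= /andP[h1 h2] h3]; split; last by have [] := OW x h3.
  by rewrite /= in_itv /= h1; lra.
have [LA LA0 LAP] := matrix_box_bounds CA BD.
have [LV LV0 LVP] := C2_box_expansion CV BD.
have cuB : {within box y0 s0 rho, continuous u} := continuous_subspaceW BD' cu.
have [Mu [Mu0 MuP]] : exists M, 0 <= M /\ forall z, box y0 s0 rho z -> `|u z| <= M.
  have [M [_ MP]] := compact_bounded (continuous_compact cuB (@box_compact _ _ _ _ _)).
  exists (`|M| + 1); split; first by rewrite addr_ge0.
  move=> z zB; apply: (MP (`|M| + 1)); last by exists z.
  by rewrite (le_lt_trans (ler_norm _))// ltrDl.
have lip x x' : `|x - y0| <= rho -> `|x' - y0| <= rho ->
    `|u (0, x') - u (0, x)| <= (`|M0| + 1) * `|x' - x|.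
  move=> xr x'r; have [Ox Wx] := OW x xr; have [Ox' Wx'] := OW x' x'r.
  rewrite !uu0//; have M1 : M0 < `|M0| + 1 by rewrite (le_lt_trans (ler_norm _))// ltrDl.
  exact: (lipW _ M1 (x', x) (conj Wx' Wx)).
have ci0 : 0 < c1^-1 by rewrite invr_gt0.
have n0 : 0 <= n%:R :> R by [].
have M00 := normr_ge0 M0.
(* One constant for all bounds of [local_solution]: [n] compares the pairing with sup norms, [c1^-1]
   expresses ellipticity, [LA] and [LV] come from the expansions of the coefficients, [Mu] bounds
   [u], and [|M0| + 1] is a Lipschitz constant of [u0] near [y0]. *)
pose c := 2 + n%:R + c1^-1 + LA + LV + Mu + `|M0|.
have [c_1 nc cic [LAc LVc Muc Mc]] : [/\ 1 <= c, n%:R <= c, c1^-1 <= c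
    & [/\ LA <= c, LV <= c, Mu <= c & `|M0| + 1 <= c]].
  clear -LA0 LV0 Mu0 ci0 n0 M00; by rewrite /c; split; [lra..|split; lra].
clearbody c.
have c0 : 0 <= c by exact: le_trans ler01 c_1.
have leM (a X Y : R) : 0 <= X -> Y <= a * X -> a <= c -> Y <= c * X.
  by move=> X0 h ac; apply: le_trans h _; rewrite ler_wpM2r.
exists s0, rho, c; split => //; last by move=> x /OW[].
have pos z z' : 0 <= dist1 z z' by exact: dist1_ge0.
split => //.
- by rewrite s00.
- by rewrite rho0.
- move=> p q; rewrite -mulrA; apply: (leM n%:R); first by rewrite mulr_ge0.
    by rewrite mulrA; exact: ler_dotv.
  exact: nc.
- by move=> z /BD; exact: As.
- move=> z p zB; have [->|pn0] := eqVneq p 0.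
    by rewrite normr0 expr0n /= /mxact mul0mx dotv0l mulr0.
  have := Ac z (BD z zB) p pn0.
  have -> : mxact c1%:M p = c1 *: p by rewrite /mxact tr_scalar_mx mul_mx_scalar.
  rewrite dotvZl => h.
  have ap : `|p| ^+ 2 <= c1^-1 * dotv (mxact (A z) p) p.
    rewrite mulrC ler_pdivlMr// mulrC; apply: le_trans (ltW h).
    by rewrite ler_wpM2l ?(ltW c10)// sqr_norm_le_dotv.
  apply: leM ap cic.
  apply: ltW; apply: le_lt_trans h; rewrite mulr_ge0 ?(ltW c10)//; exact: dotvv_ge0.
- move=> z p zB; have [h _ _] := LAP z zB p; exact: leM h LAc.
- move=> z z' p zB z'B; have [_ h _] := LAP z zB p.
  rewrite -mulrA; apply: (leM LA); first by rewrite mulr_ge0.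
    by rewrite mulrA; exact: h.
  exact: LAc.
- by move=> z zB; have [h _ _] := LVP z zB; exact: le_trans h LVc.
- by move=> z z' zB z'B; have [_ h _] := LVP z zB; exact: leM (h z' z'B) LVc.
- move=> z p zB; have [_ _ [h0 [h1 [h0b h1b hP]]]] := LAP z zB p.
  have [_ _ [l0 [l1 [l0b l1b lP]]]] := LVP z zB.
  have p2 := sqr_ge0 `|p|.
  have LAV : LA * `|p| ^+ 2 + LV <= c * (1 + `|p| ^+ 2).
    have a1 : LA * `|p| ^+ 2 <= c * `|p| ^+ 2 by rewrite ler_wpM2r.
    by rewrite mulrDr mulr1 addrC lerD.
  have LAp : 0 <= LA * `|p| ^+ 2 by rewrite mulr_ge0.
  exists (2^-1 * h0 + l0), (2^-1 *: h1 + l1); split.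
  + apply: le_trans (ler_normD _ _) (le_trans _ LAV); rewrite lerD//.
    by rewrite normrM ger0_norm//; apply: le_trans h0b; rewrite ler_piMl// invf_le1// ler1n.
  + apply: le_trans (ler_normD _ _) (le_trans _ LAV); rewrite lerD//.
    by rewrite norm_scale_ge0//; apply: le_trans h1b; rewrite ler_piMl// invf_le1// ler1n.
  move=> z' z'B; have d2 := sqr_ge0 (dist1 z z').
  have := hP z' z'B; have := lP z' z'B.
  set X := _ - dotv l1 _; set Y := _ - dotv h1 _ => hX hY.
  have -> : hamiltonian A V z' p - hamiltonian A V z p - (2^-1 * h0 + l0) * (z'.1 - z.1)
      - dotv (2^-1 *: h1 + l1) (z'.2 - z.2) = 2^-1 * Y + X.
    by rewrite /hamiltonian /X /Y dotvDl dotvZl; ring.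
  apply: le_trans (ler_normD _ _) _; rewrite normrM (ger0_norm (_ : 0 <= 2^-1))//.
  apply: le_trans (ler_wpM2r d2 LAV); rewrite mulrDl; apply: lerD => //.
  by apply: le_trans hY; rewrite ler_piMl// invf_le1// ler1n.
- by move=> z zB; exact: le_trans (MuP z zB) Muc.
- move=> x x' xr x'r; exact: leM (lip x x' xr x'r) Mc.
- move=> t x tau p C r /andP[t0 ts] xr r1 jet.
  apply: (visc_subsol_jet vsub _ r1 jet); split => /=; first by rewrite in_itv /= t0 (lt_trans ts).
  by have [] := OW x (ltW xr).
- move=> t x tau p C r /andP[t0 ts] xr r1 jet.
  apply: (visc_supersol_jet vsuper _ r1 jet); split => /=; first by rewrite in_itv /= t0 (lt_trans ts).
  by have [] := OW x (ltW xr).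
Qed.

End LocalProblemExists.

Theorem theorem6 (R : realType) (n : nat) (Om : set 'rV[R]_n) (T : R)
    (A : R * 'rV[R]_n -> 'M[R]_n) (V : R * 'rV[R]_n -> R) (c1 c2 : R)
    (u0 : 'rV[R]_n -> R) (u : R * 'rV[R]_n -> R) (y0 : 'rV[R]_n) :
  open Om -> 0 < T ->
  Ck_on 2 (`[0, T] `*` Om) V ->
  (forall z, (`[0, T] `*` Om) z -> sym_posdef (A z)) ->
  (forall i j, Ck_on 2 (`[0, T] `*` Om) (fun z => A z i j)) ->
  0 < c1 -> 0 < c2 ->
  (forall z, (`[0, T] `*` Om) z ->
    form_lt c1%:M (A z) /\ form_lt (A z) c2%:M) ->
  locally_lipschitz Om u0 ->
  cont_visc_sol T Om (hamiltonian A V) u0 u ->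
  Om y0 -> proximal_subdiff u0 y0 = set0 ->
  exists (sigma : R) (gamma : R -> 'rV[R]_n),
    [/\ 0 < sigma,
        gen_char_ico T Om (hamiltonian A V) u gamma sigma,
        gamma 0 = y0
      & forall t, 0 < t < sigma ->
          ~ differentiable (u : R * 'rV[R]_n -> R^o) (t, gamma t)].
Proof.
move=> oOm T0 CV Apd CA c10 c20 Ac lipu0 sol Oy0 noprox.
have [s0 [rho [c [LS s0T ballOm]]]] := local_solution_exists oOm T0 CV
  (fun z zD => (Apd z zD).1) CA c10 (fun z zD => (Ac z zD).1) lipu0 sol Oy0.
have [_ _ _ uu0] := sol; have /andP[rho0 _] := ls_rho LS.
apply: (singular_characteristic LS s0T ballOm) => p K r K0 r0 P.
suff : proximal_subdiff u0 y0 p by rewrite noprox.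
(* The factor 2 matches the [K / 2] of a proximal subgradient. Passing from the sup norm to the
   larger Euclidean norm only lowers the paraboloid. *)
exists (2 * K); first by rewrite mulr_gt0.
have m0 : 0 < Num.min r rho by rewrite lt_min r0.
apply: filterS (nbhsx_ballx y0 _ m0) => x.
rewrite -ball_normE /= distrC lt_min => /andP[xr xrho].
have Ox : Om x by apply: ballOm; exact: ltW.
have := P (x - y0) (ltW xr); rewrite (addrC y0) subrK !uu0// => h; apply: le_trans h.
rewrite lerD2l lerN2 (mulrC 2) mulfK ?pnatr_eq0// ler_wpM2l ?(ltW K0)// enorm_sqr.
exact: sqr_norm_le_dotv.
Qed.
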